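(* Let $(W,G)$ be a Berglund-Hübsch potential and group with associated data $M,N,\Delta,\Delta^\vee,K_N$. Let $f:\Delta\to\mathbb C$ and $g:\Delta^\vee\to\mathbb C$ be generic coefficient functions (in this setting: all $f(m)$ and $g(n)$ are nonzero). Then the cohomology of ${\rm Fock}_{M\oplus N}$ with respect to $D_{f,g}$ is equal to the cohomology of ${\rm Fock}_{M\oplus K_N}$ with respect to $D_{f,g}$; that is, the inclusion ${\rm Fock}_{M\oplus K_N}\subseteq{\rm Fock}_{M\oplus N}$ induces an isomorphism on $D_{f,g}$-cohomology.
   Context: **Berglund-Hübsch data.** Let $(a_{ij})$ be an invertible $d\times d$ matrix of nonnegative integers and $W=\sum_{i=1}^d\prod_{j=1}^d x_j^{a_{ij}}$. Assume there are positive rationals $q_j$ with $\sum_j a_{ij}q_j=1$ for all $i$, and that $W$ is nondegenerate: the hypersurface $W=0$ in $\mathbb C^d$ is smooth away from the origin. ${\rm Aut}(W)$ is the finite group of diagonal $\gamma=(\gamma_j)\in(\mathbb C^* )^d$ preserving $W$ under $x_j\mapsto\gamma_jx_j$, and $G\subseteq{\rm Aut}(W)$ is a subgroup. Let $M_0=\bigoplus_i\mathbb Z u_i$, $N_0=\bigoplus_j\mathbb Z v_j$ with the pairing $u_i\cdot v_j=a_{ij}$, extended bilinearly. Put $N=\{\sum_jt_jv_j\in N_0\otimes\mathbb Q:(e^{2\pi i t_j})_j\in G\}$ and $M=\{m\in M_0\otimes\mathbb Q: m\cdot n\in\mathbb Z\ \forall n\in N\}$, dual lattices of rank $d$. Put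 $\Delta=\{u_i\}$, $\Delta^\vee=\{v_j\}$, $K_N=\sum_j\mathbb Q_{\ge0}v_j$. **Lattice vertex algebra.** For a field write $a(z)=\sum_l a_{(l)}z^{-l-1}$; then ${\rm Res}_{z=0}a(z)=a_{(0)}$. ${\rm Fock}_{M\oplus N}$ is the tensor product of the lattice vertex algebra of the even lattice $M\oplus N$ with form $(m+n,m'+n')=m\cdot n'+m'\cdot n$ and the free fermion vertex superalgebra generated by odd fields $m^{ferm}(z),n^{ferm}(z)$ ($m\in M_{\mathbb C}$, $n\in N_{\mathbb C}$, linear in $m,n$) with $m^{ferm}(z)n^{ferm}(w)\sim\frac{m\cdot n}{z-w}$ and trivial singular OPEs among the $m^{ferm}$'s and among the $n^{ferm}$'s. The Heisenberg (even) fields satisfy $m^{bos}(z)n^{bos}(w)\sim\frac{m\cdot n}{(z-w)^2}$, with other singular OPEs zero. $e^{\int m^{bos}(z)+n^{bos}(z)}$ denotes the lattice vertex operator (with standard normal ordering and cocycle) of $m+n\in M\oplus N$. ${\rm Fock}_{m\oplus n}$ is the subspace of lattice degree $m+n$, i.e. where $\tilde m^{bos}_{(0)}$ acts by $\tilde m\cdot n$ and $\tilde n^{bos}_{(0)}$ by $m\cdot\tilde n$. ${\rm Fock}_{M\oplus K_N}=\bigoplus_{m\in M,\,n\in K_N\cap N}{\rm Fock}_{m\oplus n}$. **Differential.** $$D_{f,g}={\rm Res}_{z=0}\Big(\sum_{m\in\Delta}f(m)m^{ferm}(z)e^{\int m^{bos}(z)}+\sum_{n\in\Delta^\vee}g(n)n^{ferm}(z)e^{\int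 n^{bos}(z)}\Big),$$ an odd operator with $D_{f,g}^2=0$, preserving ${\rm Fock}_{M\oplus K_N}$. *)

(* Defs.v *)
From mathcomp Require Import all_boot all_order all_algebra.
From mathcomp Require Import finmap multiset monalg.
From mathcomp Require mpoly.
Import (canonicals, coercions) mpoly.
From mathcomp Require Import boolp classical_sets functions fsbigop reals trigo.
From mathcomp Require Import complex.

Set Implicit Arguments.
Unset Strict Implicit.
Unset Printing Implicit Defensive.

Import Order.TTheory GRing.Theory Num.Theory.
Local Open Scope ring_scope.
Local Open Scope classical_set_scope.

Section BerglundHubsch.
Context (R : realType) (d : nat) (a : 'M[nat]_d).
Local Notation C := R[i].

Definition exponent_matrix : 'M[rat]_d := map_mx (fun k : nat => k%:R) a.

Definition Wvar (j : 'I_d) : mpoly.mpoly d C := mpoly.mpolyX C (mpoly.mnm1 j).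

Definition W : mpoly.mpoly d C := \sum_i \prod_j Wvar j ^+ a i j.

Definition quasihomogeneous : Prop :=
  exists q : 'I_d -> rat,
    (forall j, 0 < q j) /\ (forall i, \sum_j (a i j)%:R * q j = 1).

Definition nondegenerate : Prop :=
  forall x : 'I_d -> C, (exists j, x j != 0) -> mpoly.meval x W = 0 ->
    exists j, mpoly.meval x (mpoly.mderiv j W) != 0.

Definition BH_potential : Prop :=
  [/\ exponent_matrix \in unitmx, quasihomogeneous & nondegenerate].

Definition AutW : set ('I_d -> C) :=
  [set y | (forall j, y j != 0) /\
           mpoly.comp_mpoly [tuple y j *: Wvar j | j < d] W = W].

Definition subgroup_of_AutW (G : set ('I_d -> C)) : Prop :=
  [/\ G `<=` AutW, G (fun=> 1),
      forall y z, G y -> G z -> G (fun j => y j * z j)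
    & forall y, G y -> G (fun j => (y j)^-1)].

(* e^{2 pi i t} *)
Definition exp2pii (t : rat) : C :=
  (cos (2 * pi * ratr t) +i* sin (2 * pi * ratr t))%C.

(* Row vectors over rat are coordinates: an element of M_0 (x) Q is given in
   the basis (u_i), an element of N_0 (x) Q in the basis (v_j). *)
Definition pairing (m n : 'rV[rat]_d) : rat :=
  (m *m exponent_matrix *m n^T) 0 0.

Definition latN (G : set ('I_d -> C)) : set 'rV[rat]_d :=
  [set n | G (fun j => exp2pii (n 0 j))].

Definition latM (G : set ('I_d -> C)) : set 'rV[rat]_d :=
  [set m | forall n, latN G n -> pairing m n \is a Num.int].

Definition coneKN : set 'rV[rat]_d := [set n | forall j, 0 <= n 0 j].

End BerglundHubsch.

Section FockSpace.
Context (R : realType) (d : nat) (a : 'M[nat]_d).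
Local Notation C := R[i].

(* Lattice degrees m + n. *)
Definition degree : Type := ('rV[rat]_d * 'rV[rat]_d)%type.

Definition form (x y : degree) : rat :=
  pairing a x.1 y.2 + pairing a y.1 x.2.

(* inl i stands for u_i and inr j for v_j; they span M_C (+) N_C, so their
   fields determine all the fields m^bos, n^bos, m^ferm, n^ferm. *)
Definition gen : Type := ('I_d + 'I_d)%type.

Definition gen_degree (s : gen) : degree :=
  match s with
  | inl i => (delta_mx 0 i, 0)
  | inr j => (0, delta_mx 0 j)
  end.

(* (s, k) stands for the creation operator s^bos_(-k-1), resp. s^ferm_(-k-1). *)
Definition mode : Type := (gen * nat)%type.

(* (lambda, B, F) stands for the vector obtained from the highest weight vector
   |lambda> by applying the bosonic creation operators in the multiset B and
   the fermionic ones in F, the latter in the order of their pickle codes. *)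
Definition state : Type := (degree * {mset mode}%mset * {fset mode})%type.

(* The direct sum of Fock_{m+n} over all (m, n) in (M (+) N) (x) Q; the actual
   Fock spaces are the subspaces [Fock S] below.  On a degree where s_(0) is not
   an integer the vertex operators of s below have no integral power of z, hence
   vanish; this never happens on M (+) N. *)
Definition space : Type := {malg C[state]}.

Definition linext (phi : state -> space) (x : space) : space :=
  \sum_(e <- msupp x) mcoeff e x *: phi e.

Definition bos_create (g : mode) : space -> space :=
  linext (fun e => let: (l, B, F) := e in << (l, msetD [mset g]%mset B, F) >>).

Definition bos_derive (g : mode) : space -> space :=
  linext (fun e => let: (l, B, F) := e in
    (B g)%:R *: << (l, msetB B [mset g]%mset, F) >>).

Definition koszul_sign (g : mode) (F : {fset mode}) : C :=
  (-1) ^+ count (fun h => (choice.pickle h < choice.pickle g)%N) (enum_fset F).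

Definition ferm_create (g : mode) : space -> space :=
  linext (fun e => let: (l, B, F) := e in
    if g \in F then 0 else koszul_sign g F *: << (l, B, (g |` F)%fset) >>).

Definition ferm_derive (g : mode) : space -> space :=
  linext (fun e => let: (l, B, F) := e in
    if g \in F then koszul_sign g F *: << (l, B, (F `\ g)%fset) >> else 0).

Definition gen_form (s t : gen) : C := ratr (form (gen_degree s) (gen_degree t)).

(* The modes s^bos_(l) and s^ferm_(l). *)
Definition bos (s : gen) (l : int) (x : space) : space :=
  match l with
  | Negz k => bos_create (s, k) x
  | Posz 0 => linext (fun e => ratr (form (gen_degree s) e.1.1) *: << e >>) x
  | Posz k.+1 => \sum_(t : gen) (k.+1%:R * gen_form s t) *: bos_derive (t, k) x
  end.

Definition ferm (s : gen) (l : int) (x : space) : space :=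
  match l with
  | Negz k => ferm_create (s, k) x
  | Posz k => \sum_(t : gen) gen_form s t *: ferm_derive (t, k) x
  end.

(* For a formal series b(z) = sum_(k >= 1) b_k z^k of commuting operators,
   [pow_coef b n p] is the coefficient of z^p in b(z)^n and [exp_coef b p] the
   one in exp(b(z)); b(z)^n starts in degree n. *)
Fixpoint pow_coef (b : nat -> space -> space) (n p : nat) (x : space) : space :=
  match n with
  | 0 => if p == 0%N then x else 0
  | n'.+1 => \sum_(1 <= k < p.+1) b k (pow_coef b n' (p - k) x)
  end.

Definition exp_coef (b : nat -> space -> space) (p : nat) (x : space) : space :=
  \sum_(n < p.+1) (n`!%:R)^-1 *: pow_coef b n p x.

(* Coefficient of z^p in exp(sum_(k >= 1) s_(-k) z^k / k). *)
Definition exp_minus (s : gen) (p : nat) : space -> space :=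
  exp_coef (fun k x => (k%:R)^-1 *: bos s (- k%:Z) x) p.

(* Coefficient of z^(-q) in exp(- sum_(k >= 1) s_(k) z^(-k) / k). *)
Definition exp_plus (s : gen) (q : nat) : space -> space :=
  exp_coef (fun k x => - (k%:R)^-1 *: bos s k%:Z x) q.

(* (-1)^(m . n') for (m + n, m' + n'), a bimultiplicative cocycle on the
   lattice with c(x, y) c(y, x) = (-1)^(form x y).  The floor only serves to
   read the rational m . n', an integer on the lattice, as an int. *)
Definition cocycle (x y : degree) : C := (-1) ^ Num.floor (pairing a x.1 y.2).

(* The lattice translation e^s. *)
Definition translate (s : gen) : space -> space :=
  linext (fun e => let: (l, B, F) := e in
    cocycle (gen_degree s) l *: << (gen_degree s + l, B, F) >>).

(* Coefficient of z^l in the lattice vertex operator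
     e^{\int s^bos(z)} = e^s z^(s_(0)) exp(sum_(k >= 1) s_(-k) z^k / k)
                                       exp(- sum_(k >= 1) s_(k) z^(-k) / k).
   Only finitely many (p, q) contribute. *)
Definition vertex_coef (s : gen) (l : int) : space -> space :=
  linext (fun e =>
    \sum_(pq \in [set pq : nat * nat |
        form (gen_degree s) e.1.1 + pq.1%:R - pq.2%:R = l%:~R])
      translate s (exp_minus s pq.1 (exp_plus s pq.2 << e >>))).

(* Res_{z=0} s^ferm(z) e^{\int s^bos(z)}: the coefficient s_(l) of z^(-l-1) in
   the fermionic field meets that of z^l in the vertex operator.  Only finitely
   many l contribute. *)
Definition residue (s : gen) (x : space) : space :=
  \sum_(l \in [set: int]) ferm s l (vertex_coef s l x).

Definition Dfg (f g : 'I_d -> C) (x : space) : space :=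
  \sum_i f i *: residue (inl i) x + \sum_j g j *: residue (inr j) x.

(* The direct sum of Fock_{m+n} over (m, n) in S. *)
Definition Fock (S : set degree) : set space :=
  [set x | forall e, e \in msupp x -> S e.1.1].

Definition Fock_MN (G : set ('I_d -> C)) : set space :=
  Fock [set l | latM a G l.1 /\ latN G l.2].

Definition Fock_MKN (G : set ('I_d -> C)) : set space :=
  Fock [set l | latM a G l.1 /\ (latN G l.2 /\ coneKN l.2)].

End FockSpace.

(* For a differential D on V and a D-stable subspace S, [cohomology D S] is the
   set of cosets of D(S) in the kernel of D on S. *)
Section Cohomology.
Context (V : zmodType) (D : V -> V).

Definition coset_class (S : set V) (x : V) : set V :=
  [set y | exists2 z, S z & y - x = D z].

Definition cohomology (S : set V) : set (set V) :=
  [set coset_class S x | x in [set x | S x /\ D x = 0]].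

(* The map H(S) -> H(T) induced by an inclusion of S in T: it sends x + D(S) to
   x + D(T), hence is linear when D is. *)
Definition inclusion_map (T : set V) (c : set V) : set V :=
  [set y | exists2 x, c x & coset_class T x y].

Definition inclusion_iso (S T : set V) : Prop :=
  set_bij (cohomology S) (cohomology T) (inclusion_map T).

End Cohomology.

(* Main.v *)
Require Import Defs.
From HB Require Import structures.
From mathcomp Require Import all_boot all_order all_algebra.
From mathcomp Require mpoly.
Import (canonicals, coercions) mpoly.
From mathcomp Require Import boolp classical_sets functions cardinality fsbigop.
From mathcomp Require Import reals trigo.
From mathcomp Require Import finmap multiset monalg complex zify lra ring.
Require Import Defs.

Set Implicit Arguments.
Unset Strict Implicit.
Unset Printing Implicit Defensive.
Import Order.TTheory GRing.Theory Num.Theory.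
Local Open Scope ring_scope.

(** Why the inclusion induces an isomorphism.

    Write the elements m of M (x) Q as Laurent monomials x^m with exponents
    m . v_j, so that u_i is the i-th monomial x^(a_i) of the potential, and let
    W_f = sum_i f_i x^(a_i).  For a monomial x^m and an index j consider
      psi_j(m)  = Res z^(-1) v_j^ferm(z) e^{int m - v_j^*}(z),
      theta(m)  = Res z^(-1) e^{int m}(z),
    where v_j^* is the basis of M (x) Q dual to (v_j).  Wick's formula computes
    their anticommutators with the summands of the differential.
    - The exponentials of u_i and m do not interact, and u_i^ferm contracts
      with v_j^ferm to u_i . v_j = a_ij; hence the f-part of D sends psi_j(m)
      to theta(x^m d_j W_f), extended linearly ([bracket_psi_u]).
    - The summand of v_l anticommutes with psi_j(m) as soon as the exponent of
      x_l in x^m is nonnegative ([bracket_psi_v]).  The only possible pole is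
      the simple one for l = j and exponent 0; there the product of the two
      odd fields v_j^ferm vanishes on the diagonal and cancels it.

    Nondegeneracy says that some power of each coordinate x_k lies in the
    Jacobian ideal of W_f ([jacobian_nilpotent]): all f_i being nonzero, W_f
    has the same monomials as W, and these decide.  Divide a relation
    x_k^r = sum_j p_j d_j W_f by x_k^r and let H be the corresponding sum of the
    operators psi_j.  As theta(1) = 1, this gives
      D H + H D = 1 + N,    N = g_k (D_k H + H D_k),
    D_k being the summand of v_k, the one variable allowed to have negative
    exponents ([bracket_diff_op]).  So - N is a chain map homotopic to the
    identity.  It keeps the M-part of the degree in M, and it
    raises the k-th coordinate of the N-part by one while fixing the others.
    A power of - N therefore moves any vector to where that coordinate is
    nonnegative, and the inclusion of the subcomplex with nonnegative k-th
    coordinate is a quasi-isomorphism ([quasi_iso_homotopy], [stage_step]).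
    Imposing the conditions on the coordinates one after the other leads from
    Fock_{M + N} to Fock_{M + K_N}.

    Two ingredients need work.  The vertex operator calculus is done with
    operators on a vector space and locally finite sums of them.  An exponential
    of modes is known through its logarithmic derivative; this gives the
    exchange relation T(z) S(w) = (1 - w/z)^c S(w) T(z) ([expseq_exchange]), from
    which locality follows by comparing coefficients of (1 - x)^c for c >= 0 and
    of its inverse for c = -1.  The membership of x_k^r in the
    Jacobian ideal is proved by induction on coordinate subspaces, using
    nondegeneracy at one well-chosen point of each subspace
    ([pointer_exists]). *)

(** * Linear endomorphisms and locally finite sums *)

(** A record rather than {linear V -> V}, to carry the ring structure given by
    composition. *)
Record endo (C : comNzRingType) (V : lmodType C) :=
  Endo { endo_fun :> V -> V; endo_linear : linear endo_fun }.

Section EndoRing.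
Context (C : comNzRingType) (V : lmodType C).
Local Notation E := (endo V).
Implicit Types (A B : E) (c : C) (x y : V).

HB.instance Definition _ := gen_eqMixin E.
HB.instance Definition _ := gen_choiceMixin E.

Lemma endoP A B : A =1 B -> A = B.
Proof.
case: A B => [f lf] [g lg] /= /funext e; subst g.
by congr Endo; exact: Prop_irrelevance.
Qed.

HB.instance Definition _ A := GRing.isLinear.Build C V V *:%R A (endo_linear A).

Fact add_endo_linear A B : linear (fun x => A x + B x).
Proof. by move=> c x y; rewrite (linearP A) (linearP B) scalerDr addrACA. Qed.
Definition add_endo A B := Endo (add_endo_linear A B).

Fact opp_endo_linear A : linear (fun x => - A x).
Proof. by move=> c x y; rewrite (linearP A) opprD scalerN. Qed.
Definition opp_endo A := Endo (opp_endo_linear A).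

Fact zero_endo_linear : linear (fun _ : V => 0 : V).
Proof. by move=> c x y; rewrite scaler0 addr0. Qed.
Definition zero_endo : E := Endo zero_endo_linear.

Fact mul_endo_linear A B : linear (fun x => A (B x)).
Proof. by move=> c x y; rewrite !linearP. Qed.
Definition mul_endo A B := Endo (mul_endo_linear A B).

Fact one_endo_linear : linear (fun x : V => x).
Proof. by []. Qed.
Definition one_endo : E := Endo one_endo_linear.

Fact scale_endo_linear c A : linear (fun x => c *: A x).
Proof. by move=> b x y; rewrite (linearP A) scalerDr !scalerA mulrC. Qed.
Definition scale_endo c A := Endo (scale_endo_linear c A).

Fact add_endoA : associative add_endo.
Proof. by move=> A B D; apply: endoP => x; exact: addrA. Qed.
Fact add_endoC : commutative add_endo.
Proof. by move=> A B; apply: endoP => x; exact: addrC. Qed.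
Fact add_endo0 : left_id zero_endo add_endo.
Proof. by move=> A; apply: endoP => x; exact: add0r. Qed.
Fact add_endoN : left_inverse zero_endo opp_endo add_endo.
Proof. by move=> A; apply: endoP => x; exact: addNr. Qed.
HB.instance Definition _ :=
  GRing.isZmodule.Build E add_endoA add_endoC add_endo0 add_endoN.

Fact mul_endoA : associative mul_endo. Proof. by move=> A B D; exact: endoP. Qed.
Fact mul_endo1 : left_id one_endo mul_endo. Proof. by move=> A; exact: endoP. Qed.
Fact mul_1endo : right_id one_endo mul_endo. Proof. by move=> A; exact: endoP. Qed.
Fact mul_endoDl : left_distributive mul_endo +%R.
Proof. by move=> A B D; exact: endoP. Qed.
Fact mul_endoDr : right_distributive mul_endo +%R.
Proof. by move=> A B D; apply: endoP => x; exact: linearD. Qed.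
HB.instance Definition _ := GRing.Zmodule_isPzRing.Build E
  mul_endoA mul_endo1 mul_1endo mul_endoDl mul_endoDr.

Fact scale_endoA a b A : scale_endo a (scale_endo b A) = scale_endo (a * b) A.
Proof. by apply: endoP => x; exact: scalerA. Qed.
Fact scale_1endo : left_id 1 scale_endo.
Proof. by move=> A; apply: endoP => x; exact: scale1r. Qed.
Fact scale_endoDr : right_distributive scale_endo +%R.
Proof. by move=> c A B; apply: endoP => x; exact: scalerDr. Qed.
Fact scale_endoDl A : {morph scale_endo^~ A : a b / a + b}.
Proof. by move=> a b; apply: endoP => x; exact: scalerDl. Qed.
HB.instance Definition _ := GRing.Zmodule_isLmodule.Build C E
  scale_endoA scale_1endo scale_endoDr scale_endoDl.

Lemma endoD A B x : (A + B) x = A x + B x. Proof. by []. Qed.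
Lemma endoN A x : (- A) x = - A x. Proof. by []. Qed.
Lemma endo0 x : (0 : E) x = 0. Proof. by []. Qed.
Lemma endoM A B x : (A * B) x = A (B x). Proof. by []. Qed.
Lemma endo1 x : (1 : E) x = x. Proof. by []. Qed.
Lemma endoZ c A x : (c *: A) x = c *: A x. Proof. by []. Qed.
Lemma endo_sum (I : Type) (r : seq I) (P : pred I) (F : I -> E) x :
  (\sum_(i <- r | P i) F i) x = \sum_(i <- r | P i) F i x.
Proof. by elim/big_rec2: _ => // i y A _ <-. Qed.

Lemma endoZl c A B : (c *: A) * B = c *: (A * B).
Proof. exact: endoP. Qed.
Lemma endoZr c A B : A * (c *: B) = c *: (A * B).
Proof. by apply: endoP => x; exact: linearZ. Qed.

End EndoRing.

Section LocallyFiniteSums.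
Context (C : comNzRingType) (V : lmodType C).
Local Notation E := (endo V).

(** The condition under which an infinite sum of operators makes sense, as for
    the modes of a field applied to a fixed vector. *)
Definition lfin (I : choiceType) (F : I -> E) :=
  forall x, exists X : {fset I}, forall i, i \notin X -> F i x = 0.

Lemma lsum_linear (I : choiceType) (F : I -> E) : lfin F ->
  linear (fun x => \sum_(i \in [set: I]%classic) F i x).
Proof.
move=> fF c x y; have [X hX] := fF x; have [Y hY] := fF y.
have hc i : i \notin (X `|` Y)%fset -> F i x = 0 /\ F i y = 0.
  by rewrite inE negb_or => /andP[/hX-> /hY->].
rewrite !(fsbigTE (X `|` Y)%fset) => [|i /hc[]|i /hc[]|i /hc[hx hy]] //.
  by rewrite scaler_sumr -big_split; apply: eq_bigr => i _; exact: linearP.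
by rewrite (linearP (F i)) /= hx hy scaler0 addr0.
Qed.

Definition lsum (I : choiceType) (F : I -> E) : E :=
  if pselect (lfin F) is left h then Endo (lsum_linear h) else 0.

Lemma lsumT (I : choiceType) (F : I -> E) x : lfin F ->
  lsum F x = \sum_(i \in [set: I]%classic) F i x.
Proof. by rewrite /lsum; case: pselect. Qed.

Lemma lsumE (I : choiceType) (F : I -> E) (X : {fset I}) x : lfin F ->
  (forall i, i \notin X -> F i x = 0) -> lsum F x = \sum_(i <- X) F i x.
Proof. by move=> fF hX; rewrite lsumT // (fsbigTE X). Qed.

Lemma eq_lsum (I : choiceType) (F G : I -> E) : F =1 G -> lsum F = lsum G.
Proof. by move=> /funext->. Qed.

Lemma eq_lfin (I : choiceType) (F G : I -> E) : F =1 G -> lfin F -> lfin G.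
Proof. by move=> /funext->. Qed.

Lemma lfinMl (I : choiceType) (F : I -> E) (A : I -> E) :
  lfin F -> lfin (fun i => A i * F i).
Proof.
by move=> fF x; have [X hX] := fF x; exists X => i /hX h; rewrite endoM h linear0.
Qed.

Lemma lfinMr (I : choiceType) (F : I -> E) A : lfin F -> lfin (fun i => F i * A).
Proof. by move=> fF x; have [X hX] := fF (A x); exists X. Qed.

Lemma lfinZ (I : choiceType) (F : I -> E) (c : I -> C) :
  lfin F -> lfin (fun i => c i *: F i).
Proof.
by move=> fF x; have [X hX] := fF x; exists X => i /hX h; rewrite endoZ h scaler0.
Qed.

Lemma lfinZc (I : choiceType) (F : I -> E) c : lfin F -> lfin (fun i => c *: F i).
Proof. exact: (@lfinZ I F (fun=> c)). Qed.

Lemma lfinD (I : choiceType) (F G : I -> E) :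
  lfin F -> lfin G -> lfin (fun i => F i + G i).
Proof.
move=> fF fG x; have [X hX] := fF x; have [Y hY] := fG x.
exists (X `|` Y)%fset => i; rewrite inE negb_or => /andP[/hX hx /hY hy].
by rewrite endoD hx hy addr0.
Qed.

Lemma lfin_sum (I : choiceType) (J : Type) (r : seq J) (F : J -> I -> E) :
  (forall j, lfin (F j)) -> lfin (fun i => \sum_(j <- r) F j i).
Proof.
move=> fF; elim: r => [|j r IH].
  by move=> x; exists fset0 => i _; rewrite big_nil.
by apply: eq_lfin (lfinD (fF j) IH) => i; rewrite big_cons.
Qed.

Lemma lfin_fset (I : choiceType) (F : I -> E) (X : {fset I}) :
  (forall i, i \notin X -> F i = 0) -> lfin F.
Proof. by move=> hX x; exists X => i /hX->. Qed.

Lemma lfin_reindex (I J : choiceType) (h : I -> J) (F : J -> E) :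
  bijective h -> lfin F -> lfin (F \o h).
Proof.
case=> g hK gK fF x; have [X hX] := fF x.
exists [fset g j | j in X]%fset => i /imfsetP hi; apply: hX.
by apply/negP => hj; apply: hi; exists (h i).
Qed.

(** Only finitely many [j] see a given vector, and for each of them only
    finitely many [i] see its image. *)
Lemma lfinM (I J : choiceType) (F : I -> E) (G : J -> E) :
  lfin F -> lfin G -> lfin (fun ij => F ij.1 * G ij.2).
Proof.
move=> fF fG x; have [Y hY] := fG x.
have [X hX] : exists X : {fset I}, forall j, j \in Y ->
    forall i, i \notin X -> F i (G j x) = 0.
  pose f j := projT1 (cid (fF (G j x))).
  exists (\bigcup_(j <- Y) f j)%fset => j jY i iX.
  apply: (projT2 (cid (fF (G j x)))); apply: contra iX => iX.
  by apply/bigfcupP; exists j; rewrite ?jY.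
exists (X `*` Y)%fset => -[i j]; rewrite !inE /= negb_and.
have [jY|/hY->] := boolP (j \in Y); last by rewrite linear0.
by rewrite orbF; exact: hX.
Qed.

Lemma lsumMl (I : choiceType) (F : I -> E) A :
  lfin F -> A * lsum F = lsum (fun i => A * F i).
Proof.
move=> fF; apply: endoP => x; have [X hX] := fF x.
rewrite endoM (lsumE (X := X)) // (lsumE (X := X)).
- by rewrite linear_sum.
- exact: lfinMl.
- by move=> i /hX h; rewrite /= h linear0.
Qed.

Lemma lsumMr (I : choiceType) (F : I -> E) A :
  lfin F -> lsum F * A = lsum (fun i => F i * A).
Proof.
move=> fF; apply: endoP => x; have [X hX] := fF (A x).
by rewrite endoM (lsumE (X := X)) // (lsumE (X := X)) //; exact: lfinMr.
Qed.

Lemma lsumZ (I : choiceType) (F : I -> E) c :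
  lfin F -> lsum (fun i => c *: F i) = c *: lsum F.
Proof.
move=> fF; apply: endoP => x; have [X hX] := fF x.
rewrite endoZ (lsumE (X := X)) ?(lsumE (X := X)) //.
- by rewrite scaler_sumr.
- exact: lfinZ.
- by move=> i /hX h; rewrite endoZ h scaler0.
Qed.

Lemma lsumD (I : choiceType) (F G : I -> E) : lfin F -> lfin G ->
  lsum (fun i => F i + G i) = lsum F + lsum G.
Proof.
move=> fF fG; apply: endoP => x; have [X hX] := fF x; have [Y hY] := fG x.
have hc i : i \notin (X `|` Y)%fset -> F i x = 0 /\ G i x = 0.
  by rewrite inE negb_or => /andP[/hX-> /hY->].
rewrite endoD !(lsumE (X := (X `|` Y)%fset)) ?big_split //.
- by move=> i /hc[].
- by move=> i /hc[].
- exact: lfinD.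
- by move=> i /hc[h1 h2]; rewrite endoD h1 h2 addr0.
Qed.

Lemma lfinN (I : choiceType) (F : I -> E) : lfin F -> lfin (fun i => - F i).
Proof. by move=> fF x; have [X hX] := fF x; exists X => i /hX h; rewrite endoN h oppr0. Qed.

Lemma lsumN (I : choiceType) (F : I -> E) :
  lfin F -> lsum (fun i => - F i) = - lsum F.
Proof.
by move=> fF; rewrite -scaleN1r -lsumZ //; apply: eq_lsum => i; rewrite scaleN1r.
Qed.

Lemma lsum0 (I : choiceType) (F : I -> E) : (forall i, F i = 0) -> lsum F = 0.
Proof.
move=> h; have fF : lfin F by apply: (@lfin_fset _ _ fset0) => i _.
by apply: endoP => x; rewrite (lsumE (X := fset0)) ?big_nil // => i _; rewrite h.
Qed.

Lemma lsum_fset (I : choiceType) (F : I -> E) (X : {fset I}) :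
  (forall i, i \notin X -> F i = 0) -> lsum F = \sum_(i <- X) F i.
Proof.
move=> hX; apply: endoP => x; rewrite (lsumE (X := X)) ?endo_sum //.
  exact: lfin_fset hX.
by move=> i /hX->.
Qed.

Lemma lsum1 (I : choiceType) (F : I -> E) i0 :
  (forall i, i != i0 -> F i = 0) -> lsum F = F i0.
Proof.
move=> h; rewrite (lsum_fset (X := [fset i0]%fset)) ?big_seq_fset1 //.
by move=> i; rewrite inE => /h.
Qed.

Lemma lsum_sum (I : choiceType) (J : Type) (r : seq J) (F : J -> I -> E) :
  (forall j, lfin (F j)) ->
  lsum (fun i => \sum_(j <- r) F j i) = \sum_(j <- r) lsum (F j).
Proof.
move=> fF; elim: r => [|j r IH]; first by rewrite big_nil lsum0 // => i; rewrite big_nil.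
rewrite big_cons -IH -lsumD //; last exact: lfin_sum.
by apply: eq_lsum => i; rewrite big_cons.
Qed.

Lemma lsum_reindex (I J : choiceType) (h : I -> J) (F : J -> E) :
  bijective h -> lfin F -> lsum F = lsum (fun i => F (h i)).
Proof.
move=> bh fF; apply: endoP => x.
by rewrite !lsumT //; [exact: reindex_fsbigT|exact: (lfin_reindex bh fF)].
Qed.

Section Pairs.
Context (I J : choiceType) (F : I * J -> E) (fF : lfin F).

Lemma lfin_pairr i : lfin (fun j => F (i, j)).
Proof.
move=> x; have [X hX] := fF x; exists [fset ij.2 | ij in X]%fset => j /imfsetP hj.
by apply: hX; apply/negP => h; apply: hj; exists (i, j).
Qed.

Lemma lfin_pairl : lfin (fun i => lsum (fun j => F (i, j))).
Proof.
move=> x; have [X hX] := fF x; exists [fset ij.1 | ij in X]%fset => i /imfsetP hi.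
rewrite (lsumE (X := fset0)) ?big_nil //; first exact: lfin_pairr.
by move=> j _; apply: hX; apply/negP => h; apply: hi; exists (i, j).
Qed.

(** Local finiteness over pairs confines both indices to finite sets, so Fubini
    reduces to finite sums. *)
Lemma lsum_pair : lsum F = lsum (fun i => lsum (fun j => F (i, j))).
Proof.
apply: endoP => x; have [X hX] := fF x.
set X1 := [fset ij.1 | ij in X]%fset; set X2 := [fset ij.2 | ij in X]%fset.
have h1 i j : i \notin X1 -> F (i, j) x = 0.
  by move/imfsetP => hi; apply: hX; apply/negP => h; apply: hi; exists (i, j).
have h2 i j : j \notin X2 -> F (i, j) x = 0.
  by move/imfsetP => hi; apply: hX; apply/negP => h; apply: hi; exists (i, j).
rewrite (lsumE (X := (X1 `*` X2)%fset)) //; last first.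
  by move=> [i j]; rewrite !inE negb_and => /orP[/h1|/h2].
rewrite (lsumE lfin_pairl (X := X1)); last first.
  move=> i /h1 h; rewrite (lsumE (X := fset0)) ?big_nil //; exact: lfin_pairr.
transitivity (\sum_(i <- X1) \sum_(j <- X2) F (i, j) x); last first.
  by apply: eq_bigr => i _; rewrite (lsumE (lfin_pairr i) (X := X2)) // => j /h2.
rewrite pair_big_dep_cond /=.
under [RHS]eq_bigr do rewrite -surjective_pairing.
by apply: eq_fbigl => -[i j]; rewrite !inE /= !andbT.
Qed.

End Pairs.

Lemma lsum_exchange (I J : choiceType) (F : I -> J -> E) :
  lfin (fun ij => F ij.1 ij.2) ->
  lsum (fun i => lsum (F i)) = lsum (fun j => lsum (F^~ j)).
Proof.
move=> fF; rewrite -(lsum_pair fF).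
have bs : bijective (fun ji : J * I => (ji.2, ji.1)) by exists (fun ij => (ij.2, ij.1)) => -[].
by rewrite (lsum_reindex bs fF) (lsum_pair (lfin_reindex bs fF)).
Qed.

Lemma lsumM (I J : choiceType) (F : I -> E) (G : J -> E) :
  lfin F -> lfin G -> lsum F * lsum G = lsum (fun ij => F ij.1 * G ij.2).
Proof.
move=> fF fG; rewrite lsumMr // (lsum_pair (lfinM fF fG)).
by apply: eq_lsum => i; rewrite lsumMl.
Qed.

End LocallyFiniteSums.

(** * Formal exponentials of operators *)

Lemma int_interval_fset (m n : int) :
  exists X : {fset int}, forall k, k \notin X -> k < m \/ n < k.
Proof.
exists [fset (m + i%:Z)%R | i in iota 0 `|n - m|.+1]%fset => k /imfsetP hk.
case: (ltP k m) => [|mk]; first by left.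
case: (ltP n k) => [|kn]; first by right.
case: hk; exists `|k - m|%N => /=; last by lia.
by rewrite !inE mem_iota; lia.
Qed.

Lemma fset_bound (T : choiceType) (X : {fset T}) (f : T -> int) :
  exists M : nat, forall i, i \in X -> `|f i| <= M%:Z.
Proof.
exists (\sum_(i <- X) `|f i|%N)%N => i iX.
by rewrite (big_fsetD1 i) //=; lia.
Qed.

Lemma addz_bij (n : int) : bijective (fun k : int => k + n).
Proof. by exists (fun k => k - n) => k; rewrite ?addrK ?subrK. Qed.

Section FormalExponentials.
Context (C : numFieldType) (V : lmodType C).
Local Notation E := (endo V).
Implicit Types (b t : nat -> E) (S T : int -> E) (p q : int) (c : C).

(** [S p] is the coefficient of z^p in exp (sum_k b_k z^(k+1) / (k+1)), pinned
    down by its logarithmic derivative: this recurrence is the only handle on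
    exponentials used below.  The sum may be cut at any N >= p because S vanishes
    in negative degrees. *)
Record expseq b S : Prop := Expseq {
  expseq_neg : forall p, p < 0 -> S p = 0;
  expseq0 : S 0 = 1;
  expseq_rec : forall p N, p <= N%:Z ->
    p%:~R *: S p = \sum_(k < N) b k * S (p - k.+1%:Z) }.

Lemma int_pos_ind (P : int -> Prop) :
  (forall p, p < 0 -> P p) -> P 0 ->
  (forall p, 0 < p -> (forall p', p' < p -> P p') -> P p) -> forall p, P p.
Proof.
move=> Pneg P0 Ppos p.
suff H (n : nat) p' : p' <= n%:Z -> P p' by apply: (H `|p|%N); lia.
elim: n p' => [|n IH] p' hp'.
  by case: (ltgtP p' 0) => [/Pneg||->] //; lia.
case: (ltgtP p' 0) => [/Pneg|p0|->] //.
by apply: Ppos => // r hr; apply: IH; lia.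
Qed.

Lemma scaleI_pos p (A B : E) : 0 < p -> p%:~R *: A = p%:~R *: B -> A = B.
Proof.
move=> p0 h; have pn : p%:~R != 0 :> C by rewrite intr_eq0; lia.
by rewrite -[A]scale1r -[B]scale1r -(mulVf pn) -!scalerA h.
Qed.

(** The recurrence determines S p for p > 0, as p is invertible. *)
Lemma expseq_unique b S S' : expseq b S -> expseq b S' -> S =1 S'.
Proof.
move=> eS eS' p; elim/int_pos_ind: p => [p p0||p p0 IH].
- by rewrite (expseq_neg eS) ?(expseq_neg eS').
- by rewrite (expseq0 eS) (expseq0 eS').
apply: (scaleI_pos p0); have hp : p <= `|p|%N%:Z by lia.
rewrite (expseq_rec eS hp) (expseq_rec eS' hp).
by apply: eq_bigr => k _; rewrite IH //; lia.
Qed.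

Lemma expseq_comm b S A : expseq b S ->
  (forall k, A * b k = b k * A) -> forall p, A * S p = S p * A.
Proof.
move=> eS hA p; elim/int_pos_ind: p => [p p0||p p0 IH].
- by rewrite (expseq_neg eS) // mul0r mulr0.
- by rewrite (expseq0 eS) mul1r mulr1.
apply: (scaleI_pos p0); have hp : p <= `|p|%N%:Z by lia.
rewrite -endoZr -endoZl (expseq_rec eS hp) mulr_sumr mulr_suml.
by apply: eq_bigr => k _; rewrite mulrA hA -!mulrA IH //; lia.
Qed.

(** A bracket with a single b_n that is central acts on the exponential as a
    derivation, by multiplication with c z^(n+1). *)
Lemma expseq_shift b S (A : E) (n : nat) c : expseq b S ->
  (forall k, A * b k - b k * A = (if k == n then n.+1%:R * c else 0) *: (1 : E)) ->
  forall p, A * S p - S p * A = c *: S (p - n.+1%:Z).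
Proof.
move=> eS hA p; elim/int_pos_ind: p => [p p0||p p0 IH].
- by rewrite !(expseq_neg eS) ?mul0r ?mulr0 ?subrr ?scaler0 //; lia.
- by rewrite (expseq0 eS) (expseq_neg eS) ?mul1r ?mulr1 ?subrr ?scaler0 //; lia.
apply: (scaleI_pos p0).
pose N := (`|p|%N + n.+1)%N; have hp : p <= N%:Z by rewrite /N; lia.
rewrite scalerBr -endoZr -endoZl (expseq_rec eS hp) mulr_sumr mulr_suml -sumrB.
transitivity (\sum_(k < N) ((if k == n :> nat then n.+1%:R * c else 0) *: S (p - k.+1%:Z)
   + c *: (b k * S ((p - n.+1%:Z) - k.+1%:Z)))).
  apply: eq_bigr => k _.
  have -> : A * (b k * S (p - k.+1%:Z)) - b k * S (p - k.+1%:Z) * A =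
     (A * b k - b k * A) * S (p - k.+1%:Z)
     + b k * (A * S (p - k.+1%:Z) - S (p - k.+1%:Z) * A).
    by rewrite mulrBl mulrBr !mulrA addrA subrK.
  rewrite hA IH; last by lia.
  rewrite endoZl mul1r endoZr; congr (_ + _ *: (_ * S _)); lia.
rewrite big_split -scaler_sumr -(expseq_rec eS); last by rewrite /N; lia.
have nN : (n < N)%N by rewrite /N; lia.
rewrite (bigD1 (Ordinal nN)) //= eqxx big1 ?addr0; last first.
  by move=> k /negP hk; case: eqP => [h|_]; rewrite ?scale0r //; case: hk; apply/eqP/val_inj.
rewrite !scalerA -scalerDl; congr (_ *: _).
by rewrite [p%:~R * c]mulrC [n.+1%:R * c]mulrC -mulrDr pmulrn -intrD; congr (_ * _%:~R); lia.
Qed.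

Lemma conv_lfin S T p q : (forall k, k < 0 -> S k = 0) -> (forall k, k < 0 -> T k = 0) ->
  lfin (fun k => S (k + q) * T (p - k)).
Proof.
move=> hS hT; have [X hX] := int_interval_fset (- q) p.
apply: (@lfin_fset _ _ _ _ X) => k /hX[k0|k0]; first by rewrite hS ?mul0r //; lia.
by rewrite (hT (p - k)) ?mulr0 //; lia.
Qed.

Definition conv S T : int -> E := fun p => lsum (fun k => S k * T (p - k)).

Lemma conv0_lfin S T p : (forall k, k < 0 -> S k = 0) -> (forall k, k < 0 -> T k = 0) ->
  lfin (fun k => S k * T (p - k)).
Proof.
move=> hS hT; apply: eq_lfin (conv_lfin p 0 hS hT) => k; by rewrite addr0.
Qed.

(** exp b exp b' = exp (b + b') for commuting exponents: the Leibniz rule for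
    z d/dz splits p as k + (p - k). *)
Lemma expseqM b S b' S' : expseq b S -> expseq b' S' ->
  (forall k l, b k * b' l = b' l * b k) ->
  expseq (fun k => b k + b' k) (conv S S').
Proof.
move=> eS eS' bb'; have hS := expseq_neg eS; have hS' := expseq_neg eS'.
have b'S k p : b' k * S p = S p * b' k.
  by apply: (expseq_comm eS) => l; rewrite bb'.
split.
- move=> p p0; apply: lsum0 => k.
  by have [k0|k0] := ltP k 0; [rewrite hS ?mul0r //|rewrite hS' ?mulr0 //]; lia.
- rewrite /conv (@lsum1 _ _ _ _ 0) ?expseq0 ?mulr1 //.
    by rewrite (expseq0 eS') (expseq0 eS) mulr1.
  by move=> k k0; have [kn|kp] := ltP k 0; [rewrite hS ?mul0r //|rewrite hS' ?mulr0 //]; lia.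
move=> p N hN.
rewrite /conv -lsumZ; last exact: conv0_lfin.
transitivity (lsum (fun k => \sum_(j < N) (b j * (S (k - j.+1%:Z) * S' (p - k)))
    + \sum_(j < N) (b' j * (S k * S' (p - j.+1%:Z - k))))).
  apply: eq_lsum => k.
  have -> : p%:~R = k%:~R + (p - k)%:~R :> C by rewrite -intrD; congr _%:~R; lia.
  rewrite scalerDl; congr (_ + _).
    have [kp|pk] := ltP p k.
      rewrite (hS' (p - k)) ?mulr0 ?scaler0; last by lia.
      by rewrite big1 // => j _; rewrite !mulr0.
    rewrite -endoZl (expseq_rec eS (N := N)); last by lia.
    by rewrite mulr_suml; apply: eq_bigr => j _; rewrite mulrA.
  have [k0|k0] := ltP k 0.
    rewrite (hS k) // !mul0r scaler0 big1 // => j _; by rewrite !mul0r mulr0.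
  rewrite -endoZr (expseq_rec eS' (N := N)); last by lia.
  rewrite mulr_sumr; apply: eq_bigr => j _; rewrite !mulrA b'S.
  by congr (_ * _ * S' _); lia.
have f1 (j : 'I_N) : lfin (fun k => b j * (S (k - j.+1%:Z) * S' (p - k))).
  by apply: lfinMl; exact: conv_lfin.
have f2 (j : 'I_N) : lfin (fun k => b' j * (S k * S' (p - j.+1%:Z - k))).
  by apply: lfinMl; exact: conv0_lfin.
rewrite lsumD; [|exact: lfin_sum|exact: lfin_sum].
rewrite !lsum_sum // -big_split; apply: eq_bigr => j _ /=.
rewrite -!lsumMl; [|exact: conv0_lfin|exact: conv_lfin].
rewrite mulrDl; congr (_ * _ + _).
have bj := addz_bij j.+1%:Z.
rewrite (lsum_reindex bj); last exact: conv_lfin.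
by apply: eq_lsum => k; congr (S _ * S' _); lia.
Qed.

(** The coefficients of (1 - x)^c. *)
Record binseq (c : C) (beta : int -> C) : Prop := Binseq {
  binseq_neg : forall r, r < 0 -> beta r = 0;
  binseq0 : beta 0 = 1;
  binseq_rec : forall r, (r + 1)%:~R * beta (r + 1) = (r%:~R - c) * beta r }.

(** The logarithmic derivative - c x / (1 - x) of (1 - x)^c, expanded. *)
Lemma binseq_sum c beta : binseq c beta -> forall r N, r <= N%:Z ->
  r%:~R * beta r = - c * \sum_(k < N) beta (r - k.+1%:Z).
Proof.
move=> hb r N; have bn := binseq_neg hb.
have [r0 _|r0] := ltP r 0.
  rewrite bn // mulr0 big1 ?mulr0 // => k _; rewrite bn //; lia.
elim: N r r0 => [|N IH] r r0 rN.
  have -> : r = 0 by lia.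
  by rewrite mul0r big_ord0 mulr0.
rewrite big_ord_recl /=; have -> : r = (r - 1) + 1 by lia.
rewrite (binseq_rec hb); under eq_bigr => k _ do
  have -> : r - 1 + 1 - (bump 0 k).+1%:Z = r - 1 - k.+1%:Z by rewrite /bump /=; lia.
have -> : r - 1 + 1 - 1%:Z = r - 1 by lia.
have [r1|r1] := ltP (r - 1) 0.
  rewrite bn // mulr0 add0r big1 ?mulr0 // => k _; rewrite bn //; lia.
rewrite mulrDr -IH //; last by lia.
by rewrite mulrBl addrC mulNr.
Qed.

Lemma TS_fset T S' beta p q : (forall k, k < 0 -> T k = 0) ->
  (forall r, r < 0 -> beta r = 0) ->
  exists X : {fset int}, forall r, r \notin X -> beta r *: (S' (p - r) * T (q - r)) = 0.
Proof.
move=> hT hb; have [X hX] := int_interval_fset 0 q.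
exists X => r /hX[r0|r0]; first by rewrite hb ?scale0r.
by rewrite (hT (q - r)) ?mulr0 ?scaler0 //; lia.
Qed.

Lemma TS_lfin T S' beta p q : (forall k, k < 0 -> T k = 0) ->
  (forall r, r < 0 -> beta r = 0) ->
  lfin (fun r => beta r *: (S' (p - r) * T (q - r))).
Proof. by move=> hT hb; have [X hX] := TS_fset S' p q hT hb; apply: lfin_fset hX. Qed.

(** Moving an annihilation exponential T(z) past a creation exponential S(w)
    produces the factor (1 - w/z)^c.  Both sides satisfy the recurrence of T in
    q, which reduces to that of (1 - x)^c. *)
Lemma expseq_exchange t T b S c beta : expseq t T -> expseq b S -> binseq c beta ->
  (forall k l, t k * b l - b l * t k = (if l == k then k.+1%:R * - c else 0) *: (1 : E)) ->
  forall q p, T q * S p = lsum (fun r => beta r *: (S (p - r) * T (q - r))).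
Proof.
move=> eT eS hb tb q; have hT := expseq_neg eT; have bn := binseq_neg hb.
elim/int_pos_ind: q => [q q0||q q0 IH] p.
- rewrite hT // mul0r lsum0 // => r.
  have [r0|r0] := ltP r 0; first by rewrite bn ?scale0r.
  by rewrite (hT (q - r)) ?mulr0 ?scaler0 //; lia.
- rewrite (@lsum1 _ _ _ _ 0) ?subr0 ?(expseq0 eT) ?(binseq0 hb) ?scale1r ?mul1r ?mulr1 //.
  move=> r r0; have [rn|rp] := ltP r 0; first by rewrite bn ?scale0r.
  by rewrite (hT (0 - r)) ?mulr0 ?scaler0 //; lia.
apply: (scaleI_pos q0); pose N := `|q|%N; have hq : q <= N%:Z by rewrite /N; lia.
rewrite -endoZl (expseq_rec eT hq) mulr_suml -lsumZ; last exact: TS_lfin.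
pose F (k : nat) (r : int) := beta r *: (S (p - r) * (t k * T (q - k.+1%:Z - r))).
pose G (k : nat) (r : int) := beta (r - k.+1%:Z) *: (S (p - r) * T (q - r)).
have fF k : lfin (F k).
  have [X hX] := int_interval_fset 0 q; apply: (@lfin_fset _ _ _ _ X) => r /hX[r0|r0].
    by rewrite /F bn ?scale0r.
  by rewrite /F (hT (_ - r)) ?mulr0 ?scaler0 //; lia.
have fG k : lfin (G k).
  by apply: (@TS_lfin T S (fun r => beta (r - k.+1%:Z))) => // r r0; rewrite bn //; lia.
transitivity (\sum_(k < N) (lsum (F k) - c *: lsum (G k))).
  apply: eq_bigr => k _; rewrite -mulrA IH; last by lia.
  rewrite lsumMl; last exact: TS_lfin.
  have bj := addz_bij k.+1%:Z.
  have fG' := lfin_reindex bj (fG k).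
  rewrite (lsum_reindex bj (fG k)) -lsumZ // -lsumN; last exact: lfinZc.
  rewrite -lsumD //; last by apply: lfinN; exact: lfinZc.
  apply: eq_lsum => r; rewrite /F /G endoZr.
  have -> : t k * (S (p - r) * T (q - k.+1%:Z - r)) =
     S (p - r) * (t k * T (q - k.+1%:Z - r))
     + (t k * S (p - r) - S (p - r) * t k) * T (q - k.+1%:Z - r).
    by rewrite mulrBl !mulrA [RHS]addrC subrK.
  rewrite (expseq_shift eS (c := - c) (n := k)) // endoZl scaleNr scalerBr.
  rewrite !scalerA [beta r * c]mulrC; congr (_ - (_ * beta _) *: (S _ * T _)); lia.
rewrite sumrB -scaler_sumr -!lsum_sum // -lsumZ; last exact: lfin_sum.
rewrite -lsumN; last by apply: lfinZc; exact: lfin_sum.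
rewrite -lsumD; [|exact: lfin_sum|by apply: lfinN; apply: lfinZc; exact: lfin_sum].
apply: eq_lsum => r.
have [rq|qr] := ltP q r.
  rewrite (hT (q - r)) ?mulr0 ?scaler0; last by lia.
  rewrite !big1 ?scaler0 ?subr0 // => k _; rewrite /F /G hT ?mulr0 ?scaler0 //; lia.
have [r0|r0] := ltP r 0.
  rewrite (bn r) // !scale0r scaler0 !big1 ?scaler0 ?subr0 // => k _.
    by rewrite /G bn ?scale0r //; lia.
  by rewrite /F bn ?scale0r.
have -> : \sum_(k < N) F k r = (q - r)%:~R *: (beta r *: (S (p - r) * T (q - r))).
  rewrite scalerA [_ * beta r]mulrC -scalerA -endoZr (expseq_rec eT (N := N)); last by lia.
  rewrite mulr_sumr scaler_sumr; apply: eq_bigr => k _; rewrite /F.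
  by congr (_ *: (_ * (_ * T _))); lia.
rewrite -scaler_suml !scalerA -scalerBl; congr (_ *: _).
have -> : c * \sum_(k < N) beta (r - k.+1%:Z) = - (r%:~R * beta r).
  by rewrite (binseq_sum hb (N := N)) ?mulNr ?opprK //; lia.
by rewrite opprK -mulrDl -intrD; congr (_%:~R * _); lia.
Qed.

(** Each t_k lowers by k + 1 an exhaustive filtration that starts at 0, so only
    finitely many coefficients of the exponential see a given vector. *)
Lemma expseq_lfin t T (W : nat -> V -> Prop) : expseq t T ->
  (forall n, W n 0) ->
  (forall n c x y, W n x -> W n y -> W n (c *: x + y)) ->
  (forall k n x, W n x -> if (k < n)%N then W (n - k.+1)%N (t k x) else t k x = 0) ->
  (forall x, exists n, W n x) -> lfin T.
Proof.
move=> eT W0 WD Wt Wex.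
have W_sum n N (F : nat -> V) : (forall k, W n (F k)) -> W n (\sum_(k < N) F k).
  move=> h; elim: N => [|N IH]; first by rewrite big_ord0.
  by rewrite big_ord_recr /= addrC -[F _]scale1r; apply: WD.
have W_scale n c x : W n x -> W n (c *: x).
  by move=> h; rewrite -[_ *: _]addr0; apply: WD.
have H q : forall n x, W n x -> if q <= n%:Z then W `|(n%:Z - q)%R|%N (T q x) else T q x = 0.
  elim/int_pos_ind: q => [q q0|n x h|q q0 IH n x h].
  - by move=> n x _; rewrite (expseq_neg eT) // endo0; case: ifP.
  - by rewrite (expseq0 eT) endo1 (_ : `|(n%:Z - 0)%R|%N = n) //; lia.
  pose N := `|q|%N; have qN : q <= N%:Z by rewrite /N; lia.
  have term (k : nat) : if q <= n%:Z then W `|(n%:Z - q)%R|%N (t k (T (q - k.+1%:Z) x))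
      else t k (T (q - k.+1%:Z) x) = 0.
    have := IH (q - k.+1%:Z) _ n x h; rewrite (_ : _ < q); last by lia.
    move=> /(_ isT); have [r0|r0] := ltP (q - k.+1%:Z) 0.
      by rewrite (expseq_neg eT r0) endo0 linear0; case: (q <= _).
    case: ifPn => rn => [hT|->]; last first.
      by rewrite linear0; case: (q <= _).
    have := Wt k _ _ hT; case: ifPn => kn => [hW|->]; case: ifPn => qn //.
    + by rewrite (_ : `|(n%:Z - q)%R|%N = (`|(n%:Z - (q - k.+1%:Z))%R| - k.+1)%N) //; lia.
    + by exfalso; lia.
  have e : T q x = (q%:~R)^-1 *: \sum_(k < N) t k (T (q - k.+1%:Z) x).
    have := congr1 (fun A : E => A x) (expseq_rec eT qN).
    rewrite endoZ endo_sum => <-; rewrite scalerA mulVf ?scale1r // intr_eq0; lia.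
  case: ifPn => qn; rewrite e.
    by apply: W_scale; apply: (W_sum _ N (fun k : nat => t k (T (q - k.+1%:Z) x))) => k; have := term k; rewrite qn.
  by rewrite big1 ?scaler0 // => k _; have := term k; rewrite (negbTE qn).
move=> x; have [n hn] := Wex x; have [X hX] := int_interval_fset 0 n%:Z.
exists X => q /hX[q0|nq]; first by rewrite (expseq_neg eT q0).
by have := H q n x hn; rewrite leNgt nq.
Qed.

Section Existence.
Context (b : nat -> E).
Hypothesis bC : forall k l, b k * b l = b l * b k.

Fixpoint powE (n p : nat) : E :=
  if n is n'.+1 then \sum_(1 <= k < p.+1) b k * powE n' (p - k)
  else if p == 0%N then 1 else 0.
Definition expE (p : nat) : E := \sum_(n < p.+1) (n`!%:R)^-1 *: powE n p.
Definition expZ (p : int) : E := if p is Posz n then expE n else 0.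
Definition powZ (n : nat) (p : int) : E := if p is Posz q then powE n q else 0.

Lemma powZ_rec n p N : p <= N%:Z ->
  powZ n.+1 p = \sum_(k < N) b k.+1 * powZ n (p - k.+1%:Z).
Proof.
case: p => [p|p] pN; last first.
  by rewrite big1 // => k _; case e : (_ - _) => [m|m]; rewrite ?mulr0 //; lia.
rewrite /=.
rewrite big_add1 /= big_mkord (big_ord_widen N (fun k => b k.+1 * powE n (p - k.+1))) //.
rewrite big_mkcond; apply: eq_bigr => k _; case: ifPn => kp.
  by rewrite (_ : p%:Z - k.+1%:Z = (p - k.+1)%N%:Z) //; lia.
by case e : (p%:Z - k.+1%:Z) => [m|m]; rewrite /= ?mulr0 //; lia.
Qed.

Lemma powZ_gt n p : p < n%:Z -> powZ n p = 0.
Proof.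
elim: n p => [|n IH] p pn; first by case: p pn => //; lia.
rewrite (powZ_rec n (N := `|p|%N)); last by lia.
by rewrite big1 // => k _; rewrite IH ?mulr0 //; lia.
Qed.

(** The derivative n b^(n-1) (z d/dz b) of b^n, in coefficients. *)
Lemma powZ_deriv n p N : p <= N%:Z -> p%:~R *: powZ n p =
  n%:R *: \sum_(k < N) k.+1%:R *: (b k.+1 * powZ n.-1 (p - k.+1%:Z)).
Proof.
elim: n p => [|n IH] p pN.
  rewrite scale0r; case: p pN => [[|p]|p] _ /=; rewrite ?scaler0 //.
  by rewrite mulr0z scale0r.
rewrite (powZ_rec n pN) scaler_sumr /=.
transitivity (\sum_(k < N) (k.+1%:R *: (b k.+1 * powZ n (p - k.+1%:Z))
   + b k.+1 * ((p - k.+1%:Z)%:~R *: powZ n (p - k.+1%:Z)))).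
  apply: eq_bigr => k _; rewrite endoZr -scalerDl; congr (_ *: _).
  by rewrite intrB pmulrn addrC subrK.
rewrite big_split /= -natr1 scalerDl scale1r addrC; congr (_ + _).
transitivity (\sum_(k < N) n%:R *: \sum_(j < N)
    b k.+1 * (j.+1%:R *: (b j.+1 * powZ n.-1 (p - k.+1%:Z - j.+1%:Z)))).
  apply: eq_bigr => k _; rewrite IH; last by lia.
  by rewrite endoZr mulr_sumr.
rewrite -scaler_sumr exchange_big /=; case: n IH => [|n] IH; first by rewrite !scale0r.
congr (_ *: _); apply: eq_bigr => j _.
rewrite (powZ_rec n (N := N)); last by lia.
rewrite mulr_sumr scaler_sumr; apply: eq_bigr => k _.
rewrite endoZr !mulrA bC /=; congr (_ *: (_ * powZ _ _)); lia.
Qed.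

Lemma expZE p M : p < M%:Z -> expZ p = \sum_(n < M) (n`!%:R)^-1 *: powZ n p.
Proof.
case: p => [p|p] pM; last by rewrite big1 // => n _; rewrite scaler0.
rewrite /= /expE (big_ord_widen M (fun n => (n`!%:R)^-1 *: powE n p)) //.
rewrite big_mkcond; apply: eq_bigr => n _; case: ifPn => // np.
by have := @powZ_gt n p%:Z => /= ->; rewrite ?scaler0 //; lia.
Qed.

(** The usual series sum_n b^n / n! has the right logarithmic derivative. *)
Lemma expseq_expZ : expseq (fun k => k.+1%:R *: b k.+1) expZ.
Proof.
split=> [[]//||p N pN]; first by rewrite /= /expE big_ord1 /= fact0 invr1 scale1r.
rewrite (expZE (M := N.+2)); last by lia.
rewrite scaler_sumr big_ord_recl /=.
have -> : p%:~R *: ((0`!%:R)^-1 *: powZ 0 p) = 0.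
  by rewrite scalerA mulrC -scalerA (powZ_deriv 0 pN) scale0r scaler0.
rewrite add0r.
transitivity (\sum_(n < N.+1) (n`!%:R)^-1 *:
    \sum_(k < N) k.+1%:R *: (b k.+1 * powZ n (p - k.+1%:Z))).
  apply: eq_bigr => n _; rewrite scalerA mulrC -scalerA (powZ_deriv _ pN) /bump add1n /=.
  rewrite scalerA; congr (_ *: _).
  by rewrite factS natrM invfM mulrAC mulVf ?mul1r // pnatr_eq0.
under [LHS]eq_bigr do rewrite scaler_sumr.
rewrite exchange_big; apply: eq_bigr => k _.
rewrite (expZE (M := N.+1)); last by lia.
rewrite mulr_sumr; apply: eq_bigr => n _.
by rewrite endoZr endoZl !scalerA mulrC.
Qed.

End Existence.
End FormalExponentials.

(** * Normally ordered exponentials and their products *)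

Section NormalOrder.
Context (C : numFieldType) (V : lmodType C).
Local Notation E := (endo V).
Implicit Types (S T : int -> E).

(** Coefficient of z^a in S(z) T(z), where T(z) = sum_q T_q z^(-q). *)
Definition nexp S T (a : int) : E := lsum (fun q => S (a + q) * T q).

Lemma nexp_lfin S T a : lfin T -> lfin (fun q => S (a + q) * T q).
Proof. exact: lfinMl. Qed.

Lemma nexp_comm S T A : lfin T -> (forall p, A * S p = S p * A) ->
  (forall p, A * T p = T p * A) -> forall a, A * nexp S T a = nexp S T a * A.
Proof.
move=> fT AS AT a; rewrite /nexp lsumMl ?lsumMr; try exact: nexp_lfin.
by apply: eq_lsum => q; rewrite mulrA AS -!mulrA AT.
Qed.

(** [S (a + q)] vanishes once [a + q < 0]. *)
Lemma nexp_lbound S T : lfin T -> (forall p, p < 0 -> S p = 0) ->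
  forall x, exists M : nat, forall a, a < - M%:Z -> nexp S T a x = 0.
Proof.
move=> fT hS x; have [X hX] := fT x; have [M hM] := fset_bound X id.
exists M => a aM; rewrite (lsumE (X := X)); last 2 first.
- exact: nexp_lfin.
- by move=> q /hX h; rewrite endoM h linear0.
rewrite big_seq big1 // => q /hM hq; rewrite hS //; lia.
Qed.

Section TwoExponentials.
Context (S T S' T' : int -> E) (beta : int -> C).
Hypothesis hS : forall p, p < 0 -> S p = 0.
Hypothesis hS' : forall p, p < 0 -> S' p = 0.
Hypothesis fT : lfin T.
Hypothesis fT' : lfin T'.

(** The normally ordered product of both exponentials: coefficient of z^a w^b in
    S(z) S'(w) T(z) T'(w). *)
Definition nexp2 (a b : int) : E :=
  lsum (fun q => S (a + q.1) * S' (b + q.2) * (T q.1 * T' q.2)).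

Lemma nexp2_lfin a b : lfin (fun q => S (a + q.1) * S' (b + q.2) * (T q.1 * T' q.2)).
Proof. by apply: lfinMl; exact: lfinM. Qed.

(** Only finitely many coefficients on an antidiagonal see a given vector,
    because both indices are bounded below. *)
Lemma antidiag_lfin (c : int -> C) a b : (forall r, r < 0 -> c r = 0) \/ (forall r, c r = 1) ->
  lfin (fun rq : int * (int * int) => c rq.1 *:
    (S (a + rq.1 + rq.2.1) * S' (b - rq.1 + rq.2.2) * (T rq.2.1 * T' rq.2.2))).
Proof.
move=> hc x; have [X hX] := lfinM fT fT' x.
have [M hM] := fset_bound X (fun q => q.1); have [M' hM'] := fset_bound X (fun q => q.2).
have [Z hZ] := int_interval_fset (- M%:Z - a) (b + M'%:Z).
exists (Z `*` X)%fset => -[r q] /=; rewrite !inE /= negb_and.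
have [qX|/hX /= h] := boolP (q \in X); last by rewrite h !linear0.
rewrite orbF => /hZ [rM|rM].
  by rewrite hS /= ?scaler0 //; have /= := hM _ qX; lia.
by rewrite hS' /= ?linear0 ?scaler0 //; have /= := hM' _ qX; lia.
Qed.

Lemma nexp2_antidiag_lfin a b : lfin (fun r => nexp2 (a + r) (b - r)).
Proof.
have h := lfin_pairl (antidiag_lfin a b (or_intror (fun r => erefl (1 : C)))).
by apply: eq_lfin h => r; apply: eq_lsum => q /=; rewrite scale1r.
Qed.

Hypothesis hb : forall r, r < 0 -> beta r = 0.
Hypothesis SS' : forall p q, S p * S' q = S' q * S p.
Hypothesis TT' : forall p q, T p * T' q = T' q * T p.
Hypothesis hT : forall p, p < 0 -> T p = 0.
Hypothesis TS' : forall q p,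
  T q * S' p = lsum (fun r => beta r *: (S' (p - r) * T (q - r))).

Lemma nexp2_beta_lfin a b : lfin (fun r => beta r *: nexp2 (a + r) (b - r)).
Proof. by apply: lfinZ; exact: nexp2_antidiag_lfin. Qed.

(** Wick's formula: T(z) moves past S'(w). *)
Lemma nexpM a b : nexp S T a * nexp S' T' b =
  lsum (fun r => beta r *: nexp2 (a + r) (b - r)).
Proof.
pose F (rq : int * (int * int)) : E := beta rq.1 *:
  (S (a + rq.1 + rq.2.1) * S' (b - rq.1 + rq.2.2) * (T rq.2.1 * T' rq.2.2)).
pose h (qr : (int * int) * int) := (qr.2, (qr.1.1 - qr.2, qr.1.2)).
have bh : bijective h.
  exists (fun rq => ((rq.2.1 + rq.1, rq.2.2), rq.1)) => [[[q q'] r]|[r [q q']]];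
  by rewrite /h /= ?subrK ?addrK.
have fF : lfin F by apply: antidiag_lfin; left.
rewrite lsumM; [|exact: nexp_lfin|exact: nexp_lfin].
transitivity (lsum (fun q => lsum (fun r => F (h (q, r))))).
  apply: eq_lsum => -[q q'] /=.
  rewrite -mulrA [T q * _]mulrA TS' lsumMr ?lsumMl; last first.
  - exact: TS_lfin.
  - by apply: lfinMr; exact: TS_lfin.
  apply: eq_lsum => r; rewrite /F /h /= endoZl endoZr !mulrA.
  by congr (_ *: (S _ * S' _ * _ * _)); lia.
rewrite -(lsum_pair (lfin_reindex bh fF)) -(lsum_reindex bh fF) (lsum_pair fF).
by apply: eq_lsum => r; rewrite /F -lsumZ //; exact: nexp2_lfin.
Qed.

End TwoExponentials.

Lemma nexp2C S T S' T' : (forall p q, S p * S' q = S' q * S p) ->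
  (forall p q, T p * T' q = T' q * T p) -> lfin T -> lfin T' ->
  forall a b, nexp2 S' T' S T b a = nexp2 S T S' T' a b.
Proof.
move=> SS' TT' fT fT' a b; rewrite /nexp2.
have bs : bijective (fun ji : int * int => (ji.2, ji.1)) by exists (fun ij => (ij.2, ij.1)) => -[].
rewrite (lsum_reindex bs (nexp2_lfin S' S fT' fT b a)) /=.
by apply: eq_lsum => -[q q'] /=; rewrite SS' TT'.
Qed.

(** Along an antidiagonal the two normally ordered exponentials merge into one,
    the value of S(z) S'(w) T(z) T'(w) at z = w. *)
Lemma nexp2_diag S T S' T' : (forall p, p < 0 -> S p = 0) ->
  (forall p, p < 0 -> S' p = 0) -> (forall p, p < 0 -> T p = 0) ->
  (forall p, p < 0 -> T' p = 0) -> lfin T -> lfin T' ->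
  forall K, lsum (fun l => nexp2 S T S' T' l (K - l)) = nexp (conv S S') (conv T T') K.
Proof.
move=> hS hS' hT hT' fT fT' K.
have fF := antidiag_lfin hS hS' fT fT' 0 K (or_intror (fun r => erefl (1 : C))).
transitivity (lsum (fun l => lsum (fun q : int * int =>
   1 *: (S (0 + l + q.1) * S' (K - l + q.2) * (T q.1 * T' q.2))))).
  by apply: eq_lsum => l; apply: eq_lsum => q; rewrite scale1r add0r.
rewrite (lsum_exchange fF).
have fG : lfin (fun Qq : int * int => conv S S' (K + Qq.1) * (T Qq.2 * T' (Qq.1 - Qq.2))).
  have bh : bijective (fun Qq : int * int => (Qq.2, Qq.1 - Qq.2)).
    by exists (fun q => (q.1 + q.2, q.1)) => -[x y] /=; congr (_, _); lia.
  apply: lfinMl; exact: (lfin_reindex bh (lfinM fT fT')).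
transitivity (lsum (fun q : int * int => conv S S' (K + q.1 + q.2) * (T q.1 * T' q.2))).
  apply: eq_lsum => -[q q'] /=; rewrite /conv lsumMr; last exact: conv0_lfin.
  have fl : lfin (fun l => S l * S' (K + q + q' - l) * (T q * T' q')).
    by apply: lfinMr; exact: conv0_lfin.
  rewrite (lsum_reindex (addz_bij q) fl); apply: eq_lsum => l; rewrite scale1r.
  by congr (S _ * S' _ * _); lia.
rewrite /nexp; transitivity (lsum (fun Q => lsum (fun q =>
    conv S S' (K + Q) * (T q * T' (Q - q))))); last first.
  by apply: eq_lsum => Q; rewrite {2}/conv lsumMl //; exact: conv0_lfin.
rewrite -(lsum_pair fG).
have bh : bijective (fun q : int * int => (q.1 + q.2, q.1)).
  by exists (fun Qq => (Qq.2, Qq.1 - Qq.2)) => -[x y] /=; congr (_, _); lia.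
rewrite (lsum_reindex bh fG) /=; apply: eq_lsum => -[q q'] /=.
by congr (conv _ _ _ * (_ * T' _)); lia.
Qed.

(** The coefficients of (1 - x)^c for c a natural number, and for c = -1. *)
Definition alt_binomial (c : nat) (r : int) : C :=
  if r is Posz n then (-1) ^+ n * 'C(c, n)%:R else 0.
Definition heaviside (r : int) : C := if r is Posz _ then 1 else 0.

Lemma binseq_alt_binomial c : binseq c%:R (alt_binomial c).
Proof.
split=> [[]//||[n|n]] /=; first by rewrite bin0 mulr1.
  have -> : n%:Z + 1 = n.+1%:Z by lia.
  rewrite addn1 exprS mulN1r mulNr mulrN.
  rewrite -!pmulrn mulrCA -natrM mul_bin_left natrM.
  have [cn|nc] := ltnP c n; first by rewrite bin_small // !mulr0 oppr0.
  by rewrite natrB // mulrCA -mulNr opprB.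
case: n => [|n]; first by rewrite (_ : Negz 0 + 1 = 0) ?mul0r ?mulr0.
by rewrite (_ : Negz n.+1 + 1 = Negz n) ?mulr0 //; lia.
Qed.

Lemma binseq_heaviside : binseq (-1) heaviside.
Proof.
split=> [[]//|//|[n|n]] /=.
  by rewrite !mulr1 opprK intrD.
case: n => [|n]; first by rewrite (_ : Negz 0 + 1 = 0) ?mul0r ?mulr0.
by rewrite (_ : Negz n.+1 + 1 = Negz n) ?mulr0 //; lia.
Qed.

Lemma alt_binomial_sym (c : nat) r : alt_binomial c (c%:Z - r) = (-1) ^+ c * alt_binomial c r.
Proof.
case: r => n; last first.
  rewrite (_ : c%:Z - Negz n = (c + n.+1)%N%:Z); last by lia.
  by rewrite /= bin_small ?mulr0 //; lia.
have [cn|nc] := ltnP c n.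
  by rewrite /= [X in _ * X]/= bin_small // !mulr0; case e : (c%:Z - n%:Z) => [m|m] //=; lia.
rewrite (_ : c%:Z - n%:Z = (c - n)%N%:Z) /= ?bin_sub //; last by lia.
rewrite mulrA; congr (_ * _); rewrite -exprD -signr_odd -[RHS]signr_odd.
by rewrite oddB // oddD.
Qed.

Lemma lsum_ord (c : nat) (F : int -> E) :
  (forall r, r < 0 -> F r = 0) -> (forall r, c%:Z < r -> F r = 0) ->
  lsum F = \sum_(r < c.+1) F r%:Z.
Proof.
move=> F0 Fc.
rewrite (lsum_fset (X := [fset r%:Z | r in iota 0 c.+1]%fset)); last first.
  case=> [r|r]; last by move=> _; apply: F0; lia.
  move=> /imfsetP hr; apply: Fc; apply/negP => hrc; apply: hr.
  by exists r => //=; rewrite !inE mem_iota; lia.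
rewrite big_imfset /=; last by move=> i j _ _ [].
rewrite -(big_mkord xpredT (fun r => F r%:Z)) /index_iota subn0.
apply/perm_big/uniq_perm; [exact: (undup_uniq (iota 0 c.+1))|exact: iota_uniq|].
exact: (mem_undup (iota 0 c.+1)).
Qed.

Section ProductFormulas.
Context (S T S' T' : int -> E).
Hypothesis hS : forall p, p < 0 -> S p = 0.
Hypothesis hS' : forall p, p < 0 -> S' p = 0.
Hypothesis hT : forall p, p < 0 -> T p = 0.
Hypothesis hT' : forall p, p < 0 -> T' p = 0.
Hypothesis fT : lfin T.
Hypothesis fT' : lfin T'.
Hypothesis SS' : forall p q, S p * S' q = S' q * S p.
Hypothesis TT' : forall p q, T p * T' q = T' q * T p.

(** Moving annihilators to the right costs (1 - w/z)^c on one side and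
    (1 - z/w)^c on the other; c is the pairing of the two lattice degrees. *)
Definition exchanges (c : C) := forall beta, binseq c beta ->
  (forall q p, T q * S' p = lsum (fun r => beta r *: (S' (p - r) * T (q - r)))) /\
  (forall q p, T' q * S p = lsum (fun r => beta r *: (S (p - r) * T' (q - r)))).

(** For c >= 0 both products are the normally ordered one times a polynomial,
    and (z - w)^c = (-1)^c (w - z)^c. *)
Lemma nexp_locality (c : nat) : exchanges c%:R -> forall a b,
  nexp S T (a - c%:Z) * nexp S' T' b = (-1) ^+ c *: (nexp S' T' (b - c%:Z) * nexp S T a).
Proof.
move=> hc a b; have hb := binseq_alt_binomial c; have [TS' T'S] := hc _ hb.
have bn := binseq_neg hb.
rewrite (nexpM hS hS' fT fT' bn hT TS') (nexpM hS' hS fT' fT bn hT' T'S).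
have fY := nexp2_beta_lfin (alt_binomial c) hS' hS fT' fT (b - c%:Z) a.
have bj : bijective (fun r : int => c%:Z - r).
  by exists (fun r => c%:Z - r) => r; lia.
rewrite (lsum_reindex bj fY) -lsumZ; last exact: (lfin_reindex bj fY).
apply: eq_lsum => r; rewrite alt_binomial_sym scalerA mulrA -exprD addnn -mul2n exprM sqrrN.
rewrite !expr1n mul1r nexp2C //; congr (_ *: nexp2 _ _ _ _ _ _); lia.
Qed.

(** The expansions of 1/(z - w) in both regions differ by the delta function. *)
Lemma nexp_simple_pole : exchanges (-1) -> forall a b,
  nexp S T (a + 1) * nexp S' T' b + nexp S' T' (b + 1) * nexp S T a =
  nexp (conv S S') (conv T T') (a + b + 1).
Proof.
move=> hc a b; have hb := binseq_heaviside; have [TS' T'S] := hc _ hb.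
have bn := binseq_neg hb.
rewrite (nexpM hS hS' fT fT' bn hT TS') (nexpM hS' hS fT' fT bn hT' T'S).
have fY := nexp2_beta_lfin heaviside hS' hS fT' fT (b + 1) a.
have bj : bijective (fun r : int => - 1 - r).
  by exists (fun r => - 1 - r) => r; lia.
rewrite (lsum_reindex bj fY) -lsumD; last exact: (lfin_reindex bj fY); last first.
  exact: nexp2_beta_lfin.
rewrite -nexp2_diag //.
have fD := nexp2_antidiag_lfin hS hS' fT fT' 0 (a + b + 1).
have fD' : lfin (fun r => nexp2 S T S' T' r (a + b + 1 - r)).
  by apply: eq_lfin fD => r; rewrite add0r.
rewrite (lsum_reindex (addz_bij (a + 1)) fD'); apply: eq_lsum => r.
rewrite (nexp2C SS' TT' fT fT').
have -> : b + 1 + (-1 - r) = b - r by lia.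
have -> : a - (-1 - r) = a + 1 + r by lia.
rewrite -scalerDl (_ : heaviside r + heaviside (-1 - r) = 1) ?scale1r; last first.
  case: r => r; first by rewrite (_ : -1 - r%:Z = Negz r) ?addr0 //; lia.
  by rewrite (_ : -1 - Negz r = r%:Z) ?add0r //; lia.
by congr (nexp2 _ _ _ _ _ _); lia.
Qed.

(** The value of (1 - x)^c at x = 1. *)
Lemma sum_alt_binomial (c : nat) : \sum_(r < c.+1) alt_binomial c r%:Z = (c == 0%N)%:R.
Proof.
have -> : (c == 0%N)%:R = (1 - 1) ^+ c :> C by rewrite subrr expr0n.
rewrite exprBn; apply: eq_bigr => r _ /=.
by rewrite !expr1n !mulr1 mulr_natr.
Qed.

(** For c >= 0 the expansion of (z - w)^c is a finite sum, so that setting z = w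
    makes sense. *)
Lemma nexpM_antidiag (c : nat) : exchanges c%:R -> forall K l,
  nexp S T l * nexp S' T' (K - l) = \sum_(r < c.+1)
    alt_binomial c r%:Z *: nexp2 S T S' T' (l + r%:Z) (K - (l + r%:Z)).
Proof.
move=> hc K l; have hb := binseq_alt_binomial c; have [TS' _] := hc _ hb.
have bn := binseq_neg hb.
rewrite (nexpM hS hS' fT fT' bn hT TS') (lsum_ord (c := c)).
- by apply: eq_bigr => r _; congr (_ *: nexp2 _ _ _ _ _ _); lia.
- by move=> r /bn->; rewrite scale0r.
- by case=> [r|r] hr; rewrite /= ?bin_small ?mulr0 ?scale0r //; lia.
Qed.

Lemma nexp2_line_lfin K (r : int) : lfin (fun l => nexp2 S T S' T' (l + r) (K - (l + r))).
Proof.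
apply: (lfin_reindex (addz_bij r) (F := fun l => nexp2 S T S' T' l (K - l))).
by apply: eq_lfin (nexp2_antidiag_lfin hS hS' fT fT' 0 K) => l; rewrite add0r.
Qed.

Lemma nexp_diagonal_lfin (c : nat) : exchanges c%:R -> forall K,
  lfin (fun l => nexp S T l * nexp S' T' (K - l)).
Proof.
move=> hc K; have f : lfin (fun l => \sum_(r < c.+1)
    alt_binomial c r%:Z *: nexp2 S T S' T' (l + r%:Z) (K - (l + r%:Z))).
  by apply: lfin_sum => r; apply: lfinZc; exact: nexp2_line_lfin.
by apply: eq_lfin f => l; rewrite (nexpM_antidiag hc).
Qed.

(** Setting z = w in (z - w)^c : S(z) S'(w) T(z) T'(w) :. *)
Lemma nexp_diagonal (c : nat) : exchanges c%:R -> forall K,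
  lsum (fun l => nexp S T l * nexp S' T' (K - l)) =
  (c == 0%N)%:R *: nexp (conv S S') (conv T T') K.
Proof.
move=> hc K; under eq_lsum do rewrite (nexpM_antidiag hc).
rewrite lsum_sum => [|r]; last by apply: lfinZc; exact: nexp2_line_lfin.
rewrite -sum_alt_binomial scaler_suml; apply: eq_bigr => r _.
rewrite lsumZ; last exact: nexp2_line_lfin.
have f : lfin (fun l => nexp2 S T S' T' l (K - l)).
  by apply: eq_lfin (nexp2_line_lfin K 0) => l; rewrite addr0.
by rewrite -(lsum_reindex (addz_bij r%:Z) f) nexp2_diag.
Qed.

End ProductFormulas.
End NormalOrder.

(** * Fermionic vertex operators *)

Section FermionicVertex.
Context (C : numFieldType) (V : lmodType C).
Local Notation E := (endo V).
Implicit Types (S T nu : int -> E).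

Definition ubound nu :=
  forall x, exists M : nat, forall l, M%:Z < l -> nu l x = 0.

(** The residue of z^a nu(z) S(z) T(z), for nu(z) = sum_l nu_l z^(-l-1). *)
Definition fnexp nu S T (a : int) : E := lsum (fun l => nu l * nexp S T (l - a)).

Lemma fnexp_lfin nu S T a : ubound nu -> lfin T -> (forall p, p < 0 -> S p = 0) ->
  (forall l p, nu l * S p = S p * nu l) -> (forall l p, nu l * T p = T p * nu l) ->
  lfin (fun l => nu l * nexp S T (l - a)).
Proof.
move=> bnu fT hS nuS nuT x; have [M hM] := bnu x.
have [M' hM'] := nexp_lbound fT hS x.
have [X hX] := int_interval_fset (a - M'%:Z) M%:Z.
exists X => l /hX[lM|lM].
  by rewrite endoM hM' ?linear0 //; lia.
by rewrite nexp_comm // endoM hM // linear0.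
Qed.

Section TwoVertices.
Context (nu S T nu' S' T' : int -> E).
Hypothesis bnu : ubound nu.
Hypothesis bnu' : ubound nu'.
Hypothesis hS : forall p, p < 0 -> S p = 0.
Hypothesis hS' : forall p, p < 0 -> S' p = 0.
Hypothesis hT : forall p, p < 0 -> T p = 0.
Hypothesis hT' : forall p, p < 0 -> T' p = 0.
Hypothesis fT : lfin T.
Hypothesis fT' : lfin T'.
Hypothesis SS' : forall p q, S p * S' q = S' q * S p.
Hypothesis TT' : forall p q, T p * T' q = T' q * T p.
Hypothesis nuS : forall l p, nu l * S p = S p * nu l.
Hypothesis nuT : forall l p, nu l * T p = T p * nu l.
Hypothesis nuS' : forall l p, nu l * S' p = S' p * nu l.
Hypothesis nuT' : forall l p, nu l * T' p = T' p * nu l.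
Hypothesis nu'S : forall l p, nu' l * S p = S p * nu' l.
Hypothesis nu'T : forall l p, nu' l * T p = T p * nu' l.
Hypothesis nu'S' : forall l p, nu' l * S' p = S' p * nu' l.
Hypothesis nu'T' : forall l p, nu' l * T' p = T' p * nu' l.

Local Notation G := (nexp S T).
Local Notation G' := (nexp S' T').

Let fx a : lfin (fun l => nu l * G (l - a)). Proof. exact: fnexp_lfin. Qed.
Let fx' a : lfin (fun l => nu' l * G' (l - a)). Proof. exact: fnexp_lfin. Qed.

Lemma fnexpM a b : fnexp nu S T a * fnexp nu' S' T' b =
  lsum (fun lk => nu lk.1 * nu' lk.2 * (G (lk.1 - a) * G' (lk.2 - b))).
Proof.
rewrite lsumM //; apply: eq_lsum => -[l k] /=.
by rewrite -!mulrA; congr (_ * _); rewrite !mulrA (nexp_comm fT (nu'S k) (nu'T k)).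
Qed.

Lemma fnexpM_lfin a b :
  lfin (fun lk => nu lk.1 * nu' lk.2 * (G (lk.1 - a) * G' (lk.2 - b))).
Proof.
apply: eq_lfin (lfinM (fx a) (fx' b)) => -[l k] /=.
by rewrite -!mulrA; congr (_ * _); rewrite !mulrA (nexp_comm fT (nu'S k) (nu'T k)).
Qed.

Lemma fnexpM_swap a b : fnexp nu' S' T' b * fnexp nu S T a =
  lsum (fun lk => nu' lk.2 * nu lk.1 * (G' (lk.2 - b) * G (lk.1 - a))).
Proof.
have bs : bijective (fun lk : int * int => (lk.2, lk.1)) by exists (fun ij => (ij.2, ij.1)) => -[].
rewrite lsumM // (lsum_reindex bs (lfinM (fx' b) (fx a))).
apply: eq_lsum => -[l k] /=.
by rewrite -!mulrA; congr (_ * _); rewrite !mulrA (nexp_comm fT' (nuS' l) (nuT' l)).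
Qed.

Lemma fnexpM_swap_lfin a b :
  lfin (fun lk => nu' lk.2 * nu lk.1 * (G' (lk.2 - b) * G (lk.1 - a))).
Proof.
have bs : bijective (fun lk : int * int => (lk.2, lk.1)) by exists (fun ij => (ij.2, ij.1)) => -[].
apply: eq_lfin (lfin_reindex bs (lfinM (fx' b) (fx a))) => -[l k] /=.
by rewrite -!mulrA; congr (_ * _); rewrite !mulrA (nexp_comm fT' (nuS' l) (nuT' l)).
Qed.

(** Without poles only the contraction of the two fermions contributes, and it
    evaluates the exponentials at the same point. *)
Lemma fnexp_anticomm (c : nat) kappa : exchanges S T S' T' c%:R ->
  (forall l k, nu l * nu' k + nu' k * nu l = (if k == - 1 - l then kappa else 0) *: (1 : E)) ->
  forall a b, fnexp nu S T (a + c%:Z) * fnexp nu' S' T' b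
    + (-1) ^+ c *: (fnexp nu' S' T' (b + c%:Z) * fnexp nu S T a)
  = (kappa * (c == 0%N)%:R) *: nexp (conv S S') (conv T T') (- 1 - a - b - c%:Z).
Proof.
move=> hc hnu a b; rewrite fnexpM fnexpM_swap.
pose F (lk : int * int) := (if lk.2 == - 1 - lk.1 then kappa else 0) *:
   (G (lk.1 - a - c%:Z) * G' (lk.2 - b)).
have EF lk : nu lk.1 * nu' lk.2 * (G (lk.1 - (a + c%:Z)) * G' (lk.2 - b))
   + (-1) ^+ c *: (nu' lk.2 * nu lk.1 * (G' (lk.2 - (b + c%:Z)) * G (lk.1 - a))) = F lk.
  rewrite -endoZr !opprD !addrA -(nexp_locality hS hS' hT hT' fT fT' SS' TT' hc).
  by rewrite -mulrDl hnu endoZl mul1r.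
have fF : lfin F.
  by apply: eq_lfin (lfinD (fnexpM_lfin _ _) (lfinZc ((-1) ^+ c) (fnexpM_swap_lfin _ _))) => lk.
rewrite -lsumZ; last exact: fnexpM_swap_lfin.
rewrite -lsumD; [|exact: fnexpM_lfin|by apply: lfinZc; exact: fnexpM_swap_lfin].
rewrite (eq_lsum EF) (lsum_pair fF).
transitivity (lsum (fun l => kappa *: (G (l - (a + c%:Z)) * G' (- 1 - a - b - c%:Z - (l - (a + c%:Z)))))).
  apply: eq_lsum => l; rewrite (@lsum1 _ _ _ _ (- 1 - l)) /F /=.
    by rewrite eqxx; congr (_ *: (G _ * G' _)); lia.
  by move=> k /negbTE->; rewrite scale0r.
have fl := nexp_diagonal_lfin hS hS' hT fT fT' hc (- 1 - a - b - c%:Z).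
have bs := addz_bij (- (a + c%:Z)).
rewrite lsumZ; last exact: (lfin_reindex bs fl).
by rewrite -(lsum_reindex bs fl) (nexp_diagonal hS hS' hT hT' fT fT' hc) scalerA.
Qed.

(** The simple pole is cancelled by the zero of nu(z) nu(w) at z = w: the delta
    function of [nexp_simple_pole] symmetrizes nu_l nu_k, which is alternating. *)
Lemma fnexp_anticomm_pole : exchanges S T S' T' (- 1) -> nu =1 nu' ->
  (forall l k, nu l * nu k + nu k * nu l = 0) ->
  forall a b, fnexp nu S T (a - 1) * fnexp nu' S' T' b
    - fnexp nu' S' T' (b - 1) * fnexp nu S T a = 0.
Proof.
move=> hc hnn hnu a b; rewrite fnexpM fnexpM_swap.
pose Z := nexp (conv S S') (conv T T').
pose F (lk : int * int) := nu lk.1 * nu lk.2 * Z (lk.1 + lk.2 - a - b + 1).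
have EF lk : nu lk.1 * nu' lk.2 * (G (lk.1 - (a - 1)) * G' (lk.2 - b))
   - nu' lk.2 * nu lk.1 * (G' (lk.2 - (b - 1)) * G (lk.1 - a)) = F lk.
  have := hnu lk.1 lk.2; rewrite addrC => /eqP; rewrite addr_eq0 => /eqP e.
  rewrite -hnn e mulNr opprK -mulrDr /F; congr (_ * _).
  have -> : lk.1 - (a - 1) = (lk.1 - a) + 1 by lia.
  have -> : lk.2 - (b - 1) = (lk.2 - b) + 1 by lia.
  rewrite (nexp_simple_pole hS hS' hT hT' fT fT' SS' TT' hc).
  by congr Z; lia.
have fF : lfin F.
  by apply: eq_lfin (lfinD (fnexpM_lfin _ _) (lfinN (fnexpM_swap_lfin _ _))) => lk; exact: EF.
rewrite -lsumN; last exact: fnexpM_swap_lfin.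
rewrite -lsumD; [|exact: fnexpM_lfin|by apply: lfinN; exact: fnexpM_swap_lfin].
rewrite (eq_lsum EF).
have bs : bijective (fun lk : int * int => (lk.2, lk.1)) by exists (fun ij => (ij.2, ij.1)) => -[].
have h : lsum F = - lsum F.
  rewrite {1}(lsum_reindex bs fF) -lsumN //; apply: eq_lsum => -[l k]; rewrite /F /=.
  have := hnu k l => /eqP; rewrite addr_eq0 => /eqP->.
  by rewrite mulNr [k + l]addrC.
have : (1 + 1 : C) *: lsum F = 0.
  by rewrite scalerDl scale1r {1}h addNr.
move/(congr1 (fun A => (1 + 1 : C)^-1 *: A)); rewrite scalerA mulVf ?scaler0 ?scale1r //.
by rewrite (_ : 1 + 1 = 2%:R) ?pnatr_eq0.
Qed.

End TwoVertices.
End FermionicVertex.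

(** * Free modules *)

(** Opaque below, so that unification does not unfold the module structure. *)
Definition freeMod (C : numFieldType) (K : choiceType) : lmodType C := {malg C[K]}.

HB.lock Definition basis_vec (C : numFieldType) (K : choiceType) (e : K) : freeMod C K :=
  (<< e >> : {malg C[K]}).
Arguments basis_vec {C K} e.

Section LinearExtension.
Context (C : numFieldType) (K : choiceType).
Local Notation V := (freeMod C K).
Local Notation E := (endo V).
Local Notation basis_vec := (@basis_vec C K).
Implicit Types (e : K) (phi : K -> V) (x : V).

Definition supp x : {fset K} := msupp (x : {malg C[K]}).
Definition coord e x : C := mcoeff e (x : {malg C[K]}).

Lemma freeMod_sum x : x = \sum_(e <- supp x) coord e x *: basis_vec e.
Proof.
rewrite basis_vec.unlock; rewrite {1}[x](@monalgE K C x); apply: eq_bigr => e _.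
by apply/malgP => k; rewrite mcoeffU [RHS]mcoeffZ mcoeffU mulr_natr.
Qed.

Lemma coord_out e x : e \notin supp x -> coord e x = 0.
Proof. exact: mcoeff_outdom. Qed.

Definition linexp phi x : V := \sum_(e <- supp x) coord e x *: phi e.

Lemma linexpEw phi x (X : {fset K}) : (supp x `<=` X)%fset ->
  linexp phi x = \sum_(e <- X) coord e x *: phi e.
Proof.
move=> h; rewrite /linexp (big_fset_incl _ h) // => e _ /coord_out ->.
by rewrite scale0r.
Qed.

Lemma coordP e c x y : coord e (c *: x + y) = c * coord e x + coord e y.
Proof. by rewrite /coord mcoeffD mcoeffZ. Qed.

Lemma suppP c x y : (supp (c *: x + y) `<=` supp x `|` supp y)%fset.
Proof. by apply: fsubset_trans (msuppD_le _ _) _; apply: fsetSU; exact: msuppZ_le. Qed.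

Lemma linexp_linear phi : linear (linexp phi).
Proof.
move=> c x y; rewrite (linexpEw phi (suppP c x y)).
rewrite (@linexpEw phi x _ (fsubsetUl _ (supp y))) (@linexpEw phi y _ (fsubsetUr (supp x) _)).
rewrite scaler_sumr -big_split; apply: eq_bigr => e _.
by rewrite coordP scalerDl scalerA.
Qed.

Definition lin phi : E := Endo (linexp_linear phi).

Lemma supp_basis_vec e : supp (basis_vec e) = [fset e]%fset.
Proof. by rewrite basis_vec.unlock /supp msuppU oner_eq0. Qed.

Lemma coord_basis_vec e k : coord e (basis_vec k) = (k == e)%:R.
Proof. by rewrite basis_vec.unlock /coord mcoeffU. Qed.

Lemma linU phi e : lin phi (basis_vec e) = phi e.
Proof.
rewrite /= /linexp supp_basis_vec.
by rewrite big_seq_fset1 coord_basis_vec eqxx scale1r.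
Qed.

Lemma lin_ext (A B : E) : (forall e, A (basis_vec e) = B (basis_vec e)) -> A = B.
Proof.
move=> h; apply: endoP => x; rewrite [x]freeMod_sum !linear_sum.
by apply: eq_bigr => e _; rewrite !linearZ /= h.
Qed.

End LinearExtension.

#[global] Opaque freeMod.

(** * Oscillators on the Fock space *)

Definition CC (R : realType) : numFieldType := R[i].
Definition stateC (d : nat) : choiceType := state d.
Definition fock_mod (R : realType) (d : nat) : lmodType (CC R) := freeMod (CC R) (stateC d).
Local Notation ket := (@basis_vec _ (stateC _)).
Local Notation slin := (@lin _ (stateC _)).

HB.lock Definition bos_cre (R : realType) (d : nat) (g : mode d) : endo (fock_mod R d) :=
  slin (fun e => let: (l, B, F) := e in ket (l, msetD [mset g]%mset B, F)).
HB.lock Definition bos_ann (R : realType) (d : nat) (g : mode d) : endo (fock_mod R d) :=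
  slin (fun e => let: (l, B, F) := e in
    ((B g)%:R : CC R) *: ket (l, msetB B [mset g]%mset, F)).
HB.lock Definition ferm_cre (R : realType) (d : nat) (g : mode d) : endo (fock_mod R d) :=
  slin (fun e => let: (l, B, F) := e in
    if g \in F then 0 else (koszul_sign R g F : CC R) *: ket (l, B, (g |` F)%fset)).
HB.lock Definition ferm_ann (R : realType) (d : nat) (g : mode d) : endo (fock_mod R d) :=
  slin (fun e => let: (l, B, F) := e in
    if g \in F then (koszul_sign R g F : CC R) *: ket (l, B, (F `\ g)%fset) else 0).

Section Oscillators.
Context (R : realType) (d : nat).
Local Notation C := (CC R).
Local Notation V := (fock_mod R d).
Local Notation E := (endo V).
Local Notation bos_cre := (@bos_cre R d).
Local Notation bos_ann := (@bos_ann R d).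
Local Notation ferm_cre := (@ferm_cre R d).
Local Notation ferm_ann := (@ferm_ann R d).

Lemma bos_creU g l B F : bos_cre g (ket (l, B, F)) = ket (l, msetD [mset g]%mset B, F).
Proof. by rewrite bos_cre.unlock linU. Qed.
Lemma bos_annU g l B F : bos_ann g (ket (l, B, F)) = ((B g)%:R : C) *: ket (l, msetB B [mset g]%mset, F).
Proof. by rewrite bos_ann.unlock linU. Qed.
Lemma ferm_creU g l B F : ferm_cre g (ket (l, B, F)) =
  if g \in F then 0 else (koszul_sign R g F : C) *: ket (l, B, (g |` F)%fset).
Proof. by rewrite ferm_cre.unlock linU. Qed.
Lemma ferm_annU g l B F : ferm_ann g (ket (l, B, F)) =
  if g \in F then (koszul_sign R g F : C) *: ket (l, B, (F `\ g)%fset) else 0.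
Proof. by rewrite ferm_ann.unlock linU. Qed.

Lemma bos_creC g h : bos_cre g * bos_cre h = bos_cre h * bos_cre g.
Proof. by apply: (@lin_ext C (stateC d)) => -[[l B] F]; rewrite !endoM !bos_creU msetDCA. Qed.

Lemma bos_annC g h : bos_ann g * bos_ann h = bos_ann h * bos_ann g.
Proof.
apply: (@lin_ext C (stateC d)) => -[[l B] F]; rewrite !endoM !bos_annU !linearZ /= !bos_annU !scalerA.
have [->//|gh] := eqVneq g h.
rewrite !msetB1E (negbTE gh) eq_sym (negbTE gh) !subn0 mulrC; congr (_ *: ket (_, _, _)).
by apply/msetP => k; rewrite !msetB1E subnAC.
Qed.

Lemma bos_ann_cre g h : bos_ann g * bos_cre h - bos_cre h * bos_ann g = (g == h)%:R *: (1 : E).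
Proof.
apply: (@lin_ext C (stateC d)) => -[[l B] F];
rewrite endoD endoN endoZ endo1 !endoM bos_annU bos_creU bos_annU linearZ /= bos_creU.
rewrite mset1DE; have [<-|gh] := eqVneq g h; last first.
  rewrite add0n scale0r [X in _ *: X - _](_ : _ = ket (l, msetD [mset h]%mset (msetB B [mset g]%mset), F)) ?subrr //.
  congr (ket (_, _, _)); apply/msetP => k; rewrite msetB1E !mset1DE msetB1E.
  have [->|_] := eqVneq k g; last by rewrite !subn0.
  by rewrite [g == h](_ : _ = false) ?add0n //; exact/negbTE.
rewrite add1n scale1r msetD1K; have [B0|Bn] := posnP (B g).
  by rewrite B0 scale0r subr0 scale1r.
have gB : g \in (B : {mset mode d}%mset) by rewrite in_mset.
by rewrite msetB1K // -scalerBl -natrB // subSnn scale1r.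
Qed.

Lemma bos_cre_ferm_cre g h : bos_cre g * ferm_cre h = ferm_cre h * bos_cre g.
Proof.
apply: (@lin_ext C (stateC d)) => -[[l B] F]; rewrite !endoM bos_creU !ferm_creU.
by case: (h \in F); rewrite ?linear0 // linearZ /= bos_creU.
Qed.
Lemma bos_cre_ferm_ann g h : bos_cre g * ferm_ann h = ferm_ann h * bos_cre g.
Proof.
apply: (@lin_ext C (stateC d)) => -[[l B] F]; rewrite !endoM bos_creU !ferm_annU.
by case: (h \in F); rewrite ?linear0 // linearZ /= bos_creU.
Qed.
Lemma bos_ann_ferm_cre g h : bos_ann g * ferm_cre h = ferm_cre h * bos_ann g.
Proof.
apply: (@lin_ext C (stateC d)) => -[[l B] F]; rewrite !endoM bos_annU linearZ /= !ferm_creU.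
case: (h \in F); first by rewrite linear0 scaler0.
by rewrite linearZ /= bos_annU !scalerA mulrC.
Qed.
Lemma bos_ann_ferm_ann g h : bos_ann g * ferm_ann h = ferm_ann h * bos_ann g.
Proof.
apply: (@lin_ext C (stateC d)) => -[[l B] F]; rewrite !endoM bos_annU linearZ /= !ferm_annU.
case: (h \in F); last by rewrite linear0 scaler0.
by rewrite linearZ /= bos_annU !scalerA mulrC.
Qed.

Definition before (g h : mode d) : nat := (choice.pickle h < choice.pickle g)%N.

Lemma before_anti g h : g != h -> (before g h + before h g = 1)%N.
Proof.
move=> gh; have : choice.pickle g != choice.pickle h.
  by apply: contra gh => /eqP /(pcan_inj choice.pickleK) ->.
by rewrite /before; lia.
Qed.

(** Adding h to F changes the Koszul sign of g iff h precedes g; for two distinct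
    modes exactly one precedes the other, whence all the anticommutation signs. *)
Lemma koszulU g h (F : {fset mode d}) : h \notin F ->
  koszul_sign R g (h |` F)%fset = (-1) ^+ before g h * koszul_sign R g F.
Proof.
move=> hF; rewrite /koszul_sign -exprD; congr (_ ^+ _).
have p : perm_eq (h |` F)%fset (h :: F).
  by apply: uniq_perm; rewrite ?fset_uniq /= ?hF ?fset_uniq // => k; rewrite !inE.
by rewrite (permP p).
Qed.

Lemma koszulD g h (F : {fset mode d}) : h \in F ->
  koszul_sign R g (F `\ h)%fset = (-1) ^+ before g h * koszul_sign R g F.
Proof.
move=> hF; rewrite -{2}(fsetD1K hF) koszulU ?inE ?eqxx // mulrA -exprD addnn.
by rewrite -mul2n exprM sqrrN !expr1n mul1r.
Qed.

Lemma beforexx g : before g g = 0%N. Proof. by rewrite /before ltnn. Qed.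

Lemma sign_before g h (c : C) : g != h ->
  (-1) ^+ before g h * c + (-1) ^+ before h g * c = 0.
Proof.
move/before_anti; case: (before g h) => [|[|n]] //; rewrite ?add0n ?add1n.
  by move=> ->; rewrite mul1r mulN1r subrr.
by case=> ->; rewrite mulN1r mul1r addNr.
Qed.

Lemma koszul2 g (F : {fset mode d}) : koszul_sign R g F * koszul_sign R g F = 1.
Proof. by rewrite /koszul_sign -exprD addnn -mul2n exprM sqrrN !expr1n. Qed.

Lemma ferm_creC g h : ferm_cre g * ferm_cre h + ferm_cre h * ferm_cre g = 0.
Proof.
apply: (@lin_ext C (stateC d)) => -[[l B] F]; rewrite endoD !endoM endo0 !ferm_creU.
have [hF|hF] := boolP (h \in F); have [gF|gF] := boolP (g \in F);
  rewrite ?linear0 ?addr0 ?add0r // !linearZ /= !ferm_creU !inE ?hF ?gF ?orbT ?scaler0 ?addr0 //.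
have [->|gh] := eqVneq g h; first by rewrite /= !scaler0 addr0.
rewrite /= (negbTE hF) (negbTE gF) (koszulU _ hF) (koszulU _ gF) !scalerA.
rewrite fsetUCA -scalerDl.
set a := koszul_sign _ _ _; set b := koszul_sign _ _ _.
rewrite [X in X *: _](_ : _ = (-1) ^+ before g h * (a * b) + (-1) ^+ before h g * (a * b)).
  by rewrite sign_before // scale0r.
by ring.
Qed.

Lemma ferm_annC g h : ferm_ann g * ferm_ann h + ferm_ann h * ferm_ann g = 0.
Proof.
apply: (@lin_ext C (stateC d)) => -[[l B] F]; rewrite endoD !endoM endo0 !ferm_annU.
have [hF|hF] := boolP (h \in F); have [gF|gF] := boolP (g \in F);
  rewrite ?linear0 ?addr0 ?add0r // !linearZ /= !ferm_annU !inE ?hF ?gF ?(negbTE hF) ?(negbTE gF) ?andbF ?scaler0 ?addr0 //.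
have [->|gh] := eqVneq g h; first by rewrite /= !scaler0 addr0.
rewrite /= (koszulD _ hF) (koszulD _ gF) !scalerA.
rewrite fsetDDl fsetDDl fsetUC -scalerDl.
set a := koszul_sign _ _ _; set b := koszul_sign _ _ _.
rewrite [X in X *: _](_ : _ = (-1) ^+ before g h * (a * b) + (-1) ^+ before h g * (a * b)).
  by rewrite sign_before // scale0r.
by ring.
Qed.

Lemma ferm_ann_cre g h : ferm_ann g * ferm_cre h + ferm_cre h * ferm_ann g = (g == h)%:R *: (1 : E).
Proof.
apply: (@lin_ext C (stateC d)) => -[[l B] F]; rewrite endoD !endoM endoZ endo1 ferm_creU ferm_annU.
have [<-|gh] := eqVneq g h.
  have [gF|gF] := boolP (g \in F).
    rewrite /= linear0 add0r linearZ /= ferm_creU !inE eqxx /= (@koszulD g g F gF) beforexx expr0 mul1r.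
    by rewrite scalerA koszul2 fsetD1K.
  rewrite /= linear0 addr0 linearZ /= ferm_annU !inE eqxx /= (@koszulU g g F gF) beforexx expr0 mul1r.
  by rewrite scalerA koszul2 fsetU1K.
have hg : (h == g) = false by rewrite eq_sym; exact/negbTE.
rewrite scale0r; have [hF|hF] := boolP (h \in F); have [gF|gF] := boolP (g \in F).
- by rewrite /= linear0 add0r linearZ /= ferm_creU !inE hF hg /= scaler0.
- by rewrite /= !linear0 addr0.
- rewrite /= !linearZ /= ferm_creU ferm_annU !inE gF (negbTE hF) hg orbT andbF /=.
  rewrite (@koszulU g h F hF) (@koszulD h g F gF) !scalerA.
  have -> : ((h |` F) `\ g = h |` (F `\ g))%fset.
    by rewrite fsetDUl; congr (_ `|` _)%fset; apply/fsetDidPl; rewrite fdisjoint1X inE hg.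
  rewrite -scalerDl; set a := koszul_sign _ _ _; set b := koszul_sign _ _ _.
  rewrite [X in X *: _](_ : _ = (-1) ^+ before g h * (a * b) + (-1) ^+ before h g * (a * b)).
    by rewrite sign_before // scale0r.
  by ring.
- by rewrite /= linear0 addr0 linearZ /= ferm_annU !inE (negbTE gF) (negbTE gh) scaler0.
Qed.

End Oscillators.

(** * Vertex operators on the Fock space *)

Section Weight.
Context (R : realType) (d : nat).
Local Notation C := (CC R).
Local Notation V := (fock_mod R d).
Local Notation E := (endo V).

(** The conformal weight of the bosonic part: an annihilation operator of index k
    lowers it by exactly k + 1. *)
Definition weight (B : {mset mode d}%mset) : nat := (\sum_(g <- enum_mset B) g.2.+1)%N.

Lemma weightB (B : {mset mode d}%mset) g : (0 < B g)%N ->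
  (weight (msetB B [mset g]%mset) + g.2.+1 = weight B)%N.
Proof.
move=> B0; have gB : g \in B by rewrite in_mset.
rewrite /weight addnC -[in RHS](msetB1K gB).
transitivity (\sum_(h <- g :: enum_mset (msetB B [mset g]%mset)) h.2.+1)%N; first by rewrite big_cons.
apply/perm_big; apply/allP => h _ /=; apply/eqP.
by rewrite -/(count_mem h _) !count_mem_mset mset1DE eq_sym.
Qed.

Definition wle (n : nat) (x : V) := forall e, e \in supp x -> (weight e.1.2 <= n)%N.

Lemma wle_ket n (e : stateC d) : (weight e.1.2 <= n)%N -> wle n (basis_vec e).
Proof. by move=> h k; rewrite supp_basis_vec inE => /eqP->. Qed.

Lemma wle0 n : wle n 0.
Proof. by move=> e; rewrite /supp msupp0. Qed.

Lemma wleD n (c : C) (x y : V) : wle n x -> wle n y -> wle n (c *: x + y).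
Proof.
move=> hx hy e /(fsubsetP (suppP c x y)); rewrite inE => /orP[/hx|/hy] //.
Qed.

Lemma wle_ex x : exists n, wle n x.
Proof.
have [M hM] := fset_bound (supp x) (fun e : stateC d => (weight e.1.2)%:Z).
by exists M => e /hM; lia.
Qed.

Lemma wle_lin n (A : E) (P : V -> Prop) : P 0 ->
  (forall c x y, P x -> P y -> P (c *: x + y)) ->
  (forall e : stateC d, (weight e.1.2 <= n)%N -> P (A (basis_vec e))) ->
  forall x, wle n x -> P (A x).
Proof.
move=> P0 PD PA x hx; rewrite [x]freeMod_sum linear_sum big_seq.
apply: big_ind => // [u v Pu Pv|e ex]; first by rewrite -[u]scale1r; apply: PD.
by rewrite linearZ /= -[X in P X]addr0; apply: PD => //; apply: PA; exact: hx.
Qed.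

End Weight.

Section VertexData.
Context (R : realType) (d : nat) (a : 'M[nat]_d).
Local Notation C := (CC R).
Local Notation V := (fock_mod R d).
Local Notation E := (endo V).
Local Notation bos_cre := (@bos_cre R d).
Local Notation bos_ann := (@bos_ann R d).
Local Notation ferm_cre := (@ferm_cre R d).
Local Notation ferm_ann := (@ferm_ann R d).
Implicit Types (eta zeta : degree d) (s t : gen d).

(** Coordinates in the basis (u_i), (v_j), on which the modes of a general
    lattice degree are expanded. *)
Definition gcoord eta t : rat :=
  match t with inl i => eta.1 0 i | inr j => eta.2 0 j end.

Lemma pairingDl m m' n : pairing a (m + m') n = pairing a m n + pairing a m' n.
Proof. by rewrite /pairing !mulmxDl mxE. Qed.
Lemma pairingDr m n n' : pairing a m (n + n') = pairing a m n + pairing a m n'.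
Proof. by rewrite /pairing linearD /= mulmxDr mxE. Qed.
Lemma pairingZl c m n : pairing a (c *: m) n = c * pairing a m n.
Proof. by rewrite /pairing -!scalemxAl mxE. Qed.
Lemma pairingZr c m n : pairing a m (c *: n) = c * pairing a m n.
Proof. by rewrite /pairing linearZ /= -scalemxAr mxE. Qed.
Lemma pairing0l n : pairing a 0 n = 0.
Proof. by rewrite /pairing !mul0mx mxE. Qed.
Lemma pairing0r m : pairing a m 0 = 0.
Proof. by rewrite /pairing linear0 mulmx0 mxE. Qed.
Lemma pairing_suml (I : Type) (r : seq I) (F : I -> 'rV_d) n :
  pairing a (\sum_(i <- r) F i) n = \sum_(i <- r) pairing a (F i) n.
Proof. by elim/big_rec2: _ => [|i y x _ <-]; rewrite ?pairing0l ?pairingDl. Qed.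
Lemma pairing_sumr (I : Type) (r : seq I) (F : I -> 'rV_d) m :
  pairing a m (\sum_(i <- r) F i) = \sum_(i <- r) pairing a m (F i).
Proof. by elim/big_rec2: _ => [|i y x _ <-]; rewrite ?pairing0r ?pairingDr. Qed.

Lemma formC eta zeta : form a eta zeta = form a zeta eta.
Proof. by rewrite /form addrC. Qed.
Lemma formDl eta eta' zeta : form a (eta + eta') zeta = form a eta zeta + form a eta' zeta.
Proof. by rewrite /form pairingDl pairingDr addrACA. Qed.

(** The generators are not self-dual for the form; expanding one argument lets
    the bracket of modes collapse to a diagonal sum in [an_mode_cr_mode]. *)
Lemma form_gens eta zeta :
  form a eta zeta = \sum_t gcoord zeta t * form a eta (gen_degree t).
Proof.
rewrite big_sumType /= addrC /form; congr (_ + _).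
  rewrite {1}[zeta.2]row_sum_delta pairing_sumr; apply: eq_bigr => j _.
  by rewrite /= pairingZr pairing0l addr0.
rewrite {1}[zeta.1]row_sum_delta pairing_suml; apply: eq_bigr => i _.
by rewrite /= pairingZl pairing0r add0r.
Qed.

Definition cr_mode eta (k : nat) : E := \sum_t (ratr (gcoord eta t) : C) *: bos_cre (t, k).
Definition an_mode eta (k : nat) : E :=
  \sum_t (k.+1%:R * ratr (form a eta (gen_degree t)) : C) *: bos_ann (t, k).

Lemma comm_lc (A : E) (I : finType) (c : I -> C) (F : I -> E) :
  (forall i, A * F i = F i * A) -> A * (\sum_i c i *: F i) = (\sum_i c i *: F i) * A.
Proof.
move=> h; rewrite mulr_sumr mulr_suml; apply: eq_bigr => i _.
by rewrite endoZr endoZl h.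
Qed.

Lemma eq_scale (c c' : C) (A : E) : c = c' -> c *: A = c' *: A.
Proof. by move->. Qed.

Lemma bracket_lc (I J : finType) (c : I -> C) (c' : J -> C) (F : I -> E) (G : J -> E) (k : I -> J -> C) :
  (forall i j, F i * G j - G j * F i = k i j *: (1 : E)) ->
  (\sum_i c i *: F i) * (\sum_j c' j *: G j) - (\sum_j c' j *: G j) * (\sum_i c i *: F i)
  = (\sum_i \sum_j c i * c' j * k i j) *: (1 : E).
Proof.
move=> h; rewrite !mulr_suml scaler_suml.
have -> : \sum_j c' j *: G j * (\sum_i c i *: F i) =
          \sum_i (\sum_j c' j *: G j) * (c i *: F i).
  by rewrite -mulr_suml mulr_sumr.
rewrite -sumrB; apply: eq_bigr => i _.
rewrite mulr_sumr mulr_suml -sumrB scaler_suml; apply: eq_bigr => j _.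
rewrite !(endoZl, endoZr) !scalerA [c' j * c i]mulrC -scalerBr h.
by rewrite scalerA.
Qed.

Lemma cr_modeC eta zeta k l : cr_mode eta k * cr_mode zeta l = cr_mode zeta l * cr_mode eta k.
Proof. by apply: comm_lc => t; apply/esym/comm_lc => s; rewrite bos_creC. Qed.

Lemma an_modeC eta zeta k l : an_mode eta k * an_mode zeta l = an_mode zeta l * an_mode eta k.
Proof. by apply: comm_lc => t; apply/esym/comm_lc => s; rewrite bos_annC. Qed.

Lemma an_mode_cr_mode eta zeta k l : an_mode eta k * cr_mode zeta l - cr_mode zeta l * an_mode eta k =
  (if l == k then k.+1%:R * (ratr (form a eta zeta) : C) else 0) *: (1 : E).
Proof.
rewrite (bracket_lc _ _ (k := fun t s => ((t, k) == (s, l))%:R)); last first.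
  by move=> t s; exact: bos_ann_cre.
apply: eq_scale; case: eqP => [->|lk]; last first.
  rewrite big1 // => t _; rewrite big1 // => s _.
  by rewrite xpair_eqE [k == l]eq_sym (introF eqP lk) andbF mulr0.
rewrite form_gens rmorph_sum mulr_sumr; apply: eq_bigr => t _ /=.
rewrite (bigD1 t) //= eqxx mulr1 big1 ?addr0; last first.
  by move=> s st; rewrite xpair_eqE [t == s]eq_sym (negbTE st) mulr0.
by rewrite rmorphM /= -mulrA [X in _ * X]mulrC.
Qed.

(** The two exponential factors of the vertex operator of eta, in powers of z and
    of 1/z; unlike for generators, eta may be any rational degree. *)
Definition exp_cr eta : int -> E := expZ (fun k => (k%:R)^-1 *: cr_mode eta k.-1).
Definition exp_an eta : int -> E := expZ (fun k => - (k%:R)^-1 *: an_mode eta k.-1).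

Lemma exp_cr_exp eta : expseq (cr_mode eta) (exp_cr eta).
Proof.
have -> : cr_mode eta = fun k => (k.+1%:R : C) *: ((k.+1%:R)^-1 *: cr_mode eta k).
  by apply/funext => k; rewrite scalerA mulfV ?scale1r // pnatr_eq0.
by apply: expseq_expZ => k l; rewrite !(endoZl, endoZr) !scalerA mulrC cr_modeC.
Qed.

Lemma exp_an_exp eta : expseq (fun k => - an_mode eta k) (exp_an eta).
Proof.
have -> : (fun k => - an_mode eta k) = fun k => (k.+1%:R : C) *: (- (k.+1%:R)^-1 *: an_mode eta k).
  by apply/funext => k; rewrite scalerA mulrN mulfV ?scaleN1r // pnatr_eq0.
by apply: expseq_expZ => k l; rewrite !(endoZl, endoZr) !scalerA mulrC an_modeC.
Qed.

Lemma exp_cr_neg eta p : p < 0 -> exp_cr eta p = 0. Proof. exact: expseq_neg (exp_cr_exp eta) p. Qed.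
Lemma exp_an_neg eta p : p < 0 -> exp_an eta p = 0. Proof. exact: expseq_neg (exp_an_exp eta) p. Qed.

Lemma exp_crC eta zeta p q : exp_cr eta p * exp_cr zeta q = exp_cr zeta q * exp_cr eta p.
Proof.
apply: (expseq_comm (exp_cr_exp zeta)) => k; apply/esym.
by apply: (expseq_comm (exp_cr_exp eta)) => l; exact: cr_modeC.
Qed.

Lemma exp_anC eta zeta p q : exp_an eta p * exp_an zeta q = exp_an zeta q * exp_an eta p.
Proof.
apply: (expseq_comm (exp_an_exp zeta)) => k; apply/esym.
by apply: (expseq_comm (exp_an_exp eta)) => l; rewrite !mulNr !mulrN an_modeC.
Qed.

Lemma gcoordD eta zeta t : gcoord (eta + zeta) t = gcoord eta t + gcoord zeta t.
Proof. by case: t => i; rewrite /= mxE. Qed.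

Lemma cr_modeD eta zeta k : cr_mode (eta + zeta) k = cr_mode eta k + cr_mode zeta k.
Proof.
rewrite /cr_mode -big_split; apply: eq_bigr => t _ /=.
by rewrite gcoordD rmorphD /= scalerDl.
Qed.

Lemma an_modeD eta zeta k : an_mode (eta + zeta) k = an_mode eta k + an_mode zeta k.
Proof.
rewrite /an_mode -big_split; apply: eq_bigr => t _ /=.
by rewrite -scalerDl -mulrDr -rmorphD /= -formDl.
Qed.

(** At z = w the creation parts of two vertex operators merge into the one of the
    sum of the degrees, by uniqueness of exponentials. *)
Lemma exp_crD eta zeta : conv (exp_cr eta) (exp_cr zeta) = exp_cr (eta + zeta).
Proof.
apply/funext; apply: expseq_unique (exp_cr_exp _).
have -> : cr_mode (eta + zeta) = fun k => cr_mode eta k + cr_mode zeta k.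
  by apply/funext => k; exact: cr_modeD.
by apply: expseqM (exp_cr_exp _) (exp_cr_exp _) _ => k l; exact: cr_modeC.
Qed.

Lemma exp_anD eta zeta : conv (exp_an eta) (exp_an zeta) = exp_an (eta + zeta).
Proof.
apply/funext; apply: expseq_unique (exp_an_exp _).
have -> : (fun k => - an_mode (eta + zeta) k) = fun k => - an_mode eta k + - an_mode zeta k.
  by apply/funext => k; rewrite an_modeD opprD.
by apply: expseqM (exp_an_exp _) (exp_an_exp _) _ => k l; rewrite !mulNr !mulrN an_modeC.
Qed.

Lemma exp_an_lfin eta : lfin (exp_an eta).
Proof.
apply: (expseq_lfin (exp_an_exp eta) (@wle0 R d) (@wleD R d) _ (@wle_ex R d)) => k n x hx.
have step (t : gen d) (e : stateC d) : (weight e.1.2 <= n)%N ->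
    if (k < n)%N then wle (n - k.+1) (bos_ann (t, k) (basis_vec e)) else bos_ann (t, k) (basis_vec e) = 0.
  case: e => [[l B] F] /= hB; rewrite bos_annU.
  have [B0|Bn] := posnP (B (t, k)).
    by rewrite B0 scale0r; case: ifP => _ //; exact: wle0.
  have := weightB Bn => /= hw; case: ifPn => kn; last by exfalso; lia.
  rewrite -[_ *: _]addr0; apply: wleD (@wle0 _ _ _); apply: wle_ket => /=; lia.
case: ifPn => kn; last first.
  apply: (wle_lin (n := n) (P := fun y => y = 0)) => // [c y z -> ->|e he].
    by rewrite scaler0 addr0.
  rewrite endoN endo_sum big1 ?oppr0 // => t _; rewrite endoZ.
  by have := step t e he; rewrite (negbTE kn) => ->; rewrite scaler0.
apply: (wle_lin (n := n) (P := wle (n - k.+1))) => //.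
- exact: wle0.
- by move=> c y z; exact: wleD.
move=> e he; rewrite endoN endo_sum -scaleN1r -[_ *: _]addr0.
apply: wleD (@wle0 _ _ _).
apply: big_ind => [|u v hu hv|t _]; first exact: wle0.
  by rewrite -[u]scale1r; apply: wleD.
rewrite endoZ -[_ *: _]addr0; apply: wleD (@wle0 _ _ _).
by have := step t e he; rewrite kn.
Qed.

Lemma exp_an_exp_cr eta zeta beta : binseq (ratr (form a eta zeta)) beta ->
  forall q p, exp_an eta q * exp_cr zeta p =
    lsum (fun r => beta r *: (exp_cr zeta (p - r) * exp_an eta (q - r))).
Proof.
move=> hb; apply: expseq_exchange (exp_an_exp eta) (exp_cr_exp zeta) hb _ => k l.
rewrite mulNr mulrN opprK addrC -[LHS]opprB an_mode_cr_mode -scaleNr.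
by case: eqP; rewrite ?oppr0 // mulrN.
Qed.

Lemma exchanges_form eta zeta :
  exchanges (exp_cr eta) (exp_an eta) (exp_cr zeta) (exp_an zeta) (ratr (form a eta zeta)).
Proof.
by move=> beta hb; split; [exact: exp_an_exp_cr|apply: exp_an_exp_cr; rewrite formC].
Qed.

(** * Fermionic modes *)

Definition ferm_mode (s : gen d) (l : int) : E :=
  match l with
  | Negz k => ferm_cre (s, k)
  | Posz k => \sum_t (ratr (form a (gen_degree s) (gen_degree t)) : C) *: ferm_ann (t, k)
  end.

Lemma ferm_mode_bosonic (s : gen d) (A : E) :
  (forall g, A * ferm_cre g = ferm_cre g * A) -> (forall g, A * ferm_ann g = ferm_ann g * A) ->
  forall l, ferm_mode s l * A = A * ferm_mode s l.
Proof.
by move=> Ac Ad [k|k] /=; rewrite ?Ac //; apply/esym/comm_lc => t.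
Qed.

Lemma ferm_mode_exp_cr s eta l p : ferm_mode s l * exp_cr eta p = exp_cr eta p * ferm_mode s l.
Proof.
apply: (expseq_comm (exp_cr_exp eta)) => k; apply: ferm_mode_bosonic => g; apply/esym/comm_lc => t.
  by rewrite bos_cre_ferm_cre.
by rewrite bos_cre_ferm_ann.
Qed.

Lemma ferm_mode_exp_an s eta l p : ferm_mode s l * exp_an eta p = exp_an eta p * ferm_mode s l.
Proof.
apply: (expseq_comm (exp_an_exp eta)) => k; rewrite mulrN mulNr; congr (- _).
apply: ferm_mode_bosonic => g; apply/esym/comm_lc => t; [by rewrite bos_ann_ferm_cre|by rewrite bos_ann_ferm_ann].
Qed.

Lemma anticomm_lc (A : E) (I : finType) (c k : I -> C) (F : I -> E) :
  (forall i, A * F i + F i * A = k i *: (1 : E)) ->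
  A * (\sum_i c i *: F i) + (\sum_i c i *: F i) * A = (\sum_i c i * k i) *: (1 : E).
Proof.
move=> h; rewrite mulr_sumr mulr_suml -big_split scaler_suml; apply: eq_bigr => i _ /=.
by rewrite endoZr endoZl -scalerDr h scalerA.
Qed.

(** s^ferm(z) t^ferm(w) has singular part (s . t) / (z - w). *)
Lemma ferm_mode_anticomm s t l k : ferm_mode s l * ferm_mode t k + ferm_mode t k * ferm_mode s l =
  (if k == - 1 - l then ratr (form a (gen_degree s) (gen_degree t)) else 0) *: (1 : E).
Proof.
have fcd (s' t' : gen d) (m n : nat) : ferm_cre (s', m) * ferm_mode t' n%:Z + ferm_mode t' n%:Z * ferm_cre (s', m)
    = (if m == n then ratr (form a (gen_degree s') (gen_degree t')) else 0) *: (1 : E).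
  rewrite /= (anticomm_lc _ (k := fun t => ((t, n) == (s', m))%:R)); last first.
    by move=> i; rewrite addrC ferm_ann_cre.
  apply: eq_scale; case: eqP => [->|mn].
    rewrite (bigD1 s' isT) /= eqxx mulr1 formC [X in _ + X]big1 ?addr0 => [|i si].
      by [].
    by rewrite xpair_eqE (negbTE si) mulr0.
  apply: big1 => i _; rewrite xpair_eqE [n == m]eq_sym (introF eqP mn) andbF mulr0.
  by [].
case: l => l; case: k => k.
- rewrite (_ : (k%:Z == -1 - l%:Z) = false); last by apply/negP => /eqP; lia.
  rewrite /= (anticomm_lc _ (k := fun=> 0)) => [|i].
    by rewrite big1 // => i _; rewrite mulr0.
  rewrite addrC scale0r (_ : _ + _ = (\sum_j (ratr (form a (gen_degree s) (gen_degree j)) * 0 : C)) *: (1 : E)).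
    by rewrite big1 ?scale0r // => j _; rewrite mulr0.
  by apply: anticomm_lc => j; rewrite ferm_annC scale0r.
- rewrite addrC fcd (_ : (Negz k == -1 - l%:Z) = (k == l)); last by apply/eqP/eqP; lia.
  by case: eqP => // _; rewrite formC.
- rewrite fcd (_ : (k%:Z == -1 - Negz l) = (l == k)) //; by apply/eqP/eqP; lia.
- rewrite (_ : (Negz k == -1 - Negz l) = false); last by apply/negP => /eqP; lia.
  by rewrite scale0r /= ferm_creC.
Qed.

(** A vector involves finitely many fermionic modes. *)
Lemma ferm_mode_ubound s : ubound (ferm_mode s).
Proof.
move=> x; have [M hM] := fset_bound (supp x) (fun e : stateC d =>
  (\sum_(g <- e.2) g.2)%N%:Z).
exists M => -[l|l] // hl; rewrite /= endo_sum big1 // => t _; rewrite endoZ.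
rewrite [x]freeMod_sum linear_sum big_seq big1 ?scaler0 // => e ex.
rewrite linearZ /=; case: e ex => [[m B] F] ex; rewrite ferm_annU.
case: (boolP ((t, l) \in F)) => tF; last by rewrite scaler0.
have := hM _ ex; rewrite /= (big_fsetD1 _ tF) /=; lia.
Qed.

End VertexData.

(** * Lattice degrees *)

(** The lattice translation without cocycle, and the projector onto a lattice
    degree.  Operator identities involving the degree are stated after composing
    with a projector, where s_(0) is a number. *)
HB.lock Definition shift (R : realType) (d : nat) (eta : degree d) : endo (fock_mod R d) :=
  slin (fun e => let: (l, B, F) := e in ket (eta + l, B, F)).
HB.lock Definition proj (R : realType) (d : nat) (l0 : degree d) : endo (fock_mod R d) :=
  slin (fun e => if e.1.1 == l0 then ket e else 0).

Section Sectors.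
Context (R : realType) (d : nat) (a : 'M[nat]_d).
Local Notation C := (CC R).
Local Notation V := (fock_mod R d).
Local Notation E := (endo V).
Local Notation bos_cre := (@bos_cre R d).
Local Notation bos_ann := (@bos_ann R d).
Local Notation ferm_cre := (@ferm_cre R d).
Local Notation ferm_ann := (@ferm_ann R d).
Local Notation shift := (@shift R d).
Local Notation proj := (@proj R d).
Implicit Types (eta zeta lam : degree d) (s t : gen d).

Lemma shiftU eta l B F : shift eta (ket (l, B, F)) = ket (eta + l, B, F).
Proof. by rewrite shift.unlock linU. Qed.
Lemma projU lam (e : stateC d) : proj lam (ket e) = if e.1.1 == lam then ket e else 0.
Proof. by rewrite proj.unlock linU. Qed.

(** The two commutations hold for all operators that act on oscillators only. *)
Definition osc (A : E) := (forall eta, shift eta * A = A * shift eta) /\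
  (forall lam, proj lam * A = A * proj lam).

Lemma shiftM eta zeta : shift eta * shift zeta = shift (eta + zeta).
Proof.
apply: (@lin_ext C (stateC d)) => -[[l B] F].
by rewrite endoM !shiftU addrA.
Qed.

Lemma shift0 : shift 0 = 1.
Proof.
apply: (@lin_ext C (stateC d)) => -[[l B] F].
by rewrite shiftU add0r endo1.
Qed.

Lemma proj_shift eta lam : proj (eta + lam) * shift eta = shift eta * proj lam.
Proof.
apply: (@lin_ext C (stateC d)) => -[[l B] F]; rewrite !endoM shiftU !projU /=.
rewrite (inj_eq (addrI eta)); case: (l == lam); first by rewrite shiftU.
by rewrite linear0.
Qed.

Lemma projK lam : proj lam * proj lam = proj lam.
Proof.
apply: (@lin_ext C (stateC d)) => e; rewrite !endoM projU.
case: eqP => [h|_]; last by rewrite linear0.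
by rewrite projU (introT eqP h).
Qed.

Lemma osc_bos_cre g : osc (bos_cre g).
Proof.
split=> x; apply: (@lin_ext C (stateC d)) => -[[l B] F]; rewrite !endoM.
  by rewrite bos_creU !shiftU bos_creU.
rewrite bos_creU !projU /=; case: (l == x); first by rewrite bos_creU.
by rewrite linear0.
Qed.

Lemma osc_bos_ann g : osc (bos_ann g).
Proof.
split=> x; apply: (@lin_ext C (stateC d)) => -[[l B] F]; rewrite !endoM bos_annU linearZ /=.
  by rewrite !shiftU bos_annU.
rewrite !projU /=; case: (l == x); first by rewrite bos_annU.
by rewrite (linear0 (bos_ann g)) scaler0.
Qed.

Lemma osc_ferm_cre g : osc (ferm_cre g).
Proof.
split=> x; apply: (@lin_ext C (stateC d)) => -[[l B] F]; rewrite !endoM ferm_creU.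
  rewrite shiftU ferm_creU; case: (g \in F); first by rewrite linear0.
  by rewrite linearZ /= shiftU.
rewrite projU /=; case: (l == x) (@projU x (l, B, (g |` F)%fset)) => hp.
  rewrite ferm_creU; case: (g \in F); first by rewrite linear0.
  by rewrite linearZ /= hp.
rewrite (linear0 (ferm_cre g)); case: (g \in F); first by rewrite linear0.
by rewrite linearZ /= hp scaler0.
Qed.

Lemma osc_ferm_ann g : osc (ferm_ann g).
Proof.
split=> x; apply: (@lin_ext C (stateC d)) => -[[l B] F]; rewrite !endoM ferm_annU.
  rewrite shiftU ferm_annU; case: (g \in F); last by rewrite linear0.
  by rewrite linearZ /= shiftU.
rewrite projU /=; case: (l == x) (@projU x (l, B, (F `\ g)%fset)) => hp.
  rewrite ferm_annU; case: (g \in F); last by rewrite linear0.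
  by rewrite linearZ /= hp.
rewrite (linear0 (ferm_ann g)); case: (g \in F); last by rewrite linear0.
by rewrite linearZ /= hp scaler0.
Qed.

Lemma osc_lc (I : finType) (c : I -> C) (F : I -> E) :
  (forall i, osc (F i)) -> osc (\sum_i c i *: F i).
Proof. by move=> h; split=> x; apply: comm_lc => i; have [h1 h2] := h i. Qed.

Lemma oscN (A : E) : osc A -> osc (- A).
Proof. by case=> h1 h2; split=> x; rewrite mulrN mulNr ?h1 ?h2. Qed.

Lemma osc_exp b S : expseq b S -> (forall k, osc (b k)) -> forall p, osc (S p).
Proof. by move=> eS h p; split=> x; apply: (expseq_comm eS) => k; have [h1 h2] := h k. Qed.

Lemma osc_exp_cr eta p : osc (exp_cr R eta p).
Proof. by apply: (osc_exp (exp_cr_exp R eta)) => k; apply: osc_lc => t; exact: osc_bos_cre. Qed.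

Lemma osc_exp_an eta p : osc (exp_an R a eta p).
Proof. by apply: (osc_exp (exp_an_exp R a eta)) => k; apply/oscN/osc_lc => t; exact: osc_bos_ann. Qed.

Lemma osc_ferm_mode s l : osc (ferm_mode R a s l).
Proof.
case: l => l /=; last exact: osc_ferm_cre.
by apply: osc_lc => t; exact: osc_ferm_ann.
Qed.

Lemma osc_lsum (I : choiceType) (F : I -> E) : lfin F -> (forall i, osc (F i)) -> osc (lsum F).
Proof.
move=> fF h; split=> x; rewrite lsumMl // lsumMr //; apply: eq_lsum => i;
by have [h1 h2] := h i.
Qed.

Lemma oscM (A B : E) : osc A -> osc B -> osc (A * B).
Proof.
by case=> a1 a2 [b1 b2]; split=> x; rewrite mulrA ?a1 ?a2 -mulrA ?b1 ?b2 mulrA.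
Qed.

(** The vertex operators of eta stripped of the cocycle, of the translation and
    of the power z^(eta_(0)); the latter becomes a shift of the index. *)
Definition bos_vertex eta : int -> E := nexp (exp_cr R eta) (exp_an R a eta).
Definition ferm_vertex s eta : int -> E := fnexp (ferm_mode R a s) (exp_cr R eta) (exp_an R a eta).

Lemma osc_bos_vertex eta p : osc (bos_vertex eta p).
Proof.
apply: osc_lsum => [|q]; first by apply: nexp_lfin; exact: exp_an_lfin.
by apply: oscM; [exact: osc_exp_cr|exact: osc_exp_an].
Qed.

Lemma ferm_vertex_lfin s eta p : lfin (fun l => ferm_mode R a s l * bos_vertex eta (l - p)).
Proof.
apply: fnexp_lfin.
- exact: ferm_mode_ubound.
- exact: exp_an_lfin.
- exact: exp_cr_neg.
- exact: ferm_mode_exp_cr.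
- exact: ferm_mode_exp_an.
Qed.

Lemma osc_ferm_vertex s eta p : osc (ferm_vertex s eta p).
Proof.
apply: osc_lsum => [|q]; first exact: ferm_vertex_lfin.
by apply: oscM; [exact: osc_ferm_mode|exact: osc_bos_vertex].
Qed.

Lemma ferm_vertex_anticomm s t eta zeta (c : nat) p q : form a eta zeta = c%:R ->
  ferm_vertex s eta (p + c%:Z) * ferm_vertex t zeta q + (-1) ^+ c *: (ferm_vertex t zeta (q + c%:Z) * ferm_vertex s eta p)
  = (ratr (form a (gen_degree s) (gen_degree t)) * (c == 0%N)%:R) *:
    bos_vertex (eta + zeta) (- 1 - p - q - c%:Z).
Proof.
move=> hc; rewrite /bos_vertex -exp_crD -exp_anD.
have he : exchanges (exp_cr R eta) (exp_an R a eta) (exp_cr R zeta) (exp_an R a zeta) c%:R.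
  by rewrite -(ratr_nat C c) -hc; exact: exchanges_form.
exact: (fnexp_anticomm (@ferm_mode_ubound R d a s) (@ferm_mode_ubound R d a t) (@exp_cr_neg R d eta) (@exp_cr_neg R d zeta)
  (@exp_an_neg R d a eta) (@exp_an_neg R d a zeta) (@exp_an_lfin R d a eta) (@exp_an_lfin R d a zeta)
  (exp_crC R eta zeta) (exp_anC R a eta zeta) (ferm_mode_exp_cr R a s eta) (ferm_mode_exp_an R a s eta)
  (ferm_mode_exp_cr R a s zeta) (ferm_mode_exp_an R a s zeta) (ferm_mode_exp_cr R a t eta) (ferm_mode_exp_an R a t eta)
  (ferm_mode_exp_cr R a t zeta) (ferm_mode_exp_an R a t zeta) he (ferm_mode_anticomm R a s t) p q).
Qed.

(** The modes of an isotropic fermion anticommute, as [fnexp_anticomm_pole]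
    requires. *)
Lemma ferm_vertex_pole s eta zeta p q : form a eta zeta = - 1 ->
  form a (gen_degree s) (gen_degree s) = 0 ->
  ferm_vertex s eta (p - 1) * ferm_vertex s zeta q - ferm_vertex s zeta (q - 1) * ferm_vertex s eta p = 0.
Proof.
move=> hc hs.
have he : exchanges (exp_cr R eta) (exp_an R a eta) (exp_cr R zeta) (exp_an R a zeta) (- 1).
  rewrite (_ : -1 = ratr (form a eta zeta)); first exact: exchanges_form.
  by rewrite hc rmorphN rmorph1.
have h0 l k : ferm_mode R a s l * ferm_mode R a s k + ferm_mode R a s k * ferm_mode R a s l = 0.
  by rewrite ferm_mode_anticomm hs rmorph0; case: eqP => _; rewrite scale0r.
exact: (fnexp_anticomm_pole (@ferm_mode_ubound R d a s) (@ferm_mode_ubound R d a s) (@exp_cr_neg R d eta) (@exp_cr_neg R d zeta)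
  (@exp_an_neg R d a eta) (@exp_an_neg R d a zeta) (@exp_an_lfin R d a eta) (@exp_an_lfin R d a zeta)
  (exp_crC R eta zeta) (exp_anC R a eta zeta) (ferm_mode_exp_cr R a s eta) (ferm_mode_exp_an R a s eta)
  (ferm_mode_exp_cr R a s zeta) (ferm_mode_exp_an R a s zeta) (ferm_mode_exp_cr R a s eta) (ferm_mode_exp_an R a s eta)
  (ferm_mode_exp_cr R a s zeta) (ferm_mode_exp_an R a s zeta) he (fun l => erefl _) h0 p q).
Qed.

Lemma exp_cr0 p : exp_cr R (0 : degree d) p = (p == 0)%:R *: (1 : E).
Proof.
have cr0 k : cr_mode R (0 : degree d) k = 0.
  rewrite /cr_mode big1 // => t _; rewrite (_ : gcoord 0 t = 0) ?rmorph0 ?scale0r //.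
  by case: t => i; rewrite /= mxE.
have eS := exp_cr_exp R (0 : degree d).
have [pn|pp|->] := ltgtP p 0; first by rewrite exp_cr_neg // scale0r.
  have pN : p <= `|p|%N%:Z by lia.
  apply: (scaleI_pos pp); rewrite (expseq_rec eS pN) scale0r scaler0.
  by rewrite big1 // => k _; rewrite cr0 mul0r.
by rewrite (expseq0 eS) scale1r.
Qed.

Lemma exp_an0 p : exp_an R a (0 : degree d) p = (p == 0)%:R *: (1 : E).
Proof.
have an0 k : an_mode R a (0 : degree d) k = 0.
  rewrite /an_mode big1 // => t _; rewrite /form /= pairing0l pairing0r addr0.
  by rewrite rmorph0 mulr0 scale0r.
have eS := exp_an_exp R a (0 : degree d).
have [pn|pp|->] := ltgtP p 0; first by rewrite exp_an_neg // scale0r.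
  have pN : p <= `|p|%N%:Z by lia.
  apply: (scaleI_pos pp); rewrite (expseq_rec eS pN) scale0r scaler0.
  by rewrite big1 // => k _; rewrite an0 oppr0 mul0r.
by rewrite (expseq0 eS) scale1r.
Qed.

Lemma bos_vertex0 : bos_vertex 0 0 = 1.
Proof.
rewrite /bos_vertex /nexp (@lsum1 _ _ _ _ 0) => [|q q0].
  by rewrite exp_cr0 exp_an0 /= !scale1r mulr1.
by rewrite exp_an0 (negbTE q0) scale0r mulr0.
Qed.

End Sectors.

(** * The operators of the definitions in terms of lattice sectors *)

Section Link.
Context (R : realType) (d : nat) (a : 'M[nat]_d).
Local Notation C := (CC R).
Local Notation V := (fock_mod R d).
Local Notation E := (endo V).
Implicit Types (s t : gen d).

Transparent freeMod.
Lemma linextE (phi : state d -> space R d) (x : V) : linext phi x = @lin C (stateC d) phi x.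
Proof. by []. Qed.

Lemma ketE (e : state d) : (<< e >> : space R d) = ket e.
Proof. by rewrite basis_vec.unlock. Qed.

Lemma bos_createE (g : mode d) (x : V) : bos_create g x = bos_cre R g x.
Proof. by rewrite bos_cre.unlock basis_vec.unlock. Qed.
Lemma bos_deriveE (g : mode d) (x : V) : bos_derive g x = bos_ann R g x.
Proof. by rewrite bos_ann.unlock basis_vec.unlock. Qed.
Lemma ferm_createE (g : mode d) (x : V) : ferm_create g x = ferm_cre R g x.
Proof. by rewrite ferm_cre.unlock basis_vec.unlock. Qed.
Lemma ferm_deriveE (g : mode d) (x : V) : ferm_derive g x = ferm_ann R g x.
Proof. by rewrite ferm_ann.unlock basis_vec.unlock. Qed.

Lemma fermE s l (x : V) : ferm a s l x = ferm_mode R a s l x.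
Proof.
case: l => k /=; last exact: ferm_createE.
rewrite endo_sum; apply: eq_bigr => t _; rewrite ferm_deriveE. by [].
Qed.

Lemma pow_coefE (b : nat -> V -> V) (B : nat -> E) :
  (forall k x, (0 < k)%N -> b k x = B k x) ->
  forall n p x, pow_coef (b : nat -> space R d -> space R d) n p x = powE B n p x.
Proof.
move=> hb; elim=> [|n IH] p x /=; first by case: (p == 0%N).
rewrite endo_sum; apply: eq_big_nat => k /andP[k0 _]; rewrite endoM -IH; exact: hb.
Qed.

Lemma exp_coefE (b : nat -> V -> V) (B : nat -> E) :
  (forall k x, (0 < k)%N -> b k x = B k x) ->
  forall p x, exp_coef (b : nat -> space R d -> space R d) p x = expE B p x.
Proof.
move=> hb p x; rewrite /exp_coef /expE endo_sum; apply: eq_bigr => n _.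
rewrite endoZ; congr (_ *: _); exact: pow_coefE.
Qed.

Lemma gcoord_gen s t : gcoord (gen_degree s) t = (s == t)%:R.
Proof.
case: s => i; case: t => j; rewrite /= !mxE ?eqxx //.
  by rewrite [inl i == inl j](_ : _ = (i == j)) // eq_sym.
by rewrite [inr i == inr j](_ : _ = (i == j)) // eq_sym.
Qed.

Lemma cr_mode_gen s k : cr_mode R (gen_degree s) k = bos_cre R (s, k).
Proof.
rewrite /cr_mode (bigD1 s isT) /= gcoord_gen eqxx rmorph1 scale1r.
rewrite [X in _ + X]big1 => [|t ts]; first by rewrite addr0.
by rewrite gcoord_gen eq_sym (negbTE ts) rmorph0 scale0r.
Qed.

Lemma exp_minusE s p (x : V) : exp_minus a s p x = exp_cr R (gen_degree s) p x.
Proof.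
pose b k (y : V) : V := (k%:R : C)^-1 *: (bos a s (- k%:Z) y : V).
pose B k : E := (k%:R)^-1 *: cr_mode R (gen_degree s) k.-1.
have hb k y : (0 < k)%N -> b k y = B k y.
  case: k => [h|k _]; first by exfalso; move: h; rewrite ltnn.
  rewrite /b /B endoZ cr_mode_gen.
  apply: (congr1 (fun z : V => (k.+1%:R : C)^-1 *: z)); exact: bos_createE.
exact: (exp_coefE hb p x).
Qed.

Lemma exp_plusE s p (x : V) : exp_plus a s p x = exp_an R a (gen_degree s) p x.
Proof.
pose b k (y : V) : V := - (k%:R : C)^-1 *: (bos a s k%:Z y : V).
pose B k : E := - (k%:R)^-1 *: an_mode R a (gen_degree s) k.-1.
have hb k y : (0 < k)%N -> b k y = B k y.
  case: k => [h|k _]; first by exfalso; move: h; rewrite ltnn.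
  rewrite /b /B endoZ.
  apply: (congr1 (fun z : V => - (k.+1%:R : C)^-1 *: z)).
  rewrite /an_mode endo_sum; apply: eq_bigr => t _.
  by rewrite endoZ -bos_deriveE.
exact: (exp_coefE hb p x).
Qed.

Definition coc eta lam : C := cocycle R a eta lam.

Definition translate_op s : E := slin (fun e => let: (l, B, F) := e in
    coc (gen_degree s) l *: ket (gen_degree s + l, B, F)).

Lemma translateE s (x : V) : translate a s x = translate_op s x.
Proof. by rewrite /translate_op basis_vec.unlock. Qed.

Lemma translate_op_proj s lam : translate_op s * proj R lam = coc (gen_degree s) lam *: (shift R (gen_degree s) * proj R lam).
Proof.
apply: (@lin_ext C (stateC d)) => -[[l B] F]; rewrite endoZ !endoM projU [_.1.1]/=.
case: (eqVneq l lam) => [->|_].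
  by rewrite shiftU; exact: linU.
by rewrite (linear0 (translate_op s)) (linear0 (shift R (gen_degree s))) scaler0.
Qed.

Lemma fsum_spaceE (I : choiceType) (A : set I) (F : I -> V) :
  (\sum_(i \in A) (F i : space R d)) = (\sum_(i \in A) (F i : V)).
Proof. by []. Qed.

(** Both sums run over S_p T_q with p - q fixed by the power of z.  The one on
    the left takes p, q natural, the one on the right takes q any integer, with
    S and T vanishing in negative degrees. *)
Lemma vertex_coef_int s l (e : stateC d) (h : int) : form a (gen_degree s) e.1.1 = h%:~R ->
  vertex_coef a s l (ket e) = coc (gen_degree s) e.1.1 *: shift R (gen_degree s) (bos_vertex R a (gen_degree s) (l - h) (ket e)).
Proof.
move=> hh; set eta := gen_degree s; set lam := e.1.1.
pose G (q : int) : V := coc eta lam *: shift R eta (exp_cr R eta (l - h + q) (exp_an R a eta q (ket e))).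
have fT : lfin (fun q => coc eta lam *: (shift R eta * (exp_cr R eta (l - h + q) * exp_an R a eta q))).
  by apply/lfinZc/lfinMl/lfinMl/exp_an_lfin.
have -> : coc eta lam *: shift R eta (bos_vertex R a eta (l - h) (ket e)) =
    \sum_(q \in [set: int]%classic) G q.
  rewrite -(lsumT _ fT) /bos_vertex /nexp lsumZ; last by apply/lfinMl/lfinMl/exp_an_lfin.
  by rewrite -lsumMl //; exact: nexp_lfin (exp_an_lfin _ _).
have ek : ket e = proj R lam (ket e) by rewrite projU /= eqxx.
have term (p q : nat) : translate a s (exp_minus a s p (exp_plus a s q (ket e))) =
    coc eta lam *: shift R eta (exp_cr R eta p (exp_an R a eta q (ket e))).
  rewrite translateE exp_minusE exp_plusE.
  have hX : proj R lam (exp_cr R eta p (exp_an R a eta q (ket e))) = exp_cr R eta p (exp_an R a eta q (ket e)).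
    rewrite {2}ek -!endoM; congr (_ _).
    by rewrite -!mulrA -(proj2 (osc_exp_an R a eta q)) !mulrA (proj2 (osc_exp_cr R eta p)).
  by rewrite -{1}hX -[LHS]endoM translate_op_proj endoZ endoM hX.
rewrite /vertex_coef linextE linU ketE.
pose A := [set pq : nat * nat | form a eta e.1.1 + pq.1%:R - pq.2%:R = l%:~R]%classic.
transitivity (\sum_(pq \in A) coc eta lam *: shift R eta (exp_cr R eta pq.1 (exp_an R a eta pq.2 (ket e)))).
  pose H (pq : nat * nat) : V := translate a s (exp_minus a s pq.1 (exp_plus a s pq.2 (ket e))).
  refine (etrans (fsum_spaceE A H) _).
  by apply: eq_fsbigr => pq _; rewrite /H term.
pose B := [set q : int | 0 <= q /\ 0 <= l - h + q]%classic.
rewrite -(fsbig_widen B) => [|q _ //|q [_ qB]]; last first.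
  rewrite /= /G; have [q0|q0] := ltP q 0.
    by rewrite (exp_an_neg _ _ _ q0) endo0 !linear0.
  have q1 : l - h + q < 0 by rewrite ltNge; apply/negP => h0; exact: qB.
  by rewrite (exp_cr_neg _ _ q1) endo0 !linear0.
rewrite (reindex_fsbig (fun q : int => (`|(l - h + q)%R|%N, `|q|%N)) B A).
  apply: eq_fsbigr => q /set_mem[q0 q1]; rewrite /G.
  have e0 : `|q|%N%:Z = q by rewrite gez0_abs.
  have e1 : `|(l - h + q)%R|%N%:Z = l - h + q by rewrite gez0_abs.
  by rewrite [(_, _).1]/= [(_, _).2]/= e0 e1.
split.
- move=> q [q0 q1]; rewrite /A /= -/lam hh !natr_absz !ger0_norm // -!intrD -rmorphB /=.
  by congr (_%:~R); lia.
- by move=> q q' /set_mem[q0 q1] /set_mem[q0' q1'] [_]; lia.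
move=> [p q]; rewrite /A /= hh => /eqP; rewrite !pmulrn -intrD -intrB eqr_int => /eqP hl.
exists q%:Z; first by split; lia.
by congr (_, _); lia.
Qed.

Lemma vertex_coef_nonint s l (e : stateC d) :
  (forall h : int, form a (gen_degree s) e.1.1 <> h%:~R) ->
  vertex_coef a s l (ket e) = (0 : V).
Proof.
move=> hn; rewrite /vertex_coef linextE linU ketE.
rewrite (_ : [set pq | _]%classic = set0) ?fsbig_set0 //.
apply/seteqP; split => // -[p q] /= hpq; apply: (hn (l - p%:Z + q%:Z)).
by rewrite intrD intrB -hpq -!pmulrn; lra.
Qed.

Definition vertex_coef_op s l : E := slin (fun e => (\sum_(pq \in [set pq : nat * nat |
        form a (gen_degree s) e.1.1 + pq.1%:R - pq.2%:R = l%:~R]%classic)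
      translate a s (exp_minus a s pq.1 (exp_plus a s pq.2 (<< e >> : space R d))) : space R d)).

Lemma vertexE s l (x : V) : vertex_coef a s l x = vertex_coef_op s l x.
Proof. exact: linextE. Qed.

Lemma vertex_coef_op_ket s l e : vertex_coef_op s l (ket e) = vertex_coef a s l (ket e).
Proof. by rewrite vertexE. Qed.

Lemma lfin_ket (I : choiceType) (F : I -> E) :
  (forall e, exists X : {fset I}, forall i, i \notin X -> F i (ket e) = 0) -> lfin F.
Proof.
move=> h x.
pose f e := projT1 (cid (h e)).
exists (\bigcup_(e <- supp x) f e)%fset => i iX.
rewrite [x]freeMod_sum linear_sum big_seq big1 // => e ex.
rewrite linearZ /= (projT2 (cid (h e))) ?scaler0 //.
by apply: contra iX => iX; apply/bigfcupP; exists e; rewrite ?ex.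
Qed.

Lemma ferm_mode_vertex_coef_op_int s l (e : stateC d) (h : int) : form a (gen_degree s) e.1.1 = h%:~R ->
  (ferm_mode R a s l * vertex_coef_op s l) (ket e) = coc (gen_degree s) e.1.1 *:
     shift R (gen_degree s) ((ferm_mode R a s l * bos_vertex R a (gen_degree s) (l - h)) (ket e)).
Proof.
move=> hh; rewrite endoM vertex_coef_op_ket (vertex_coef_int _ hh) linearZ.
by rewrite -!endoM mulrA (proj1 (osc_ferm_mode R a s l)).
Qed.

Lemma ferm_mode_vertex_coef_op_lfin s : lfin (fun l => ferm_mode R a s l * vertex_coef_op s l).
Proof.
apply: lfin_ket => e.
have [[h hh]|hn] := pselect (exists h : int, form a (gen_degree s) e.1.1 = h%:~R).
  have [X hX] := @ferm_vertex_lfin R d a s (gen_degree s) h (ket e).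
  exists X => l /hX hl; rewrite (ferm_mode_vertex_coef_op_int _ hh) hl.
  by rewrite (linear0 (shift R _)) scaler0.
exists fset0 => l _; rewrite endoM vertex_coef_op_ket vertex_coef_nonint ?linear0 //.
by move=> h hh; apply: hn; exists h.
Qed.

Definition residue_op s : E := lsum (fun l => ferm_mode R a s l * vertex_coef_op s l).

Lemma residueE s (x : V) : residue a s x = residue_op s x.
Proof.
rewrite /residue_op (lsumT x (ferm_mode_vertex_coef_op_lfin s)).
refine (etrans (fsum_spaceE _ (fun l => ferm a s l (vertex_coef a s l x))) _).
by apply: eq_fsbigr => l _; rewrite fermE vertexE endoM.
Qed.

(** On one sector the factor z^(s_(0)) is the integer power z^h. *)
Lemma residue_op_proj s lam (h : int) : form a (gen_degree s) lam = h%:~R ->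
  residue_op s * proj R lam = coc (gen_degree s) lam *:
    (shift R (gen_degree s) * ferm_vertex R a s (gen_degree s) h * proj R lam).
Proof.
move=> hh; apply: (@lin_ext C (stateC d)) => e; rewrite endoZ !endoM projU.
case: (eqVneq e.1.1 lam) => [he|_]; last first.
  by rewrite (linear0 (residue_op s)) (linear0 (ferm_vertex _ _ _ _ _)) (linear0 (shift R _)) scaler0.
rewrite -he in hh *.
have [X hX] := @ferm_vertex_lfin R d a s (gen_degree s) h (ket e).
rewrite (lsumE (@ferm_vertex_lfin R d a s (gen_degree s) h) hX).
rewrite (lsumE (X := X) (ferm_mode_vertex_coef_op_lfin s)) => [|l /hX hl]; last first.
  by rewrite (ferm_mode_vertex_coef_op_int _ hh) hl (linear0 (shift R _)) scaler0.
rewrite linear_sum scaler_sumr; apply: eq_bigr => l _.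
exact: ferm_mode_vertex_coef_op_int.
Qed.

Definition diff_op (f g : 'I_d -> C) : E :=
  \sum_i f i *: residue_op (inl i) + \sum_j g j *: residue_op (inr j).

Lemma diff_op_apply (f g : 'I_d -> C) (x : V) :
  diff_op f g x = \sum_i f i *: residue_op (inl i) x + \sum_j g j *: residue_op (inr j) x.
Proof.
refine (congr2 (fun y z : V => y + z) _ _).
  exact: (endo_sum _ _ (fun i => f i *: residue_op (inl i)) x).
exact: (endo_sum _ _ (fun i => g i *: residue_op (inr i)) x).
Qed.

Lemma DfgE (f g : 'I_d -> R[i]) (x : V) : Dfg a f g x = diff_op f g x.
Proof.
refine (etrans _ (esym (diff_op_apply f g x))).
refine (congr2 (fun y z : V => y + z) _ _).
  refine (eq_bigr (fun i => f i *: residue_op (inl i) x : V) _) => i _.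
  exact: (congr1 (fun z : V => (f i : C) *: z) (residueE _ _)).
refine (eq_bigr (fun i => g i *: residue_op (inr i) x : V) _) => i _.
exact: (congr1 (fun z : V => (g i : C) *: z) (residueE _ _)).
Qed.

End Link.

#[global] Opaque freeMod.

(** * Anticommutators of vertex operators *)

(** The residue of z^(-m) s^ferm(z) e^{int eta}(z), for an arbitrary degree eta;
    only its values on sectors where eta_(0) is an integer h matter, and there
    the floor reads h. *)
HB.lock Definition vertex_residue (R : realType) (d : nat) (a : 'M[nat]_d) (s : gen d)
    (eta : degree d) (m : int) : endo (fock_mod R d) :=
  slin (fun e => coc R a eta e.1.1 *:
    shift R eta (ferm_vertex R a s eta (Num.floor (form a eta e.1.1) - m) (ket e))).

(** The constant coefficient of e^{int eta}(z), with the same use of the floor. *)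
HB.lock Definition vertex_const (R : realType) (d : nat) (a : 'M[nat]_d)
    (eta : degree d) : endo (fock_mod R d) :=
  slin (fun e => coc R a eta e.1.1 *:
    shift R eta (bos_vertex R a eta (- Num.floor (form a eta e.1.1)) (ket e))).

(** Composition of two operators that on each sector are a translation S times
    an oscillator operator X: the translations and oscillators separate. *)
Lemma sector_comp (C : numFieldType) (V : lmodType C) (A B X Y P P' S1 S2 : endo V) (c1 c2 : C) :
  A * P' = c1 *: (S1 * X * P') -> B * P = c2 *: (S2 * Y * P) ->
  P * Y = Y * P -> P' * S2 = S2 * P -> S2 * X = X * S2 -> P * P = P ->
  A * B * P = (c2 * c1) *: (S1 * S2 * (X * Y) * P).
Proof.
move=> hA hB PY P'S SX PP.
rewrite -mulrA hB endoZr -scalerA; congr (_ *: _).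
have e Z : Z * (S2 * Y * P) = Z * P' * (S2 * Y * P).
  by rewrite -[in LHS]PP -!mulrA; congr (_ * _); rewrite !mulrA P'S -!mulrA [P * (Y * _)]mulrA PY -!mulrA.
rewrite e hA !endoZl; congr (_ *: _).
by rewrite -e !mulrA -[S1 * X * S2]mulrA -SX !mulrA.
Qed.

Lemma sector_combine (C : numFieldType) (V : lmodType C) (X1 X2 N P S : endo V) (u e kappa : C) :
  X1 + e *: X2 = kappa *: N ->
  u *: (S * X1 * P) + (e * u) *: (S * X2 * P) = (u * kappa) *: (S * N * P).
Proof.
move=> h; rewrite [e * u]mulrC -!scalerA -scalerDr; congr (_ *: _).
by rewrite -endoZl -endoZr -mulrDl -mulrDr h endoZr endoZl.
Qed.

Section Brackets.
Context (R : realType) (d : nat) (a : 'M[nat]_d).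
Local Notation C := (CC R).
Local Notation V := (fock_mod R d).
Local Notation E := (endo V).
Local Notation proj := (@proj R d).
Local Notation shift := (@shift R d).
Local Notation ferm_vertex := (@ferm_vertex R d a).
Local Notation bos_vertex := (@bos_vertex R d a).
Local Notation coc := (@coc R d a).
Implicit Types (s t : gen d) (eta zeta lam : degree d) (h k m : int) (A B : E).

(** A common form for the summands of the differential, where m = 0, and for the
    operators psi_j, where m = 1. *)
Definition is_vertex A s eta m := forall lam h, form a eta lam = h%:~R ->
  A * proj lam = coc eta lam *: (shift eta * ferm_vertex s eta (h - m) * proj lam).

Lemma is_vertex_residue_op s : is_vertex (residue_op R a s) s (gen_degree s) 0.
Proof. by move=> lam h hh; rewrite subr0; exact: residue_op_proj. Qed.

Lemma proj_ext A B lam : (forall e : stateC d, e.1.1 = lam -> A (ket e) = B (ket e)) ->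
  A * proj lam = B * proj lam.
Proof.
move=> hAB; apply: (@lin_ext C (stateC d)) => e; rewrite !endoM projU.
case: (eqVneq e.1.1 lam) => [/hAB //|_].
by rewrite (linear0 A) (linear0 B).
Qed.

Lemma is_vertex_vertex_residue s eta m : is_vertex (vertex_residue R a s eta m) s eta m.
Proof.
move=> lam h hh; rewrite -endoZl; apply: proj_ext => e he.
by rewrite endoZ endoM vertex_residue.unlock linU he hh intrKfloor.
Qed.

Lemma vertex_const_proj eta lam h : form a eta lam = h%:~R ->
  vertex_const R a eta * proj lam = coc eta lam *: (shift eta * bos_vertex eta (- h) * proj lam).
Proof.
move=> hh; rewrite -endoZl; apply: proj_ext => e he.
by rewrite endoZ endoM vertex_const.unlock linU he hh intrKfloor.
Qed.

Lemma is_vertex_comp A B s t eta zeta m n lam h k c :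
  is_vertex A s eta m -> is_vertex B t zeta n ->
  form a eta lam = h%:~R -> form a zeta lam = k%:~R -> form a eta zeta = c%:~R ->
  A * B * proj lam = (coc zeta lam * coc eta (zeta + lam)) *:
    (shift (eta + zeta) * (ferm_vertex s eta (h + c - m) * ferm_vertex t zeta (k - n)) * proj lam).
Proof.
move=> hA hB hh hk hc.
have e : form a eta (zeta + lam) = (h + c)%:~R.
  by rewrite formC formDl !(formC a _ eta) hc hh -intrD addrC.
rewrite -shiftM; apply: (sector_comp (hA _ _ e) (hB _ _ hk)).
- exact: (proj2 (osc_ferm_vertex R a t zeta _)).
- exact: proj_shift.
- exact: (proj1 (osc_ferm_vertex R a s eta _)).
- exact: projK.
Qed.

Definition pairing_int eta lam := pairing a eta.1 lam.2 \is a Num.int.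

Lemma signD (x y : rat) : x \is a Num.int -> y \is a Num.int ->
  ((-1 : C) ^ Num.floor (x + y) = (-1) ^ Num.floor x * (-1) ^ Num.floor y).
Proof.
move=> hx hy; rewrite floorDzr // expfzDr // oppr_eq0 oner_eq0 //.
Qed.

Lemma cocDr eta zeta lam : pairing_int eta zeta -> pairing_int eta lam ->
  coc eta (zeta + lam) = coc eta zeta * coc eta lam.
Proof. by move=> h1 h2; rewrite /coc /cocycle /= pairingDr; exact: signD. Qed.

Lemma cocDl eta zeta lam : pairing_int eta lam -> pairing_int zeta lam ->
  coc (eta + zeta) lam = coc eta lam * coc zeta lam.
Proof. by move=> h1 h2; rewrite /coc /cocycle /= pairingDl; exact: signD. Qed.

Lemma coc2 eta zeta : coc eta zeta * coc eta zeta = 1.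
Proof.
rewrite /coc /cocycle -exprzMl ?mulrNN ?mulr1 ?exp1rz //; exact: unitrN1.
Qed.

(** The cocycle turns (-1)^c into commutation. *)
Lemma coc_swap eta zeta lam c : pairing_int eta zeta -> pairing_int zeta eta -> pairing_int eta lam ->
  pairing_int zeta lam -> form a eta zeta = c%:~R ->
  coc eta lam * coc zeta (eta + lam) = (-1) ^ c * (coc zeta lam * coc eta (zeta + lam)).
Proof.
move=> h1 h2 h3 h4 hc; rewrite !cocDr //.
have -> : (-1 : C) ^ c = coc eta zeta * coc zeta eta.
  have -> : c = Num.floor (form a eta zeta) by rewrite hc intrKfloor.
  by rewrite /coc /cocycle -signD.
have := coc2 eta zeta; set x := coc eta zeta; set y := coc zeta eta => hx.
set u := coc eta lam; set v := coc zeta lam.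
have -> : x * y * (v * (x * u)) = (x * x) * (u * (y * v)) by ring.
by rewrite hx mul1r.
Qed.

Definition degs_int eta zeta lam :=
  [/\ pairing_int eta zeta, pairing_int zeta eta, pairing_int eta lam & pairing_int zeta lam].

(** The sign (-1)^c of [ferm_vertex_anticomm] is absorbed by the cocycle, and only
    the contraction of the fermions remains. *)
Lemma vertex_anticomm A B s t eta zeta m n lam h k (c : nat) :
  is_vertex A s eta m -> is_vertex B t zeta n -> degs_int eta zeta lam ->
  form a eta lam = h%:~R -> form a zeta lam = k%:~R -> form a eta zeta = c%:R ->
  (A * B + B * A) * proj lam =
   ((coc zeta lam * coc eta (zeta + lam)) *
    (ratr (form a (gen_degree s) (gen_degree t)) * (c == 0%N)%:R)) *:
    (shift (eta + zeta) * bos_vertex (eta + zeta) (m + n - 1 - h - k - c%:Z) * proj lam).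
Proof.
move=> hA hB [i1 i2 i3 i4] hh hk hc.
have hc' : form a eta zeta = (c%:Z)%:~R by rewrite hc pmulrn.
have hc'' : form a zeta eta = (c%:Z)%:~R by rewrite formC.
rewrite mulrDl (is_vertex_comp hA hB hh hk hc') (is_vertex_comp hB hA hk hh hc'').
rewrite (coc_swap i1 i2 i3 i4 hc') [zeta + eta]addrC.
have := ferm_vertex_anticomm R s t (h - m) (k - n) hc.
have -> : h - m + c%:Z = h + c%:Z - m by ring.
have -> : k - n + c%:Z = k + c%:Z - n by ring.
have -> : - 1 - (h - m) - (k - n) - c%:Z = m + n - 1 - h - k - c%:Z by ring.
exact: sector_combine.
Qed.

(** For c = -1 as well the cocycle provides the sign that turns the commutator of
    [ferm_vertex_pole] into an anticommutator. *)
Lemma vertex_anticomm_pole A B s eta zeta m n lam h k :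
  is_vertex A s eta m -> is_vertex B s zeta n -> degs_int eta zeta lam ->
  form a eta lam = h%:~R -> form a zeta lam = k%:~R -> form a eta zeta = - 1 ->
  form a (gen_degree s) (gen_degree s) = 0 ->
  (A * B + B * A) * proj lam = 0.
Proof.
move=> hA hB [i1 i2 i3 i4] hh hk hc hs.
have hc' : form a eta zeta = (- 1)%:~R by rewrite hc.
have hc'' : form a zeta eta = (- 1)%:~R by rewrite formC.
rewrite mulrDl (is_vertex_comp hA hB hh hk hc') (is_vertex_comp hB hA hk hh hc'').
rewrite (coc_swap i1 i2 i3 i4 hc') [zeta + eta]addrC.
have := ferm_vertex_pole R (h - m) (k - n) hc hs.
have -> : h - m - 1 = h + - 1 - m by ring.
have -> : k - n - 1 = k + - 1 - n by ring.
rewrite -[X in _ - X]scale1r -scaleNr -(scale0r (0 : E)) => e.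
have -> : (-1 : C) ^ (- 1) = - 1 by rewrite exprN1 invrN1.
by rewrite (sector_combine _ _ _ e) !mulr0 !scale0r.
Qed.

(** * The differential *)

Definition coef_fg (f g : 'I_d -> C) s : C :=
  match s with inl i => f i | inr j => g j end.

Lemma diff_op_gens (f g : 'I_d -> C) : diff_op a f g = \sum_s coef_fg f g s *: residue_op R a s.
Proof. by rewrite big_sumType. Qed.

Lemma form_gen_gen s t : exists2 c : nat, form a (gen_degree s) (gen_degree t) = c%:R &
  pairing_int (gen_degree s) (gen_degree t).
Proof.
have p i j : pairing a (delta_mx 0 i) (delta_mx 0 j) = (a i j)%:R.
  rewrite /pairing -rowE trmx_delta -colE !mxE //.
rewrite /pairing_int /form; case: s => i; case: t => j /=.
- by exists 0%N; rewrite ?pairing0r ?addr0 ?pairing0r ?int_num0.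
- by exists (a i j); rewrite ?p ?pairing0l ?addr0 // natr_int.
- by exists (a j i); rewrite ?p ?pairing0l ?add0r // ?pairing0l int_num0.
- by exists 0%N; rewrite ?pairing0l ?addr0 // int_num0.
Qed.

(** Sectors in which all vertex operators of generators have integral powers. *)
Definition integral_sector lam := forall s, form a (gen_degree s) lam \is a Num.int.

Lemma integral_sector_pairing_int lam s : integral_sector lam -> pairing_int (gen_degree s) lam.
Proof.
move=> /(_ s); rewrite /pairing_int /form; case: s => i //=; last by rewrite pairing0l int_num0.
by rewrite pairing0r addr0.
Qed.

(** The fermions of two summands contract only for some u_i and v_j, and then to
    a_ij.  This is 0, or else the zero of (z - w)^(a_ij) kills the contraction. *)
Lemma diff_op_sq (f g : 'I_d -> C) lam : integral_sector lam -> diff_op a f g * diff_op a f g * proj lam = 0.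
Proof.
move=> hl; have br s t : (residue_op R a s * residue_op R a t + residue_op R a t * residue_op R a s) * proj lam = 0.
  have [c hc i1] := form_gen_gen s t; have [_ _ i2] := form_gen_gen t s.
  have [h hh] := intrP (hl s); have [k hk] := intrP (hl t).
  have di : degs_int (gen_degree s) (gen_degree t) lam.
    by split => //; exact: integral_sector_pairing_int.
  rewrite (vertex_anticomm (@is_vertex_residue_op s) (@is_vertex_residue_op t) di hh hk hc) hc.
  rewrite ratr_nat; case: c {hc} => [|c]; first by rewrite mul0r mulr0 scale0r.
  by rewrite !mulr0 scale0r.
rewrite diff_op_gens; set S := \sum_s _.
have e : S * S * proj lam = \sum_s \sum_t (coef_fg f g s * coef_fg f g t) *: (residue_op R a s * residue_op R a t * proj lam).
  rewrite {1}/S mulr_suml mulr_suml; apply: eq_bigr => s _.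
  rewrite /S mulr_sumr mulr_suml; apply: eq_bigr => t _.
  by rewrite endoZl endoZr !endoZl scalerA.
have h2 : S * S * proj lam + S * S * proj lam = 0.
  rewrite {2}e exchange_big /= e -big_split big1 // => s _ /=.
  rewrite -big_split big1 // => t _ /=.
  by rewrite [coef_fg f g t * _]mulrC -scalerDr -mulrDl br scaler0.
have : (1 + 1 : C) *: (S * S * proj lam) = 0 by rewrite scalerDl scale1r.
move/(congr1 (fun A : E => (1 + 1 : C)^-1 *: A)); rewrite scalerA mulVf ?scaler0 ?scale1r //.
by rewrite (_ : 1 + 1 = 2%:R) ?pnatr_eq0.
Qed.

End Brackets.

(** * The Jacobian ideal *)

Section Jacobian.
Context (R : realType) (d : nat) (a : 'M[nat]_d).
Local Notation C := R[i].
Local Notation P := (mpoly.mpoly d C).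
Local Notation "''v_' j" := (Wvar R j) (at level 8, j at level 2).
Implicit Types (S Z : {set 'I_d}) (f : 'I_d -> C).

Definition mono (m : 'I_d -> nat) : P := \prod_j 'v_j ^+ m j.

Definition mnom (m : 'I_d -> nat) : mpoly.multinom d := mpoly.Multinom [tuple m j | j < d].

Lemma mnomE m j : mnom m j = m j. Proof. exact: mpoly.mnmE. Qed.

Lemma mpolyX_mono m : mpoly.mpolyX C (mnom m) = mono m.
Proof.
rewrite mpoly.mpolyXE_id /mono; apply: eq_bigr => j _.
by rewrite mnomE.
Qed.

Lemma mono_mpolyX (m : mpoly.multinom d) : mpoly.mpolyX C m = mono m.
Proof. exact: mpoly.mpolyXE_id. Qed.

Lemma eq_mono m m' : m =1 m' -> mono m = mono m'.
Proof. by move=> h; apply: eq_bigr => j _; rewrite h. Qed.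

Lemma monoD m m' : mono (fun j => m j + m' j)%N = mono m * mono m'.
Proof. by rewrite /mono -big_split; apply: eq_bigr => j _; rewrite exprD. Qed.

Lemma mono_delta k n : mono (fun j => n * (j == k))%N = 'v_k ^+ n.
Proof.
rewrite /mono (bigD1 k) //= eqxx muln1 big1 ?mulr1 // => j /negbTE->.
by rewrite muln0 expr0.
Qed.

Lemma meval_mono (x : 'I_d -> C) m : mpoly.meval x (mono m) = \prod_j x j ^+ m j.
Proof.
rewrite -mpolyX_mono mpoly.mevalX; apply: eq_bigr => j _.
by rewrite mnomE.
Qed.

Lemma mderiv_mono j m :
  mpoly.mderiv j (mono m) = (m j)%:R *: mono (fun z => m z - (z == j))%N.
Proof.
rewrite -!mpolyX_mono mpoly.mderivX mnomE; congr (_ *: mpoly.mpolyX _ _).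
by apply/mpoly.mnmP => z; rewrite mpoly.mnmBE mpoly.mnm1E !mnomE eq_sym.
Qed.

Lemma W_mono : W R a = \sum_i mono (a i). Proof. by []. Qed.

(** The partial derivative in x_j of sum_i f_i x^(a_i). *)
Definition dW f j : P := \sum_i (f i * (a i j)%:R) *: mono (fun z => a i z - (z == j))%N.

Lemma mderiv_W j : mpoly.mderiv j (W R a) = dW (fun=> 1) j.
Proof.
rewrite W_mono /dW linear_sum; apply: eq_bigr => i _.
by rewrite /= mderiv_mono mul1r.
Qed.

(** Membership in the ideal generated by the d_j W_f and by the x_z for z in Z. *)
Definition in_jac f Z (q : P) := exists p h : 'I_d -> P,
  q = \sum_j p j * dW f j + \sum_(z in Z) h z * 'v_z.

Lemma in_jac_lin f Z p q u v : in_jac f Z p -> in_jac f Z q -> in_jac f Z (u * p + v * q).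
Proof.
case=> p1 [h1 ->] [p2 [h2 ->]].
exists (fun j => u * p1 j + v * p2 j), (fun j => u * h1 j + v * h2 j).
rewrite !mulrDr addrACA !mulr_sumr -!big_split.
by congr (_ + _); apply: eq_bigr => j _; rewrite mulrDl !mulrA.
Qed.

Lemma in_jac_mul f Z p u : in_jac f Z p -> in_jac f Z (u * p).
Proof. by move=> h; have := in_jac_lin u 0 h h; rewrite mul0r addr0. Qed.

Lemma in_jac_add f Z p q : in_jac f Z p -> in_jac f Z q -> in_jac f Z (p + q).
Proof. by move=> h1 h2; have := in_jac_lin 1 1 h1 h2; rewrite !mul1r. Qed.

Lemma in_jac0 f Z : in_jac f Z 0.
Proof.
by exists (fun=> 0), (fun=> 0); rewrite !big1 ?addr0 // => j _; rewrite mul0r.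
Qed.

Lemma in_jac_sum f Z (I : finType) (F : I -> P) :
  (forall i, in_jac f Z (F i)) -> in_jac f Z (\sum_i F i).
Proof. by move=> h; apply: big_ind => //; [exact: in_jac0|exact: in_jac_add]. Qed.

Lemma in_jac_dW f Z j : in_jac f Z (dW f j).
Proof.
exists (fun i => (i == j)%:R), (fun=> 0).
rewrite [X in _ + X]big1 ?addr0; last by move=> z _; rewrite mul0r.
rewrite (bigD1 j) //= eqxx mul1r big1 ?addr0 // => i /negbTE->.
by rewrite mul0r.
Qed.

Lemma in_jac_var f Z z : z \in Z -> in_jac f Z 'v_z.
Proof.
move=> zZ; exists (fun=> 0), (fun i => (i == z)%:R).
rewrite [X in X + _]big1 ?add0r; last by move=> j _; rewrite mul0r.
rewrite (bigD1 z) //= eqxx mul1r big1 ?addr0 // => i /andP[_ /negbTE->].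
by rewrite mul0r.
Qed.

Lemma in_jac_scale f Z c p : in_jac f Z p -> in_jac f Z (c *: p).
Proof. by move=> h; rewrite -[p]mul1r scalerAl; exact: in_jac_mul. Qed.

Lemma in_jac_mono f Z m z : z \in Z -> (0 < m z)%N -> in_jac f Z (mono m).
Proof.
move=> zZ mz; rewrite /mono (bigD1 z) //= -(prednK mz) exprSr mulrAC.
by apply: in_jac_mul; exact: in_jac_var.
Qed.

(** s is nilpotent modulo I as soon as it is so modulo I + (x_y) and after
    inverting x_y: s^p = h x_y modulo I, and s x_y is nilpotent modulo I. *)
Lemma in_jac_split f Z y (s : P) p q : y \notin Z ->
  in_jac f (y |: Z) (s ^+ p) -> in_jac f Z ((s * 'v_y) ^+ q) -> exists r, in_jac f Z (s ^+ r).
Proof.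
move=> yZ [u [h e]] hq.
have [w e'] : exists w, in_jac f Z w /\ s ^+ p = w + h y * 'v_y.
  exists (\sum_j u j * dW f j + \sum_(z in Z) h z * 'v_z); split; first by exists u, h.
  by rewrite e big_setU1 //= addrA addrAC.
case: e' => hw e'; exists (p * q + q)%N.
rewrite exprD exprM e'.
suff hk k : exists w', in_jac f Z w' /\ (w + h y * 'v_y) ^+ k = w' + (h y * 'v_y) ^+ k.
  have [w' [hw' ->]] := hk q; rewrite mulrDl; apply: in_jac_add.
    by rewrite mulrC; exact: in_jac_mul.
  have -> : (h y * 'v_y) ^+ q * s ^+ q = h y ^+ q * (s * 'v_y) ^+ q.
    by rewrite !exprMn; ring.
  exact: in_jac_mul.
elim: k => [|k [w' [hw' IH]]]; first by exists 0; split; [exact: in_jac0|rewrite add0r].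
exists (w' * (w + h y * 'v_y) + (h y * 'v_y) ^+ k * w); split.
  by apply: in_jac_add; [rewrite mulrC; exact: in_jac_mul|exact: in_jac_mul].
by rewrite exprSr IH exprSr; ring.
Qed.

(** Invertibility of the exponent matrix puts every monomial of the potential in
    the span of the logarithmic derivatives x_j d_j W_f. *)
Lemma in_jac_row f Z i : exponent_matrix a \in unitmx -> (forall i, f i != 0) -> in_jac f Z (mono (a i)).
Proof.
move=> Au f0; set A := exponent_matrix a in Au.
pose c j : C := ratr (invmx A j i) / f i.
have key i' : \sum_j c j * (f i' * (a i' j)%:R) = (f i' / f i) * (i' == i)%:R.
  rewrite (eq_bigr (fun j => (f i' / f i) * ratr (A i' j * invmx A j i) : C)).
    rewrite -mulr_sumr -rmorph_sum; congr (_ * _).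
    have /matrixP/(_ i' i) := mulmxV Au; rewrite !mxE => ->.
    by case: eqP => _; rewrite ?rmorph1 ?rmorph0.
  by move=> j _; rewrite rmorphM /= mxE ratr_nat /c; field; exact: f0.
have -> : mono (a i) = \sum_j (c j *: 'v_j) * dW f j.
  transitivity (\sum_i' (\sum_j c j * (f i' * (a i' j)%:R)) *: mono (a i')).
    rewrite (bigD1 i) //= key eqxx mulr1 divff // scale1r.
    by rewrite big1 ?addr0 // => i' /negbTE i'i; rewrite key i'i mulr0 scale0r.
  under eq_bigr do rewrite scaler_suml.
  rewrite exchange_big; apply: eq_bigr => j _ /=.
  rewrite /dW mulr_sumr; apply: eq_bigr => i' _.
  rewrite -[RHS]scalerAl -[X in _ = _ *: X]scalerAr [RHS]scalerA.
  have [a0|an] := posnP (a i' j); first by rewrite a0 !mulr0 !scale0r.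
  congr (_ *: _).
  have -> : 'v_j = mono (fun z => 1 * (z == j))%N by rewrite mono_delta expr1.
  rewrite -monoD; apply: eq_mono => z.
  by have [->|] := eqVneq z j; lia.
by apply: in_jac_sum => j; apply: in_jac_mul; exact: in_jac_dW.
Qed.

(** Row i reads x_j times a monomial in the variables of S. *)
Definition points_to S i j := [forall z, (z \notin S) ==> (a i z == (z == j))].

Definition vprod S : P := \prod_(s in S) 'v_s.

Lemma in_jac_vprod f Z S m : (forall z, z \notin S -> m z = 0%N) ->
  in_jac f Z (mono m) -> exists r, in_jac f Z (vprod S ^+ r).
Proof.
move=> hm hI; pose N := (\sum_z m z)%N; exists N.
have hN z : (m z <= N)%N by rewrite /N (bigD1 z) //= leq_addr.
have -> : vprod S ^+ N = (\prod_(s in S) 'v_s ^+ (N - m s)) * mono m.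
  rewrite /vprod -prodrXl /mono [\prod_j _](bigID (mem S)) /=.
  rewrite [X in _ * (_ * X)]big1 ?mulr1; last by move=> z /hm ->.
  by rewrite -big_split; apply: eq_bigr => s sS; rewrite /= -exprD subnK.
exact: in_jac_mul.
Qed.

(** With the variables outside S set to zero, a row that is the only one to
    point to j survives alone in the j-th partial derivative. *)
Lemma in_jac_unique_pointer f S i j : (forall i, f i != 0) -> j \notin S -> points_to S i j ->
  (forall i', points_to S i' j -> i' = i) ->
  in_jac f (~: S) (mono (fun z => a i z - (z == j))%N).
Proof.
move=> f0 jS /forallP pij uniq.
have aij : a i j = 1%N by have := pij j; rewrite jS eqxx => /eqP.
have := in_jac_dW f (~: S) j; rewrite /dW (bigD1 i) //= aij mulr1 => h.
set q := mono _ in h *; set w := \sum_(_ | _) _ in h.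
have hw : in_jac f (~: S) w.
  rewrite /w big_mkcond; apply: in_jac_sum => i'; case: eqP => [_|i'i]; first exact: in_jac0.
  have [a0|an] := posnP (a i' j); first by rewrite a0 mulr0n mulr0 scale0r; exact: in_jac0.
  apply: in_jac_scale.
  have [z [zS az]] : exists z, z \notin S /\ (0 < a i' z - (z == j))%N.
    have /forallPn [z] : ~~ points_to S i' j by apply/negP => /uniq.
    rewrite negb_imply => /andP[zS hz]; exists z; split=> //.
    by move: hz; have [->|zj] := eqVneq z j; lia.
  by apply: (in_jac_mono _ (z := z)); rewrite // inE.
have := in_jac_lin 1 (- 1) h hw; rewrite !mul1r mulN1r addrK => /(in_jac_scale (f i)^-1).
by rewrite scalerA mulVf // scale1r.
Qed.

(** The torus points where the monomials of the potential take prescribed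
    nonzero values: take roots, then invert the exponents with the adjugate. *)
Lemma torus_point : exponent_matrix a \in unitmx -> forall l : 'I_d -> C,
  (forall i, l i != 0) -> exists2 y : 'I_d -> C, (forall j, y j != 0) &
  forall i, \prod_j y j ^+ a i j = l i.
Proof.
move=> Au l l0; pose A : 'M[int]_d := map_mx Posz a.
have eA : exponent_matrix a = map_mx (intr : int -> rat) A.
  by apply/matrixP => i j; rewrite !mxE pmulrn.
have D0 : \det A != 0.
  by move: Au; rewrite eA unitmxE det_map_mx unitfE intr_eq0.
pose n := `|\det A|%N; have n0 : (0 < n)%N by rewrite /n absz_gt0.
pose mu i := n.-root (l i).
have muK i : mu i ^+ n = l i by exact: rootCK.
have mu0 i : mu i \is a GRing.unit.
  by rewrite unitfE; apply: contraNneq (l0 i) => e; rewrite -muK e expr0n eqn0Ngt n0.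
pose w j k : int := sgz (\det A) * (\adj A) j k.
exists (fun j => \prod_k mu k ^ w j k) => [j|i].
  by apply/prodf_neq0 => k _; rewrite -unitfE unitrXz.
under eq_bigr do rewrite -prodrXl.
rewrite exchange_big /= (bigD1 i) //=.
have h k : \prod_j (mu k ^ w j k) ^+ a i j = mu k ^ (if i == k then n%:Z else 0).
  have -> : \prod_j (mu k ^ w j k) ^+ a i j = mu k ^ (\sum_j w j k * (a i j)%:Z).
    elim/big_rec2: _ => [|j x y _ ->]; first by rewrite expr0z.
    by rewrite expfzDr -?unitfE // exprnP exprz_exp.
  congr (_ ^ _).
  have /matrixP/(_ i k) := mul_mx_adj A; rewrite !mxE => e.
  under eq_bigr do rewrite /w -mulrA.
  rewrite -mulr_sumr (eq_bigr (fun j => A i j * (\adj A) j k)).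
    rewrite e; case: eqP => _; rewrite ?mulr1n ?mulr0n ?mulr0 //.
    by rewrite /n abszEsg.
  by move=> j _; rewrite mulrC !mxE.
rewrite h eqxx big1 ?mulr1 => [|k /negbTE ki]; last by rewrite h eq_sym ki expr0z.
exact: muK.
Qed.

(** On the coordinate subspace of S, either a monomial of W survives, or some
    derivative d_j W with j outside S is a single monomial.  Otherwise W vanishes
    there, all d_j W with j in S vanish, and each other d_j W is a sum of none or
    at least two monomials.  The row vectors pointing to distinct j are distinct,
    so at a suitable torus point these sums all cancel, against
    nondegeneracy. *)
Lemma pointer_exists S : BH_potential R a -> S != finset.set0 ->
  (exists i, forall z, z \notin S -> a i z = 0%N) \/
  (exists i j, [/\ j \notin S, points_to S i j & forall i', points_to S i' j -> i' = i]).
Proof.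
case=> Au _ nd /finset.set0Pn [s0 s0S].
case: (pselect (exists i, forall z, z \notin S -> a i z = 0%N)) => [?|n1]; first by left.
case: (pselect (exists i j, [/\ j \notin S, points_to S i j &
  forall i', points_to S i' j -> i' = i])) => [?|n2]; first by right.
exfalso.
have out i : exists2 z, z \notin S & (0 < a i z)%N.
  apply: contrapT => h; apply: n1; exists i => z zS; apply/eqP; rewrite -leqn0 leqNgt.
  by apply/negP => az; apply: h; exists z.
pose T j := [set i | points_to S i j].
(* a row points to at most one variable outside S *)
have Tuniq i j j' : j \notin S -> j' \notin S -> points_to S i j -> points_to S i j' -> j = j'.
  move=> jS j'S /forallP/(_ j) + /forallP/(_ j); rewrite jS eqxx /= => /eqP -> /eqP.
  by case: eqP.
have Tcard j i : j \notin S -> i \in T j -> (1 < #|T j|)%N.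
  rewrite inE => jS pij; rewrite ltnNge; apply/negP => hc; apply: n2; exists i, j; split=> // i' pi'j.
  have : (#|T j| == 1)%N by rewrite eqn_leq hc card_gt0; apply/finset.set0Pn; exists i; rewrite inE.
  case/cards1P => k Tk; have : i \in T j by rewrite inE.
  have : i' \in T j by rewrite inE.
  by rewrite Tk !inE => /eqP-> /eqP->.
(* values of the monomials: for each pointed-to j, all rows but one get 1 and the
   remaining one minus their number, which is nonzero *)
pose first j i := [pick k in T j] == Some i.
pose l i : C := if [pick j | (j \notin S) && points_to S i j] is Some j then
    (if first j i then - (#|T j|.-1)%:R else 1) else 1.
have lE i j : j \notin S -> i \in T j -> l i = if first j i then - (#|T j|.-1)%:R else 1.
  rewrite inE => jS pij; rewrite /l; case: pickP => [j' /andP[j'S pij']|/(_ j)].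
    by rewrite (Tuniq i j' j).
  by rewrite jS pij.
have l0 i : l i != 0.
  rewrite /l; case: pickP => [j /andP[jS pij]|_]; last exact: oner_neq0.
  case: ifP => _; last exact: oner_neq0.
  rewrite oppr_eq0 pnatr_eq0 -lt0n; have := Tcard j i jS; rewrite inE => /(_ pij).
  by case: #|_| => [|[]].
have lsum0 j : j \notin S -> \sum_(i in T j) l i = 0.
  move=> jS; case: (pickP (mem (T j))) => [i0 i0T|none]; last first.
    by rewrite big_pred0.
  have [k kT fk] : exists2 k, k \in T j & [pick k in T j] = Some k.
    by case: pickP => [k kT|/(_ i0) /=]; [exists k|rewrite (i0T : i0 \in T j)].
  rewrite (bigD1 k) //= (lE k j) // /first fk eqxx.
  rewrite (eq_bigr (fun=> 1)) => [|i /andP[iT ik]]; last first.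
    by rewrite (lE i j) // /first fk; case: eqP => // -[e]; rewrite e eqxx in ik.
  set m := #|T j|.-1; rewrite sumr_const (_ : #|_| = m) ?addNr // /m.
  rewrite [in RHS](cardsD1 k (T j)) kT add1n /=; apply: eq_card => i.
  by rewrite [RHS]in_setD1 [RHS]andbC.
have [y y0 yl] := torus_point Au l0.
pose x j := if j \in S then y j else 0.
have Wx : mpoly.meval x (W R a) = 0.
  rewrite W_mono raddf_sum big1 // => i _; rewrite /= meval_mono.
  have [z zS az] := out i; rewrite (bigD1 z) //= /x (negbTE zS) expr0n.
  by rewrite (gtn_eqF az) mul0r.
case: (nd x _ Wx) => [|j].
  by exists s0; rewrite /x s0S.
rewrite mderiv_W /dW raddf_sum /=.
under eq_bigr do rewrite mul1r mpoly.mevalZ meval_mono.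
case/negP; apply/eqP; have [jS|jS] := boolP (j \in S).
  apply: big1 => i _; have [z zS az] := out i.
  rewrite (bigD1 z) //= /x (negbTE zS) expr0n (_ : (z == j) = false); last first.
    by apply/negP => /eqP e; rewrite e jS in zS.
  by rewrite subn0 (gtn_eqF az) mul0r mulr0.
rewrite (bigID (fun i => i \in T j)) /= [X in _ + X]big1 ?addr0.
  rewrite (eq_bigr (fun i => (y j)^-1 * l i)) => [|i]; first by rewrite -mulr_sumr lsum0 ?mulr0.
  rewrite inE => pij; have /forallP/(_ j) := pij; rewrite jS eqxx /= => /eqP aij.
  rewrite aij mul1r -yl (bigD1 j) //= [in RHS](bigD1 j) //= aij eqxx expr0 expr1 mul1r.
  rewrite mulrA mulVf ?y0 // mul1r; apply: eq_bigr => z zj; rewrite (negbTE zj) subn0 /x.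
  case: ifP => // /negbT zS; have /forallP/(_ z) := pij; rewrite zS (negbTE zj) => /eqP->.
  by rewrite !expr0.
move=> i; rewrite inE => npij.
have [a0|an] := posnP (a i j); first by rewrite a0 mul0r.
have /forallPn [z] := npij; rewrite negb_imply => /andP[zS hz].
rewrite (bigD1 z) //= /x (negbTE zS) expr0n (_ : _ == 0%N = false) ?mul0r ?mulr0 //.
by move: hz; have [->|zj] := eqVneq z j; lia.
Qed.

(** For Z empty and S = {k} this says that x_k is nilpotent modulo the Jacobian
    ideal; general S and Z make an induction possible.  A variable y outside both
    is either set to zero (added to Z) or inverted (added to S), and
    [in_jac_split] glues the two cases.  When no variable remains, all lies on the
    torus of the coordinate subspace of S, and the ideal contains a monomial in
    the variables of S. *)
Lemma jacobian_nilpotent f : BH_potential R a -> (forall i, f i != 0) ->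
  forall S Z, S != finset.set0 -> [disjoint S & Z] -> exists r, in_jac f Z (vprod S ^+ r).
Proof.
move=> BH f0 S Z; have [n] := ubnP #|~: (S :|: Z)|; elim: n S Z => // n IH S Z hn S0 dSZ.
have [y yP|all] := pickP (mem (~: (S :|: Z))).
  move: (yP); rewrite !inE negb_or => /andP[yS yZ].
  have sub U : U = S :|: Z :|: [set y] -> (#|~: U| < n)%N.
    move=> ->; rewrite -ltnS; apply: leq_trans hn; rewrite ltnS.
    apply/proper_card/properP; split.
      by rewrite finset.setCS; exact: finset.subsetUl.
    by exists y; rewrite !inE ?eqxx ?orbT // negb_or yS.
  have dis x : (x \in S) && (x \in Z) = false.
    by case: (boolP (x \in S)) => // xS; rewrite (disjointFr dSZ xS).
  have [p hp] : exists p, in_jac f (y |: Z) (vprod S ^+ p).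
    apply: IH => //.
      by apply: sub; apply/setP => x; rewrite !inE; do !case: (_ \in _); case: (_ == _).
    apply/pred0P => x /=; rewrite !inE; have := dis x; case: eqP => [->|_] //=.
    by rewrite (negbTE yS).
  have [q hq] : exists q, in_jac f Z (vprod (y |: S) ^+ q).
    apply: IH => //.
    - by apply: sub; apply/setP => x; rewrite !inE; do !case: (_ \in _); case: (_ == _).
    - by apply/finset.set0Pn; exists y; rewrite !inE eqxx.
    apply/pred0P => x /=; rewrite !inE; have := dis x; case: eqP => [->|_] //=.
    by rewrite (negbTE yZ).
  move: hq; rewrite /vprod big_setU1 //= [_ * \prod_(_ in S) _]mulrC => hq.
  exact: (in_jac_split yZ hp hq).
have ZE : Z = ~: S.
  apply/setP => z; have := all z; rewrite !inE negb_or; move=> /negbT.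
  rewrite negb_and !negbK => /orP[zS|zZ].
    by rewrite zS (disjointFr dSZ zS).
  by rewrite zZ (disjointFl dSZ zZ).
have [Au _ _] := BH.
have [[i hi]|[i [j [jS pij uij]]]] := pointer_exists BH S0.
  by apply: in_jac_vprod (in_jac_row Z i Au f0) => z /hi.
apply: in_jac_vprod (_ : in_jac f Z (mono (fun z => a i z - (z == j))%N)); last first.
  by rewrite ZE; exact: in_jac_unique_pointer.
move=> z zS; have /forallP/(_ z) := pij; rewrite zS /= => /eqP->.
by rewrite subnn.
Qed.

End Jacobian.

(** * The lattices *)

Section Exp2pii.
Context (R : realType).
Local Notation C := R[i].
Local Notation ex := (exp2pii R).

Lemma exp2piiD s t : ex (s + t) = ex s * ex t.
Proof.
rewrite /exp2pii rmorphD /= mulrDr cosD sinD.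
by apply/eqP; rewrite eq_complex /=; apply/andP; split; apply/eqP; ring.
Qed.

Lemma exp2pii0 : ex 0 = 1.
Proof. by rewrite /exp2pii rmorph0 mulr0 cos0 sin0. Qed.

Lemma exp2pii1 : ex 1 = 1.
Proof.
by rewrite /exp2pii rmorph1 mulr1 mulr_natl cos2pi sin2pi.
Qed.

Lemma exp2piiMn t n : ex (n%:R * t) = ex t ^+ n.
Proof.
elim: n => [|n IH]; first by rewrite mul0r exp2pii0.
by rewrite -natr1 mulrDl mul1r exp2piiD IH exprSr.
Qed.

Lemma exp2pii_sum (I : finType) (F : I -> rat) : ex (\sum_i F i) = \prod_i ex (F i).
Proof. by elim/big_rec2: _ => [|i x y _ <-]; rewrite ?exp2pii0 ?exp2piiD. Qed.

Lemma exp2piiZ (k : int) : ex k%:~R = 1.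
Proof.
have h (n : nat) : ex n%:R = 1 by rewrite -[n%:R]mulr1 exp2piiMn exp2pii1 expr1n.
case: k => n; first exact: h.
have := exp2piiD (Negz n)%:~R n.+1%:R; rewrite h mulr1 => <-.
by rewrite NegzE mulrNz pmulrn addNr exp2pii0.
Qed.

(** Were the fractional part s of t positive, pi s would lie in (0, pi), where the
    sine does not vanish, against cos (2 pi s) = 1 - 2 sin^2 (pi s). *)
Lemma exp2pii_eq1 t : ex t = 1 -> t \is a Num.int.
Proof.
move=> h; pose s := t - (Num.floor t)%:~R.
have s0 : 0 <= s by rewrite subr_ge0 ge_floor // num_real.
have s1 : s < 1 by rewrite ltrBlDr addrC -[1]/(1%:~R) -intrD floorD1_gt // num_real.
have hs : ex s = 1.
  by have := exp2piiD s (Num.floor t)%:~R; rewrite subrK exp2piiZ mulr1 h.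
have [s_eq0|sn0] := eqVneq s 0.
  by rewrite -[t](subrK (Num.floor t)%:~R) -/s s_eq0 add0r intr_int.
exfalso; pose y : R := pi * ratr s.
have y0 : 0 < y by rewrite mulr_gt0 ?pi_gt0 // ltr0q lt_neqAle eq_sym sn0.
have y1 : y < pi by rewrite gtr_pMr ?pi_gt0 // -(rmorph1 ratr) ltr_rat.
have siny : 0 < sin y by rewrite sin_gt0_pi // y0.
move/eqP: hs; rewrite eq_complex /= => /andP[/eqP hc _].
have e2 : y *+ 2 = 2 * pi * ratr s by rewrite /y; ring.
have : cos (y *+ 2) = 1 by rewrite e2.
by rewrite cos_mulr2n cos2sin2 => hh; have : 0 < sin y ^+ 2 := exprn_gt0 2 siny; lra.
Qed.

End Exp2pii.

Section Lattices.
Context (R : realType) (d : nat) (a : 'M[nat]_d) (G : set ('I_d -> R[i])).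
Hypothesis BH : BH_potential R a.
Hypothesis HG : subgroup_of_AutW a G.

(** Two equal rows would make the exponent matrix singular. *)
Lemma row_inj : injective (fun i => mnom (a i)).
Proof.
case: BH => Au _ _ i i' /mpoly.mnmP h; apply/eqP/negPn/negP => ii'.
move: Au; rewrite unitmxE unitfE; case/negP; apply/eqP.
apply: (determinant_alternate ii') => j; rewrite !mxE.
by have := h j; rewrite !mnomE => ->.
Qed.

(** Comparing coefficients in W(gamma x) = W(x), the monomials of W being
    distinct. *)
Lemma AutW_rows (y : 'I_d -> R[i]) : AutW a y -> forall i, \prod_j y j ^+ a i j = 1.
Proof.
case=> _ hW i; pose c i' := \prod_j y j ^+ a i' j; rewrite -/(c i).
have : mpoly.mcoeff (mnom (a i)) (mpoly.comp_mpoly [tuple y j *: Wvar R j | j < d] (W R a))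
     = mpoly.mcoeff (mnom (a i)) (W R a) by rewrite hW.
have e : mpoly.comp_mpoly [tuple y j *: Wvar R j | j < d] (W R a) =
    \sum_i' c i' *: mono R (a i').
  rewrite W_mono linear_sum; apply: eq_bigr => i' _ /=.
  rewrite -mpolyX_mono mpoly.comp_mpolyX.
  rewrite (eq_bigr (fun j => (y j ^+ a i' j) *: Wvar R j ^+ a i' j)).
    by rewrite scaler_prod mpolyX_mono.
  by move=> j _; rewrite tnth_mktuple exprZn mnomE.
rewrite e W_mono !raddf_sum /= (bigD1 i) //= [in RHS](bigD1 i) //=.
rewrite !big1 ?addr0.
- by rewrite mpoly.mcoeffZ -mpolyX_mono mpoly.mcoeffX eqxx mulr1.
- move=> i' /negbTE i'i; rewrite -mpolyX_mono mpoly.mcoeffX.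
  by rewrite (inj_eq row_inj) i'i.
- move=> i' /negbTE i'i; rewrite mpoly.mcoeffZ -mpolyX_mono mpoly.mcoeffX.
  by rewrite (inj_eq row_inj) i'i mulr0.
Qed.

Lemma pairing_rows i (n : 'rV[rat]_d) : pairing a (delta_mx 0 i) n = \sum_j (a i j)%:R * n 0 j.
Proof.
rewrite /pairing -rowE mxE; apply: eq_bigr => j _; by rewrite !mxE.
Qed.

(** G preserves W: this is what puts u_i in M. *)
Lemma latN_row n : latN G n -> forall i, pairing a (delta_mx 0 i) n \is a Num.int.
Proof.
case: HG => GA _ _ _ /GA /AutW_rows h i; apply: (@exp2pii_eq1 R).
by rewrite pairing_rows exp2pii_sum -[RHS](h i); apply: eq_bigr => j _; rewrite exp2piiMn.
Qed.

Lemma latND n j : latN G (delta_mx 0 j + n) <-> latN G n.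
Proof.
rewrite /latN /=; set u := fun j => _; set v := fun j => _.
suff -> : u = v by [].
apply/funext => k; rewrite /u /v mxE exp2piiD mxE.
by case: (_ && _); rewrite ?exp2pii1 ?exp2pii0 mul1r.
Qed.

Lemma latN0 : latN G 0.
Proof.
case: HG => _ G1 _ _; rewrite /latN /= (_ : (fun j => _) = (fun=> 1)) //.
by apply/funext => j; rewrite mxE exp2pii0.
Qed.

Lemma latN_delta j : latN G (delta_mx 0 j).
Proof. by rewrite -[delta_mx _ _]addr0; apply/latND; exact: latN0. Qed.

Lemma latMD m i : latM a G (delta_mx 0 i + m) <-> latM a G m.
Proof.
split=> h n hn; have := h n hn; rewrite pairingDl.
  by rewrite rpredDl //; exact: latN_row.
by move=> hm; rewrite rpredD //; exact: latN_row.
Qed.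

Lemma latM_add m m' : latM a G m -> latM a G m' -> latM a G (m + m').
Proof. by move=> h h' n hn; rewrite pairingDl rpredD ?h ?h'. Qed.

Definition lattice_MN : set (degree d) := [set l | latM a G l.1 /\ latN G l.2]%classic.

Lemma lattice_MN_integral lam : lattice_MN lam -> integral_sector a lam.
Proof.
case=> hm hn [i|j]; rewrite /form /=.
  by rewrite pairing0r addr0; exact: latN_row.
by rewrite pairing0l add0r; apply: hm; exact: latN_delta.
Qed.

Lemma lattice_MN_gen s lam : lattice_MN lam -> lattice_MN (gen_degree s + lam).
Proof.
case: lam => m n [/= hm hn]; case: s => i; split=> /=; rewrite ?add0r //.
  exact/latMD.
exact/latND.
Qed.

End Lattices.

(** * Cohomology *)

Section Retraction.
Context (C : numFieldType) (V : lmodType C).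
Local Notation E := (endo V).
Implicit Types (S T U : V -> Prop) (D H N : E).

Definition subspace S := S 0 /\ forall c x y, S x -> S y -> S (c *: x + y).

Lemma subspaceD S x y : subspace S -> S x -> S y -> S (x + y).
Proof. by case=> _ h hx hy; rewrite -[x]scale1r; apply: h. Qed.
Lemma subspaceN S x : subspace S -> S x -> S (- x).
Proof. by case=> h0 h hx; rewrite -[- x]addr0 -scaleN1r; apply: h. Qed.

(** Bijectivity of the map on cohomology induced by the inclusion of S in T,
    spelled out on cocycles so that it composes and can be iterated. *)
Definition quasi_iso D S T := [/\ forall x, S x -> T x,
  forall x, T x -> D x = 0 -> exists x' z, [/\ S x', D x' = 0, T z & x - x' = D z] &
  forall x z, S x -> T z -> x = D z -> exists2 z', S z' & x = D z'].

Lemma quasi_iso_refl D S : subspace S -> quasi_iso D S S.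
Proof.
case=> S0 _; split=> // [x Sx Dx|x z _ Sz ->]; last by exists z.
by exists x, 0; rewrite subrr linear0.
Qed.

Lemma quasi_iso_trans D S T U : subspace U -> quasi_iso D S T -> quasi_iso D T U -> quasi_iso D S U.
Proof.
move=> sU [ST sur inj] [TU sur' inj']; split=> [x /ST /TU //|x Ux Dx|x z Sx Uz e].
  have [y [z [Ty Dy Uz e]]] := sur' x Ux Dx.
  have [x' [w [Sx' Dx' Tw e']]] := sur y Ty Dy.
  exists x', (z + w); split=> //; first by apply: subspaceD => //; exact: TU.
  by rewrite linearD /= -e -e' addrA subrK.
by have [w Tw e'] := inj' x z (ST _ Sx) Uz e; exact: inj Tw e'.
Qed.

(** The homotopy H shows that - N commutes with D and moves a cocycle x to
    - N x = x - D (H x), in the same class.  As N is locally nilpotent on T modulo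
    S, iterating takes cocycles into S; the same applied to a cochain z
    with D z in S makes D z a boundary in S. *)
Lemma quasi_iso_homotopy D H N S T : subspace S -> subspace T ->
  (forall x, S x -> T x) ->
  (forall x, T x -> T (D x)) -> (forall x, T x -> D (D x) = 0) ->
  (forall x, T x -> T (H x)) -> (forall x, S x -> S (H x)) ->
  (forall x, T x -> T (N x)) -> (forall x, S x -> S (N x)) ->
  (forall x, T x -> D (H x) + H (D x) = x + N x) ->
  (forall x, T x -> exists r, S (iter r N x)) -> quasi_iso D S T.
Proof.
move=> sS sT ST TD DD TH SH TN SN homotopy nil.
have DN x : T x -> D (N x) = N (D x).
  move=> Tx; have e : N x = D (H x) + H (D x) - x by rewrite homotopy // addrC addKr.
  have e' : N (D x) = D (H (D x)) - D x.
    have := homotopy (D x) (TD _ Tx); rewrite DD // linear0 addr0 => ->.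
    by rewrite addrC addKr.
  by rewrite e e' linearB linearD /= DD ?add0r //; exact: TH.
have iterN r x : iter r N (- x) = - iter r N x.
  by elim: r => //= r ->; rewrite linearN.
split=> // [x Tx|x z Sx Tz].
  have [r] := nil x Tx; elim: r x Tx => [|r IH] x Tx hr Dx.
    by exists x, 0; rewrite subrr linear0; split=> //; case: sT.
  have Ty : T (- N x) by apply: subspaceN => //; exact: TN.
  have Dy : D (- N x) = 0 by rewrite linearN /= DN // Dx linear0 oppr0.
  have hy : S (iter r N (- N x)) by rewrite iterN -iterSr; exact: subspaceN.
  have [x' [z [Sx' Dx' Tz e]]] := IH _ Ty hy Dy.
  exists x', (H x + z); split=> //; first by apply: subspaceD => //; exact: TH.
  rewrite linearD /= -e; have := homotopy x Tx; rewrite Dx linear0 addr0 => ->.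
  by rewrite addrA addrK.
have [r] := nil z Tz; elim: r x z Sx Tz => [|r IH] x z Sx Tz hr e; first by exists z.
have Dx : D x = 0 by rewrite e DD.
have Sy : S (- N x) by apply: subspaceN => //; exact: SN.
have Tw : T (- N z) by apply: subspaceN => //; exact: TN.
have hw : S (iter r N (- N z)) by rewrite iterN -iterSr; exact: subspaceN.
have ew : - N x = D (- N z) by rewrite linearN /= DN // e.
have [z' Sz' e'] := IH _ _ Sy Tw hw ew.
exists (H x + z'); first by apply: subspaceD => //; exact: SH.
rewrite linearD /= -e'; have := homotopy x (ST _ Sx); rewrite Dx linear0 addr0 => ->.
by rewrite addrK.
Qed.

Lemma quasi_iso_inclusion D S T : subspace S -> subspace T ->
  quasi_iso D S T -> inclusion_iso (D : V -> V) [set x | S x]%classic [set x | T x]%classic.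
Proof.
move=> sS sT [ST sur inj].
have inc x : S x -> inclusion_map D [set x | T x]%classic (coset_class D [set x | S x]%classic x)
    = coset_class D [set x | T x]%classic x.
  move=> Sx; apply/seteqP; split=> y /=.
    case=> u [z /= Sz e] [w /= Tw e']; exists (w + z) => /=.
      by apply: subspaceD => //; exact: ST.
    by rewrite linearD /= -e -e' addrA subrK.
  case=> z /= Tz e; exists x; last by exists z.
  by exists 0 => /=; [case: sS|rewrite subrr linear0].
split.
- move=> _ [x [/= Sx Dx] <-]; rewrite inc //; exists x => //=; split=> //; exact: ST.
- move=> c c' /set_mem [x [/= Sx Dx] <-] /set_mem [x' [/= Sx' Dx'] <-].
  rewrite !inc // => e.
  have : coset_class D [set x | T x]%classic x' x.
    by rewrite -e; exists 0 => /=; [case: sT|rewrite subrr linear0].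
  case=> z /= Tz exx'.
  have [w Sw ew] : exists2 w, S w & x - x' = D w.
    by apply: inj Tz exx'; apply: subspaceD => //; exact: subspaceN.
  apply/seteqP; split=> y /= [u /= Su eu].
    exists (u + w) => /=; first exact: subspaceD.
    by rewrite linearD /= -eu -ew addrA subrK.
  exists (u - w) => /=; first by apply: subspaceD => //; exact: subspaceN.
  by rewrite linearB /= -eu -ew opprB addrA subrK.
- move=> _ [x [/= Tx Dx] <-]; have [x' [z [Sx' Dx' Tz e]]] := sur x Tx Dx.
  exists (coset_class D [set x | S x]%classic x'); first by exists x'.
  rewrite inc //; apply/seteqP; split=> y /= [u /= Tu eu].
    exists (u - z) => /=; first by apply: subspaceD => //; exact: subspaceN.
    by rewrite linearB /= -eu -e opprB addrA subrK.
  exists (u + z) => /=; first exact: subspaceD.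
  by rewrite linearD /= -eu -e addrA subrK.
Qed.

End Retraction.

(** * Supports *)

Section Supports.
Context (R : realType) (d : nat).
Local Notation C := (CC R).
Local Notation V := (fock_mod R d).
Local Notation E := (endo V).
Local Notation proj := (@proj R d).
Implicit Types (S : set (degree d)).

(** [supported S] is Fock_S. *)
Definition supported S (x : V) := forall e : stateC d, e \in supp x -> S e.1.1.

Lemma supported_subspace S : subspace (supported S).
Proof.
split=> [e|c x y hx hy e /(fsubsetP (suppP c x y))]; first by rewrite /supp msupp0.
by rewrite inE => /orP[/hx|/hy].
Qed.

Lemma supported_sub S S' x : (forall l, S l -> S' l) -> supported S x -> supported S' x.
Proof. by move=> h hx e /hx /h. Qed.

Lemma supported_sum S (I : Type) (r : seq I) (F : I -> V) :
  (forall i, supported S (F i)) -> supported S (\sum_(i <- r) F i).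
Proof.
have [h0 h1] := supported_subspace S.
move=> h; elim/big_rec: _ => // i x _ hx; rewrite -[F i]scale1r; exact: h1.
Qed.

Lemma supportedZ S c x : supported S x -> supported S (c *: x).
Proof.
have [h0 h1] := supported_subspace S.
by move=> hx; rewrite -[_ *: _]addr0; exact: h1.
Qed.

Lemma supportedD S x y : supported S x -> supported S y -> supported S (x + y).
Proof. by have [_ h] := supported_subspace S; move=> hx hy; rewrite -[x]scale1r; exact: h. Qed.

Lemma supported_proj S lam x : S lam -> supported S (proj lam x).
Proof.
move=> Sl; rewrite [x]freeMod_sum linear_sum; apply: supported_sum => e.
rewrite linearZ /=; apply: supportedZ; rewrite projU; case: (eqVneq e.1.1 lam) => [h|_].
  by move=> k; rewrite supp_basis_vec inE => /eqP->; rewrite h.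
by case: (supported_subspace S).
Qed.

Lemma supported_map S S' (A : E) : (forall lam, S lam -> forall x, supported S' (A (proj lam x))) ->
  forall x, supported S x -> supported S' (A x).
Proof.
move=> h x hx; rewrite [x]freeMod_sum linear_sum big_seq.
have [h0 h1] := supported_subspace S'.
apply: big_ind => // [u v hu hv|e ex]; first by rewrite -[u]scale1r; exact: h1.
rewrite linearZ /=; apply: supportedZ.
have -> : ket e = proj e.1.1 (ket e) by rewrite projU eqxx.
by apply: h; exact: hx.
Qed.

Lemma sector_eq S (A B : E) : (forall lam, S lam -> A * proj lam = B * proj lam) ->
  forall x, supported S x -> A x = B x.
Proof.
move=> h x hx; rewrite [x]freeMod_sum !linear_sum big_seq [RHS]big_seq.
apply: eq_bigr => e ex; rewrite !linearZ /=; congr (_ *: _).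
have -> : ket e = proj e.1.1 (ket e) by rewrite projU eqxx.
by rewrite -[LHS]endoM -[RHS]endoM h //; exact: hx.
Qed.

(** A vertex operator of degree eta translates lattice degrees by eta. *)
Lemma is_vertex_supported (a : 'M[nat]_d) (A : E) s eta m lam h S : is_vertex a A s eta m ->
  form a eta lam = h%:~R -> S (eta + lam) -> forall x, supported S (A (proj lam x)).
Proof.
move=> hA hh Sl x; rewrite -[A _]endoM (hA _ _ hh).
have -> : shift R eta * ferm_vertex R a s eta (h - m) * proj lam =
    proj (eta + lam) * (shift R eta * ferm_vertex R a s eta (h - m)).
  by rewrite mulrA proj_shift -!mulrA (proj2 (osc_ferm_vertex R a s eta _)).
by rewrite endoZ endoM; apply: supportedZ; exact: supported_proj.
Qed.

End Supports.

(** * The homotopy *)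

Section Anticommutators.
Context (C : numFieldType) (V : lmodType C).
Implicit Types (A B H X : endo V).

Lemma anticommDl A B H X : ((A + B) * H + H * (A + B)) * X =
  (A * H + H * A) * X + (B * H + H * B) * X.
Proof. by rewrite (mulrDl A B) (mulrDr H) addrACA mulrDl. Qed.

Lemma anticomm_sumr (I : Type) (s : seq I) (c : I -> C) (F : I -> endo V) A X :
  (A * (\sum_(i <- s) c i *: F i) + (\sum_(i <- s) c i *: F i) * A) * X =
  \sum_(i <- s) c i *: ((A * F i + F i * A) * X).
Proof.
rewrite mulr_sumr mulr_suml -big_split mulr_suml; apply: eq_bigr => i _ /=.
by rewrite endoZr endoZl -scalerDr endoZl.
Qed.

Lemma anticomm_sum (I : Type) (s : seq I) (F : I -> endo V) A X :
  (A * (\sum_(i <- s) F i) + (\sum_(i <- s) F i) * A) * X =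
  \sum_(i <- s) (A * F i + F i * A) * X.
Proof. by rewrite mulr_sumr !mulr_suml -big_split mulr_suml. Qed.

Lemma anticommC A B X : (A * B + B * A) * X = (B * A + A * B) * X.
Proof. by rewrite addrC. Qed.

End Anticommutators.

Section Homotopy.
Context (R : realType) (d : nat) (a : 'M[nat]_d) (G : set ('I_d -> R[i])).
Context (f g : 'I_d -> CC R).
Hypothesis BH : BH_potential R a.
Hypothesis HG : subgroup_of_AutW a G.
Local Notation C := (CC R).
Local Notation V := (fock_mod R d).
Local Notation E := (endo V).
Local Notation proj := (@proj R d).
Local Notation shift := (@shift R d).
Local Notation residue_op := (@residue_op R d a).
Local Notation P := (mpoly.mpoly d R[i]).
Local Notation multi := (mpoly.multinom d).
Local Notation lattice_MN := (@lattice_MN R d a G).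
Context (k : 'I_d) (r : nat).

(** The element of M (x) Q whose pairing with v_l is c_l. *)
Definition dualM (c : 'rV[rat]_d) : 'rV[rat]_d := c *m invmx (exponent_matrix a).

Lemma pairing_dualM c n : pairing a (dualM c) n = (c *m n^T) 0 0.
Proof. by have [Au _ _] := BH; rewrite /pairing /dualM mulmxKV. Qed.

Lemma pairing_dualM_delta c j : pairing a (dualM c) (delta_mx 0 j) = c 0 j.
Proof. by rewrite pairing_dualM trmx_delta -colE mxE. Qed.

Lemma dualM_row i : dualM (\row_j (a i j)%:R) = delta_mx 0 i.
Proof.
have [Au _ _] := BH; rewrite /dualM (_ : \row_j _ = row i (exponent_matrix a)).
  by rewrite -row_mul mulmxV // row1.
by apply/rowP => j; rewrite !mxE.
Qed.

(** The degrees of the Laurent monomials x^m / x_k^r and x^m / (x_j x_k^r). *)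
Definition mdeg (m : 'I_d -> nat) : degree d :=
  (dualM (\row_l ((m l)%:R - (r * (l == k))%:R)), 0).
Definition mdeg1 (m : 'I_d -> nat) (j : 'I_d) : degree d :=
  (dualM (\row_l ((m l)%:R - (r * (l == k))%:R - (l == j)%:R)), 0).

(** Monomials that are not in M are sent to 0.  They contribute nothing, since
    multiplication by the u_i, which lie in M, does not mix the two kinds. *)
Definition theta (m : 'I_d -> nat) : E :=
  if `[< latM a G (mdeg m).1 >] then vertex_const R a (mdeg m) else 0.
Definition psi j (m : 'I_d -> nat) : E :=
  if `[< latM a G (mdeg1 m j).1 >] then vertex_residue R a (inr j) (mdeg1 m j) 1 else 0.

Lemma dualMD c c' : dualM (c + c') = dualM c + dualM c'.
Proof. exact: mulmxDl. Qed.

Lemma mdeg_row i j m : (0 < a i j)%N ->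
  mdeg (fun z => m z + (a i z - (z == j)))%N = gen_degree (inl i) + mdeg1 m j.
Proof.
move=> aij; rewrite /mdeg /mdeg1 /= -(dualM_row i); congr (_, _); last by rewrite addr0.
rewrite -dualMD; congr dualM; apply/rowP => z; rewrite !mxE natrD.
have [->|zj] := eqVneq z j; last by rewrite subn0 subr0; ring.
by rewrite natrB //; ring.
Qed.

(** The form vanishes between degrees in M, so the exponentials of u_i and of
    x^m / (x_j x_k^r) have neither pole nor zero.  Only the contraction a_ij of the
    fermions remains; it multiplies the two lattice exponentials. *)
Lemma bracket_psi_u i j m lam : lattice_MN lam ->
  (residue_op (inl i) * psi j m + psi j m * residue_op (inl i)) * proj lam =
  (a i j)%:R *: (theta (fun z => m z + (a i z - (z == j)))%N * proj lam).
Proof.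
move=> Ml; have Il := lattice_MN_integral BH HG Ml; case: (Ml) => lm ln.
have eM : (0 < a i j)%N -> latM a G (mdeg (fun z => m z + (a i z - (z == j)))%N).1 <->
    latM a G (mdeg1 m j).1 by move=> an; rewrite mdeg_row //; exact: latMD.
rewrite /psi; case: asboolP => [hm|hm]; last first.
  rewrite mulr0 !mul0r addr0 mul0r; have [a0|an] := posnP (a i j); first by rewrite a0 scale0r.
  by rewrite /theta asboolF ?mul0r ?scaler0 // => /(eM an).
have [h hh] := intrP (Il (inl i)).
have [h' hh'] : exists h' : int, form a (mdeg1 m j) lam = h'%:~R.
  by apply/intrP; rewrite /form /= pairing0r addr0; exact: hm.
have di : degs_int a (gen_degree (inl i)) (mdeg1 m j) lam.
  split; rewrite /pairing_int /= ?pairing0r ?int_num0 //; last exact: hm.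
  exact: (latN_row BH HG).
have hc : form a (gen_degree (inl i)) (mdeg1 m j) = 0%:R.
  by rewrite /form /= !pairing0r addr0.
rewrite (vertex_anticomm (@is_vertex_residue_op R d a (inl i))
  (@is_vertex_vertex_residue R d a (inr j) _ 1) di hh hh' hc).
have -> : form a (gen_degree (inl i)) (gen_degree (inr j)) = (a i j)%:R.
  rewrite /form /= pairing_rows pairing0l addr0 (bigD1 j) //= mxE !eqxx mulr1 big1 ?addr0 // => l /negbTE lj.
  by rewrite mxE lj andbF mulr0.
rewrite ratr_nat mulr1; have [a0|an] := posnP (a i j); first by rewrite a0 mulr0 !scale0r.
rewrite /theta asboolT; last exact/(eM an).
rewrite mdeg_row //.
have hs : form a (gen_degree (inl i) + mdeg1 m j) lam = (h + h')%:~R by rewrite formDl hh hh' intrD.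
rewrite (vertex_const_proj _ hs) scalerA.
case: di => i1 i2 i3 i4.
have -> : 0 + 1 - 1 - h - h' - 0%:Z = - (h + h') by ring.
apply: eq_scale; rewrite [(a i j)%:R * _]mulrC; congr (_ * _).
rewrite cocDr // cocDl //.
have -> : coc R a (gen_degree (inl i)) (mdeg1 m j) = 1.
  by rewrite /coc /cocycle /= pairing0r floor0.
by rewrite mul1r mulrC.
Qed.

(** The pairing of v_l with x^m / (x_j x_k^r) is m_l - delta_lj since l <> k.  It is
    negative only for l = j and m_l = 0, where it is -1 and the fermions agree. *)
Lemma bracket_psi_v l j m lam : lattice_MN lam -> l != k ->
  (residue_op (inr l) * psi j m + psi j m * residue_op (inr l)) * proj lam = 0.
Proof.
move=> Ml lk; have Il := lattice_MN_integral BH HG Ml; case: (Ml) => lm ln.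
rewrite /psi; case: asboolP => [hm|_]; last by rewrite mulr0 mul0r addr0 mul0r.
have [h hh] := intrP (Il (inr l)).
have [h' hh'] : exists h' : int, form a (mdeg1 m j) lam = h'%:~R.
  by apply/intrP; rewrite /form /= pairing0r addr0; exact: hm.
have hml : pairing a (mdeg1 m j).1 (delta_mx 0 l) = (m l)%:R - (l == j)%:R.
  by rewrite pairing_dualM_delta mxE (negbTE lk) muln0 subr0.
have di : degs_int a (gen_degree (inr l)) (mdeg1 m j) lam.
  split; rewrite /pairing_int /= ?pairing0l ?int_num0 //; last exact: hm.
  by apply: hm; exact: (latN_delta HG).
have fE : form a (gen_degree (inr l)) (mdeg1 m j) = (m l)%:R - (l == j)%:R.
  by rewrite /form /= pairing0l add0r hml.
have [/andP[/eqP lj /eqP ml]|npole] := boolP ((l == j) && (m l == 0%N)).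
  rewrite -lj in hh' di fE *.
  have hc : form a (gen_degree (inr l)) (mdeg1 m l) = - 1.
    by rewrite fE ml eqxx sub0r.
  apply: (vertex_anticomm_pole (@is_vertex_residue_op R d a (inr l)) (@is_vertex_vertex_residue R d a (inr l) _ 1) di hh hh' hc).
  by rewrite /form /= !pairing0l addr0.
have hc : form a (gen_degree (inr l)) (mdeg1 m j) = (m l - (l == j))%N%:R.
  by rewrite fE natrB //; move: npole; case: (l == j) => //=; rewrite -lt0n.
rewrite (vertex_anticomm (@is_vertex_residue_op R d a (inr l)) (@is_vertex_vertex_residue R d a (inr j) _ 1) di hh hh' hc).
rewrite (_ : form a (gen_degree (inr l)) (gen_degree (inr j)) = 0).
  by rewrite rmorph0 mul0r mulr0 scale0r.
by rewrite /form /= !pairing0l addr0.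
Qed.

(** x_k^r / x_k^r = 1. *)
Lemma theta_pow lam : lattice_MN lam -> theta (fun j => r * (j == k))%N * proj lam = proj lam.
Proof.
move=> Ml; rewrite /theta (_ : mdeg _ = 0).
  rewrite asboolT; last by move=> n _; rewrite pairing0l int_num0.
  have h0 : form a 0 lam = 0%:~R by rewrite /form /= pairing0l pairing0r addr0.
  rewrite (vertex_const_proj _ h0) oppr0 bos_vertex0 shift0 !mul1r.
  by rewrite /coc /cocycle /= pairing0l floor0 expr0z scale1r.
rewrite /mdeg (_ : \row_l _ = 0) /dualM ?mul0mx //.
by apply/rowP => l; rewrite !mxE subrr.
Qed.

Definition Theta (p : P) : E :=
  \sum_(m <- mpoly.msupp p) (mpoly.mcoeff m p : C) *: theta m.

Lemma ThetaEw (p : P) (X : seq multi) : uniq X -> {subset mpoly.msupp p <= X} ->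
  Theta p = \sum_(m <- X) (mpoly.mcoeff m p : C) *: theta m.
Proof.
move=> uX sX; rewrite /Theta.
rewrite [RHS](bigID (fun m => m \in mpoly.msupp p)) /= [X in _ + X]big1 ?addr0; last first.
  by move=> m hm; rewrite mpoly.memN_msupp_eq0 // scale0r.
rewrite -[RHS]big_filter; apply: perm_big; apply: uniq_perm.
- exact: mpoly.msupp_uniq.
- exact: filter_uniq.
- by move=> m; rewrite mem_filter; case: (boolP (m \in _)) => // /sX ->.
Qed.

Lemma ThetaP c (p q : P) : Theta (c *: p + q) = (c : C) *: Theta p + Theta q.
Proof.
pose X := undup (mpoly.msupp p ++ mpoly.msupp q ++ mpoly.msupp (c *: p + q)).
have uX : uniq X by exact: undup_uniq.
rewrite !(@ThetaEw _ X) //; try by move=> m hm; rewrite mem_undup !mem_cat hm ?orbT.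
rewrite scaler_sumr -big_split; apply: eq_bigr => m _.
by rewrite mpoly.mcoeffD mpoly.mcoeffZ scalerDl scalerA.
Qed.

Lemma Theta0 : Theta 0 = 0.
Proof. by rewrite /Theta mpoly.msupp0 big_nil. Qed.

Lemma Theta_sum (I : finType) (F : I -> P) : Theta (\sum_i F i) = \sum_i Theta (F i).
Proof.
by elim/big_rec2: _ => [|i y x _ <-]; [exact: Theta0|rewrite -[F i]scale1r ThetaP !scale1r].
Qed.

Lemma ThetaZ c p : Theta (c *: p) = (c : C) *: Theta p.
Proof. by rewrite -[c *: p]addr0 ThetaP Theta0 addr0. Qed.

Lemma theta_ext m m' : m =1 m' -> theta m = theta m'.
Proof. by move=> /funext->. Qed.

Lemma Theta_mono m : Theta (mono R m) = theta m.
Proof.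
rewrite -mpolyX_mono /Theta mpoly.msuppX big_seq1 mpoly.mcoeffX eqxx scale1r.
by apply: theta_ext => j; rewrite mnomE.
Qed.

Lemma Theta_mulr (p q : P) :
  Theta (p * q) = \sum_(m <- mpoly.msupp p) (mpoly.mcoeff m p : C) *: Theta (mono R m * q).
Proof.
rewrite {1}[p]mpoly.mpolyE mulr_suml.
rewrite (big_morph Theta (id1 := 0) (op1 := +%R)); first last.
- exact: Theta0.
- by move=> x y; rewrite -[x]scale1r ThetaP !scale1r.
by apply: eq_bigr => m _; rewrite -scalerAl ThetaZ mono_mpolyX.
Qed.

Context (p : 'I_d -> P).
Hypothesis pE : Wvar R k ^+ r = \sum_j p j * dW a f j.

Definition homotopy : E := \sum_j \sum_(m <- mpoly.msupp (p j)) (mpoly.mcoeff m (p j) : C) *: psi j m.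

Lemma bracket_homotopy (A : E) lam :
  (A * homotopy + homotopy * A) * proj lam = \sum_j \sum_(m <- mpoly.msupp (p j))
    (mpoly.mcoeff m (p j) : C) *: ((A * psi j m + psi j m * A) * proj lam).
Proof.
rewrite /homotopy anticomm_sum; apply: eq_bigr => j _; exact: anticomm_sumr.
Qed.

(** The f-part of the differential turns the relation x_k^r = sum_j p_j d_j W_f,
    divided by x_k^r, into 1. *)
Lemma bracket_homotopy_u lam : lattice_MN lam ->
  ((\sum_i f i *: residue_op (inl i)) * homotopy + homotopy * (\sum_i f i *: residue_op (inl i))) * proj lam = proj lam.
Proof.
move=> Ml; rewrite bracket_homotopy -[RHS](theta_pow Ml) -Theta_mono mono_delta pE Theta_sum mulr_suml.
apply: eq_bigr => j _; rewrite Theta_mulr mulr_suml; apply: eq_bigr => m _.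
rewrite endoZl; congr (_ *: _).
rewrite /dW [X in Theta X]mulr_sumr Theta_sum [RHS]mulr_suml anticommC anticomm_sumr.
apply: eq_bigr => i _ /=.
rewrite addrC (bracket_psi_u i j m Ml).
by rewrite -scalerAr ThetaZ -monoD Theta_mono endoZl scalerA.
Qed.

Lemma bracket_homotopy_v l lam : lattice_MN lam -> l != k ->
  (residue_op (inr l) * homotopy + homotopy * residue_op (inr l)) * proj lam = 0.
Proof.
move=> Ml lk; rewrite bracket_homotopy; apply: big1 => j _; apply: big1 => m _.
by rewrite (bracket_psi_v j m Ml lk) scaler0.
Qed.

(** All that remains of D H + H D apart from the identity: the summand of v_k has
    a pole of high order with H, because of the denominator x_k^r. *)
Definition defect : E := g k *: (residue_op (inr k) * homotopy + homotopy * residue_op (inr k)).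

Lemma bracket_diff_op lam : lattice_MN lam ->
  (diff_op a f g * homotopy + homotopy * diff_op a f g) * proj lam = (1 + defect) * proj lam.
Proof.
move=> Ml; rewrite [RHS]mulrDl mul1r.
refine (etrans (anticommDl (\sum_i f i *: residue_op (inl i)) (\sum_j g j *: residue_op (inr j)) homotopy _) _).
refine (congr2 (fun y z : E => y + z) (bracket_homotopy_u Ml) _).
refine (etrans (anticommC _ _ _) _).
refine (etrans (anticomm_sumr _ _ _ _ _) _).
rewrite (bigD1 k isT) /= [X in _ + X]big1 => [|l lk].
  by rewrite addr0 /defect endoZl anticommC.
by rewrite anticommC (bracket_homotopy_v Ml lk) scaler0.
Qed.

End Homotopy.

(** * Pushing the support into the cone *)

Section Cone.
Context (R : realType) (d : nat) (a : 'M[nat]_d) (G : set ('I_d -> R[i])).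
Context (f g : 'I_d -> CC R).
Hypothesis BH : BH_potential R a.
Hypothesis HG : subgroup_of_AutW a G.
Hypothesis f0 : forall i, f i != 0.
Local Notation C := (CC R).
Local Notation V := (fock_mod R d).
Local Notation E := (endo V).
Local Notation proj := (@proj R d).
Local Notation residue_op := (@residue_op R d a).
Local Notation P := (mpoly.mpoly d R[i]).
Local Notation lattice_MN := (@lattice_MN R d a G).
Implicit Types (Q : 'rV[rat]_d -> Prop).

Definition degrees_MN Q : set (degree d) := [set l | lattice_MN l /\ Q l.2]%classic.

Lemma residue_op_supported s Q Q' : (forall n, Q n -> Q' ((gen_degree s).2 + n)) ->
  forall x, supported (degrees_MN Q) x -> supported (degrees_MN Q') (residue_op s x).
Proof.
move=> hQ; apply: supported_map => lam [Ml Ql] x.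
have [h hh] := intrP (lattice_MN_integral BH HG Ml s).
apply: (is_vertex_supported (@is_vertex_residue_op R d a s) hh).
by split; [exact: lattice_MN_gen|exact: hQ].
Qed.

Lemma homotopy_supported k r (p : 'I_d -> P) Q x : supported (degrees_MN Q) x ->
  supported (degrees_MN Q) (homotopy a G k r p x).
Proof.
apply: supported_map => lam [Ml Ql] y; rewrite /homotopy endo_sum; apply: supported_sum => j.
rewrite endo_sum; apply: supported_sum => m; rewrite endoZ; apply: supportedZ.
rewrite /psi; case: asboolP => [hm|_]; last by case: (supported_subspace R (degrees_MN Q)).
case: (Ml) => lm ln.
have [h hh] : exists h : int, form a (mdeg1 a k r m j) lam = h%:~R.
  by apply/intrP; rewrite /form /= pairing0r addr0; exact: hm.
apply: (is_vertex_supported (@is_vertex_vertex_residue R d a (inr j) _ 1) hh).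
split; last by rewrite /= add0r.
by split => /=; [exact: latM_add|rewrite add0r].
Qed.

Lemma diff_op_supported Q x : (forall n j, Q n -> Q (delta_mx 0 j + n)) ->
  supported (degrees_MN Q) x -> supported (degrees_MN Q) (diff_op a f g x).
Proof.
move=> hQ hx; rewrite diff_op_gens endo_sum; apply: supported_sum => s; rewrite endoZ; apply: supportedZ.
by apply: residue_op_supported hx => n Qn; case: s => i; rewrite /= ?add0r //; exact: hQ.
Qed.

Definition cone n (v : 'rV[rat]_d) := forall j : 'I_d, (j < n)%N -> 0 <= v 0 j.
(** Interpolates between Fock_{M + N} at n = 0 and Fock_{M + K_N} at n = d. *)
Definition stage n : V -> Prop := supported (degrees_MN (cone n)).

Lemma delta_ge0 i j : 0 <= (delta_mx 0 i : 'rV[rat]_d) 0 j.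
Proof. by rewrite mxE; case: (_ && _). Qed.

Lemma cone_delta n v j : cone n v -> cone n (delta_mx 0 j + v).
Proof. by move=> h i hi; rewrite mxE addr_ge0 ?delta_ge0 ?h. Qed.

(** The defect raises the k-th coordinate by one, so from a vector whose k-th
    coordinates are at least - M, its M-th power reaches the nonnegative ones. *)
Lemma stage_step (k : 'I_d) : quasi_iso (diff_op a f g) (stage k.+1) (stage k).
Proof.
have dis : [disjoint [set k]%SET & (finset.set0 : {set 'I_d})].
  by apply/pred0P => j /=; rewrite !inE andbF.
have [r [p [h pE]]] := jacobian_nilpotent BH f0 (S := [set k]%SET) (Z := finset.set0)
  (introT (finset.set0Pn _) (ex_intro _ k (finset.set11 k))) dis.
have {}pE : Wvar R k ^+ r = \sum_j p j * dW a f j.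
  by move: pE; rewrite big_set0 addr0 /vprod big_set1.
pose H := homotopy a G k r p; pose N : E := defect a G g k r p.
pose low (q : nat) (v : 'rV[rat]_d) := cone k v /\ - q%:R <= v 0 k.
have sub x : stage k.+1 x -> stage k x.
  by apply: supported_sub => l [Ml hl]; split=> // j jk; apply: hl; exact: ltnW.
have NE x : N x = g k *: (residue_op (inr k) (H x) + H (residue_op (inr k) x)) by [].
have N_stage n x : stage n x -> stage n (N x).
  move=> hx; have hR y : stage n y -> stage n (residue_op (inr k) y).
    by apply: residue_op_supported => v; exact: cone_delta.
  rewrite NE; apply: supportedZ; apply: supportedD.
    by apply: hR; exact: homotopy_supported.
  by apply: homotopy_supported; exact: hR.
have N_low q x : supported (degrees_MN (low q.+1)) x -> supported (degrees_MN (low q)) (N x).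
  have hR y : supported (degrees_MN (low q.+1)) y -> supported (degrees_MN (low q)) (residue_op (inr k) y).
    apply: residue_op_supported => v [hv vk]; split; first exact: cone_delta.
    have -> : ((gen_degree (inr k)).2 + v) 0 k = 1 + v 0 k by rewrite !mxE !eqxx.
    by move: vk; rewrite -natr1; lra.
  move=> hx; rewrite NE; apply: supportedZ; apply: supportedD.
    by apply: hR; exact: homotopy_supported.
  by apply: homotopy_supported; exact: hR.
apply: (quasi_iso_homotopy (H := H) (N := N)) => //; try exact: supported_subspace.
- by move=> x; apply: diff_op_supported => v j; exact: cone_delta.
- move=> x hx; rewrite -[LHS]endoM -[RHS](endo0 (V := V) x).
  apply: (sector_eq (S := degrees_MN (cone k))) => // lam [Ml _].
  by rewrite mul0r; apply: diff_op_sq; exact: lattice_MN_integral Ml.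
- by move=> x; exact: homotopy_supported.
- by move=> x; exact: homotopy_supported.
- exact: N_stage.
- exact: N_stage.
- move=> x hx; have := sector_eq (S := degrees_MN (cone k))
    (A := diff_op a f g * H + H * diff_op a f g) (B := 1 + N) _ hx.
  by apply=> lam [Ml _]; exact: bracket_diff_op.
move=> x hx.
have [M hM] := fset_bound (supp x) (fun e : stateC d => Num.floor (e.1.1.2 0 k)).
have : supported (degrees_MN (low M)) x.
  move=> e ex; have [Ml cl] := hx e ex; split=> //; split=> //.
  apply: le_trans (floor_le _); rewrite pmulrn -intrN ler_int.
  by have := hM e ex; rewrite ler_norml => /andP[].
exists M; elim: M x {hM hx} H0 => [|M IH] x hx.
  apply: supported_sub hx => l [Ml [cl lk]]; split=> // j; rewrite ltnS leq_eqVlt => /orP[/eqP jk|]; last exact: cl.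
  by rewrite (val_inj jk) -oppr0.
by rewrite -/(iter M.+1 N x) iterSr; apply: IH; exact: N_low.
Qed.

Lemma stage_iso n : (n <= d)%N -> quasi_iso (diff_op a f g) (stage n) (stage 0).
Proof.
elim: n => [|n IH] hn; first by apply: quasi_iso_refl; exact: supported_subspace.
apply: quasi_iso_trans (IH (ltnW hn)); first exact: supported_subspace.
exact: (stage_step (Ordinal hn)).
Qed.

End Cone.

Transparent freeMod.

Local Open Scope classical_set_scope.

Theorem theorem5p2p3 (R : realType) (d : nat) (a : 'M[nat]_d)
    (G : set ('I_d -> R[i])) (f g : 'I_d -> R[i])
    (HW : BH_potential R a) (HG : subgroup_of_AutW a G)
    (Hf : forall i, f i != 0) (Hg : forall j, g j != 0) :
  inclusion_iso (Dfg a f g) (Fock_MKN a G) (Fock_MN a G).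
Proof.
have -> : Dfg a f g = diff_op a (f : 'I_d -> CC R) g by apply/funext => x; exact: DfgE.
have -> : Fock_MKN a G = [set x | stage a G d (x : fock_mod R d)]%classic.
  apply/seteqP; split=> x hx e ex; have := hx e ex.
    by case=> hM [hN hK]; split=> // j _; exact: hK.
  by case=> -[hM hN] hK; split=> //; split=> // j; exact: hK.
have -> : Fock_MN a G = [set x | stage a G 0 (x : fock_mod R d)]%classic.
  apply/seteqP; split=> x hx e ex; have := hx e ex.
    by move=> h; split.
  by case.
apply: quasi_iso_inclusion; try exact: supported_subspace.
exact: stage_iso.
Qed.
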